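(* Let $$\bar f(z)=\frac{\beta u_0}{r}-\frac1r\,\frac{\alpha_2e^{\alpha_1z}+\alpha_1e^{-\alpha_2z}}{(\alpha_1+\alpha_2)e^{\alpha_1d}},\quad z\in[0,d],$$ $$\bar g(z)=\frac{\beta u_0-1}{r}+\frac1r\,\frac{\alpha_1(e^{\alpha_1d}-e^{-\alpha_2d})}{(\alpha_1+\alpha_2)e^{\alpha_1d}}\,e^{-\alpha_2(z-d)},\quad z>d.$$ Then $v(z)=\bar f(z)\mathbf 1_{[0,d]}(z)+\bar g(z)\mathbf 1_{(d,\infty)}(z)$ for all $z\ge0$ if and only if $$\beta\ge\zeta:=\frac{\alpha_1\alpha_2(e^{\alpha_1d}-e^{-\alpha_2d})}{r(\alpha_1+\alpha_2)e^{\alpha_1d}}\ (>0).$$ In this case, the strategy $U(t)=u_0$ for all $t\ge0$ is optimal.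
   Context: Let $(\Omega,\mathcal F,\mathbb P)$ be a complete probability space carrying a standard Brownian motion $W$. Fix $\mu\in\mathbb R$, $\sigma>0$, $u_0>0$, $r>0$, $\beta>0$, $d>0$. Let $\mathcal U$ be the set of adapted processes $U$ with $0\le U(t)\le u_0$. For $U\in\mathcal U$: $X^U(t)=\mu t+\sigma W(t)-\int_0^tU(s)\,ds$, $M_z^U(t)=\max\{z,\sup_{s\le t}X^U(s)\}$, $\Delta_z^U(t)=M_z^U(t)-X^U(t)$ for $z\ge0$; $v^U(z)=\mathbb E\big[\beta\int_0^\infty e^{-rt}U(t)\,dt-\int_0^\infty e^{-rt}\mathbf 1_{\{\Delta_z^U(t)>d\}}\,dt\big]$ and $v(z)=\sup_{U\in\mathcal U}v^U(z)$. A strategy $U^*$ is optimal if $v^{U^*}(z)=v(z)$. For $u\in[0,u_0]$ let $\theta_1(u)=\frac{\sqrt{(\mu-u)^2+2r\sigma^2}+(\mu-u)}{\sigma^2}$, $\theta_2(u)=\frac{\sqrt{(\mu-u)^2+2r\sigma^2}-(\mu-u)}{\sigma^2}$, and write $\alpha_1=\theta_1(u_0)$, $\alpha_2=\theta_2(u_0)$. *)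

(* Defs.v *)
From HB Require Import structures.
From mathcomp Require Import all_boot all_order all_algebra.
From mathcomp Require Import all_classical all_reals all_analysis.
Set Implicit Arguments.
Unset Strict Implicit.
Unset Printing Implicit Defensive.
Import Order.TTheory GRing.Theory Num.Theory.
Import numFieldNormedType.Exports.
Local Open Scope classical_set_scope.
Local Open Scope ring_scope.

Section Defs.
Variables (R : realType) (dm : measure_display) (T : measurableType dm).
Variable (P : probability T R).

Definition complete_prob_space : Prop :=
  forall N : set T, measurable N -> P N = 0%E ->
    forall A : set T, A `<=` N -> measurable A.

Definition nat_filtration (W : R -> T -> R) (t : R) : set (set T) :=
  <<s [set A : set T |
         (exists s : R, exists B : set R,
             0 <= s <= t /\ measurable B /\ A = (W s) @^-1` B)
      \/ (measurable A /\ P A = 0%E)] >>.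

Definition standard_BM (W : R -> T -> R) : Prop :=
  [/\ forall w, W 0 w = 0,
      forall w, {within [set t : R | 0 <= t], continuous (fun t => W t w)},
      forall t, 0 <= t -> measurable_fun setT (W t),
      forall s t, 0 <= s -> s < t -> forall B : set R, measurable B ->
        P [set w | B (W t w - W s w)%R] = normal_prob 0 (Num.sqrt (t - s)) B
    & forall s t, 0 <= s -> s < t -> forall A : set T,
        nat_filtration W s A -> forall B : set R, measurable B ->
        P (A `&` [set w | B (W t w - W s w)%R])
          = (P A * P [set w | B (W t w - W s w)%R])%E ].

Definition admissible (W : R -> T -> R) (u0 : R) (U : R -> T -> R) : Prop :=
  [/\ measurable_fun setT (fun p : R * T => U p.1 p.2),
      forall t, 0 <= t -> forall B : set R, measurable B ->
        nat_filtration W t ((U t) @^-1` B)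
    & forall t w, 0 <= t -> 0 <= U t w <= u0 ].

Definition Uset (W : R -> T -> R) (u0 : R) : set (R -> T -> R) :=
  [set U | admissible W u0 U].

Definition Xproc (W : R -> T -> R) (mu sigma : R) (U : R -> T -> R)
  (t : R) (w : T) : R :=
  mu * t + sigma * W t w - Rintegral lebesgue_measure `[0, t] (fun s => U s w).

Definition Mproc (W : R -> T -> R) (mu sigma : R) (U : R -> T -> R) (z : R)
  (t : R) (w : T) : R :=
  Num.max z (sup [set Xproc W mu sigma U s w | s in `[0, t]]).

Definition Dproc (W : R -> T -> R) (mu sigma : R) (U : R -> T -> R) (z : R)
  (t : R) (w : T) : R :=
  Mproc W mu sigma U z t w - Xproc W mu sigma U t w.

Definition vU (W : R -> T -> R) (mu sigma r beta d : R) (U : R -> T -> R)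
  (z : R) : \bar R :=
  (\int[P]_w
     (beta * Rintegral lebesgue_measure `[0, +oo[
                 (fun t => expR (- r * t) * U t w)
      - Rintegral lebesgue_measure `[0, +oo[
                 (fun t => expR (- r * t) *
                           (if (d < Dproc W mu sigma U z t w)%R then 1 else 0)))%:E)%E.

Definition vfun (W : R -> T -> R) (mu sigma u0 r beta d : R) (z : R) : \bar R :=
  ereal_sup [set vU W mu sigma r beta d U z | U in Uset W u0].

End Defs.

Section Explicit.
Variable R : realType.

Definition theta1 (mu sigma r u : R) : R :=
  (Num.sqrt ((mu - u) ^+ 2 + 2 * r * sigma ^+ 2) + (mu - u)) / sigma ^+ 2.
Definition theta2 (mu sigma r u : R) : R :=
  (Num.sqrt ((mu - u) ^+ 2 + 2 * r * sigma ^+ 2) - (mu - u)) / sigma ^+ 2.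

(** fbar on [0,d], gbar on (d,oo), with a1 = theta1(u0), a2 = theta2(u0). *)
Definition fbar (a1 a2 u0 r beta d z : R) : R :=
  beta * u0 / r
  - r^-1 * ((a2 * expR (a1 * z) + a1 * expR (- a2 * z))
            / ((a1 + a2) * expR (a1 * d))).
Definition gbar (a1 a2 u0 r beta d z : R) : R :=
  (beta * u0 - 1) / r
  + r^-1 * ((a1 * (expR (a1 * d) - expR (- a2 * d)))
            / ((a1 + a2) * expR (a1 * d))) * expR (- a2 * (z - d)).
Definition zeta (a1 a2 r d : R) : R :=
  (a1 * a2 * (expR (a1 * d) - expR (- a2 * d)))
  / (r * (a1 + a2) * expR (a1 * d)).

End Explicit.

(* Main.v *)
Require Import Defs.
From HB Require Import structures.
From mathcomp Require Import all_boot all_order all_algebra.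
From mathcomp Require Import all_classical all_reals all_analysis.
From mathcomp Require Import measurable_realfun ring lra.
Import Order.TTheory GRing.Theory Num.Theory.
Import numFieldNormedType.Exports.
Set Implicit Arguments.
Unset Strict Implicit.
Unset Printing Implicit Defensive.
Local Open Scope classical_set_scope.
Local Open Scope ring_scope.

(* The candidate value V (fbar on [0, d], gbar beyond d, constant below 0) is C^1 with
   V'(0) = 0, and V' attains its minimum -zeta at d. For every admissible U,
     V(z) - v^U(z) = E int_0^oo exp(-r t) (u0 - U_t) (beta + V'(Delta_t)) dt.
   If beta >= zeta the right-hand side is nonnegative, and it vanishes for U = u0. If
   beta < zeta, start from z = d and pay nothing during a short initial period: there
   beta + V'(Delta) is close to beta - zeta < 0, so this strategy beats V(d).

   The identity is Dynkin's formula for the drawdown, obtained here without stochastic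
   integration. On a grid the drawdown follows D' = max(0, D - Y), where Y is the increment of
   X, and a test function that is constant below 0 does not see the truncation; Taylor's
   formula and the independence of the increments from the past leave a one-step error of
   order h^(3/2). Letting the mesh h tend to 0 and averaging over an exponential time of rate r
   gives the formula in resolvent form for smooth test functions, then for V by backward
   difference quotients. The jump of V'' at 0 does not matter because P(Delta_t = 0) = 0. *)

(** * Integrals of bounded functions *)

(** [admissible] asks for joint measurability and for adaptedness at each fixed time, not for
    progressive measurability. That the integral of U up to t is known at time t, on which
    independence from the next increment rests, must therefore be proved; completeness and the null
    sets in [nat_filtration] enter there. The exponential law is a probability, so every discounted
    quantity is an average of a bounded function under two probabilities, and bounded convergence
    with Fubini suffices. In resolvent form the differential equation of V can be inserted directly:
    under full payment r V - L V equals the running payoff, and since the control enters the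
    generator L linearly, paying U instead of u0 leaves exactly (u0 - U)(beta + V'). V'' jumps at 0
    and at d. At d the left second derivative agrees with the strict inequality in the penalty, so
    the equation holds there. At 0 the left second derivative is that of the constant extension and
    the equation fails, so the time spent at 0 has to be shown negligible; this is done by comparing
    first and second moments of sums of normalised Brownian increments. *)

Section BoundedIntegrals.
Context d (T : measurableType d) (R : realType) (mu : {measure set T -> \bar R}).
Implicit Types (D : set T) (f g : T -> R) (C : R).

Lemma bounded_integrable D f C : measurable D -> (mu D < +oo)%E ->
  measurable_fun D f -> (forall x, D x -> `|f x| <= C) ->
  mu.-integrable D (EFin \o f).
Proof.
move=> mD Dfin mf fC; apply: measurable_bounded_integrable => //.
exists C; split; first exact: num_real.
by move=> M CM x Dx /=; rewrite (le_trans (fC _ Dx)) // ltW.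
Qed.

Lemma EFin_Rintegral D f : measurable D -> mu.-integrable D (EFin \o f) ->
  (\int[mu]_(x in D) (f x)%:E = (Rintegral mu D f)%:E)%E.
Proof. by move=> mD fi; rewrite /Rintegral fineK//; exact: integrable_fin_num. Qed.

Lemma Rintegral_bound D f C : measurable D -> (mu D < +oo)%E ->
  measurable_fun D f -> (forall x, D x -> `|f x| <= C) ->
  `|Rintegral mu D f| <= C * fine (mu D).
Proof.
move=> mD Dfin mf fC; have fi := bounded_integrable mD Dfin mf fC.
apply: (le_trans (le_normr_Rintegral mD fi)).
rewrite -(Rintegral_cst mu mD); apply: le_Rintegral => //.
  apply: (bounded_integrable (C := C)) => //; first exact: measurableT_comp.
  by move=> x Dx; rewrite normr_id fC.
by apply: (bounded_integrable (C := `|C|)).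
Qed.

Lemma bounded_convergence D (f_ : nat -> T -> R) f C :
  measurable D -> (mu D < +oo)%E ->
  (forall n, measurable_fun D (f_ n)) -> measurable_fun D f ->
  (forall n x, D x -> `|f_ n x| <= C) ->
  (forall x, D x -> f_ n x @[n --> \oo] --> f x) ->
  Rintegral mu D (f_ n) @[n --> \oo] --> Rintegral mu D f.
Proof.
move=> mD Dfin mf_ mf fC cf.
have Ci : mu.-integrable D (EFin \o (fun=> `|C|)).
  by apply: (bounded_integrable (C := `|C|)) => //; rewrite normr_id.
have mE_ n : measurable_fun D (EFin \o f_ n) by exact/measurable_EFinP.
have mE : measurable_fun D (EFin \o f) by exact/measurable_EFinP.
have [] := dominated_convergence mD mE_ mE _ Ci.
- by apply: aeW => x Dx; apply: cvg_EFin; [exact: nearW|exact: cf].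
- by apply: aeW => x n Dx /=; rewrite lee_fin (le_trans (fC _ _ Dx)) ?ler_norm.
move=> fi _ H.
rewrite /Rintegral; apply: fine_cvg.
by rewrite fineK //; exact: integrable_fin_num.
Qed.

End BoundedIntegrals.

Section BoundedFubini.
Context d1 d2 (T1 : measurableType d1) (T2 : measurableType d2) (R : realType).
Variables (m1 : {sigma_finite_measure set T1 -> \bar R})
  (m2 : {sigma_finite_measure set T2 -> \bar R}).
Variables (D1 : set T1) (D2 : set T2) (H : T1 -> T2 -> R) (C : R).
Hypotheses (mD1 : measurable D1) (mD2 : measurable D2).
Hypotheses (D1fin : (m1 D1 < +oo)%E) (D2fin : (m2 D2 < +oo)%E).
Hypothesis mH : measurable_fun setT (fun p : T1 * T2 => H p.1 p.2).
Hypothesis HC : forall x y, `|H x y| <= C.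

Lemma measurable_slice1 x : measurable_fun setT (H x).
Proof. exact: (measurableT_comp mH (measurable_pair1 x)). Qed.

Lemma measurable_slice2 y : measurable_fun setT (H ^~ y).
Proof. exact: (measurableT_comp mH (measurable_pair2 y)). Qed.

(** Adding the bound C makes the integrand nonnegative, and the indicators move both domains into
    it, so Tonelli applies. The surplus C m1(D1) m2(D2) is the same in both orders and is cancelled
    at the end. *)
Let f (p : T1 * T2) : \bar R :=
  ((H p.1 p.2 + C) * \1_D1 p.1 * \1_D2 p.2)%:E.

Let f_ge0 p : (0 <= f p)%E.
Proof.
rewrite lee_fin !mulr_ge0 //.
by rewrite -lerBlDr sub0r; have := HC p.1 p.2; rewrite ler_norml => /andP[].
Qed.

Let mf : measurable_fun setT f.
Proof.
apply/measurable_EFinP; apply: measurable_funM; first apply: measurable_funM.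
- exact: measurable_funD.
- exact: measurableT_comp (measurable_indic mD1) measurable_fst.
- exact: measurableT_comp (measurable_indic mD2) measurable_snd.
Qed.

Let integrable_slice1 x : m2.-integrable D2 (EFin \o H x).
Proof.
by apply: (bounded_integrable (C := C)) => //; apply: measurable_funTS; exact: measurable_slice1.
Qed.

Let f_inner x : (\int[m2]_y f (x, y) =
  (\1_D1 x * (Rintegral m2 D2 (H x) + C * fine (m2 D2)))%:E)%E.
Proof.
under eq_integral do rewrite /f /= -mulrA mulrCA EFinM.
have Ci : m2.-integrable D2 (EFin \o (fun=> C)).
  by apply: (bounded_integrable (C := `|C|)).
have HCi : m2.-integrable D2 (EFin \o (fun y => H x y + C)).
  by apply: (eq_integrable _ _ _ _ (integrableD mD2 (integrable_slice1 x) Ci)).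
rewrite integralZl //.
  rewrite EFinM; congr (_ * _)%E.
  rewrite -(Rintegral_cst m2 mD2) -RintegralD// -EFin_Rintegral//.
  rewrite [RHS]integral_mkcond; apply: eq_integral => y _.
  rewrite patchE indicE; case: ifPn => _; by rewrite /= ?mulr1 ?mulr0.
rewrite (_ : (fun y => _) = (EFin \o (fun y => H x y + C)) \_ D2).
  exact/(integrable_mkcond _ mD2).
apply/funext => y; rewrite patchE indicE; case: ifPn => _; by rewrite /= ?mulr1 ?mulr0.
Qed.

Lemma measurable_Rintegral_slice1 :
  measurable_fun D1 (fun x => Rintegral m2 D2 (H x)).
Proof.
have : measurable_fun setT (fubini_F m2 f).
  exact: measurable_fun_fubini_tonelli_F.
rewrite (_ : fubini_F _ _ = EFin \o (fun x => \1_D1 x * (Rintegral m2 D2 (H x) + C * fine (m2 D2)))); last first.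
  by apply/funext => x; rewrite /fubini_F f_inner.
move=> /measurable_EFinP h.
have : measurable_fun D1 ((fun x => \1_D1 x * (Rintegral m2 D2 (H x) + C * fine (m2 D2))) \- cst (C * fine (m2 D2))).
  by apply: measurable_funB => //; exact: measurable_funTS.
apply: eq_measurable_fun => x xD.
by rewrite /= indicE xD mul1r addrK.
Qed.

Lemma Rintegral_inner_integral :
  (\int[m1]_x \int[m2]_y f (x, y) =
   (Rintegral m1 D1 (fun x => Rintegral m2 D2 (H x)) + C * fine (m2 D2) * fine (m1 D1))%:E)%E.
Proof.
under eq_integral do rewrite f_inner.
have b x : D1 x -> `|Rintegral m2 D2 (H x)| <= C * fine (m2 D2).
  by move=> _; apply: Rintegral_bound => //; apply: measurable_funTS; exact: measurable_slice1.
have i1 : m1.-integrable D1 (EFin \o (fun x => Rintegral m2 D2 (H x))).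
  apply: (bounded_integrable (C := C * fine (m2 D2))) => //.
  exact: measurable_Rintegral_slice1.
have i2 : m1.-integrable D1 (EFin \o (fun=> C * fine (m2 D2))).
  by apply: (bounded_integrable (C := `|C * fine (m2 D2)|)).
rewrite -(Rintegral_cst m1 mD1) -RintegralD// -EFin_Rintegral//; last first.
  by apply: (eq_integrable _ _ _ _ (integrableD mD1 i1 i2)).
rewrite [RHS]integral_mkcond; apply: eq_integral => x _.
rewrite patchE indicE; case: ifPn => _; by rewrite /= ?mul1r ?mul0r.
Qed.

End BoundedFubini.

Lemma Rintegral_Fubini d1 d2 (T1 : measurableType d1) (T2 : measurableType d2)
    (R : realType) (m1 : {sigma_finite_measure set T1 -> \bar R})
    (m2 : {sigma_finite_measure set T2 -> \bar R})
    (D1 : set T1) (D2 : set T2) (H : T1 -> T2 -> R) (C : R) :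
  measurable D1 -> measurable D2 -> (m1 D1 < +oo)%E -> (m2 D2 < +oo)%E ->
  measurable_fun setT (fun p : T1 * T2 => H p.1 p.2) ->
  (forall x y, `|H x y| <= C) ->
  \int[m1]_(x in D1) (\int[m2]_(y in D2) H x y) =
  \int[m2]_(y in D2) (\int[m1]_(x in D1) H x y).
Proof.
move=> mD1 mD2 D1f D2f mH HC.
have mH' : measurable_fun setT (fun p : T2 * T1 => H p.2 p.1).
  exact: (measurableT_comp mH (@measurable_swap _ _ _ _)).
have HC' y x : `|H x y| <= C by [].
have e1 := Rintegral_inner_integral mD1 mD2 D1f D2f mH HC.
have e2 := @Rintegral_inner_integral _ _ _ _ _ m2 m1 D2 D1 (fun y x => H x y) C
  mD2 mD1 D2f D1f mH' HC'.
apply: (addIr (C * fine (m2 D2) * fine (m1 D1))).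
rewrite [in RHS]mulrAC; apply: EFin_inj; rewrite -[LHS]e1 -[RHS]e2.
pose f (p : T1 * T2) := ((H p.1 p.2 + C) * \1_D1 p.1 * \1_D2 p.2)%:E.
transitivity (\int[m2]_y \int[m1]_x f (x, y))%E; last first.
  by apply: eq_integral => y _; apply: eq_integral => x _; rewrite /f /= mulrAC.
apply: (@fubini_tonelli _ _ _ _ _ m1 m2 f) => //.
  apply/measurable_EFinP; apply: measurable_funM; first apply: measurable_funM.
  - exact: measurable_funD.
  - exact: measurableT_comp (measurable_indic mD1) measurable_fst.
  - exact: measurableT_comp (measurable_indic mD2) measurable_snd.
move=> p; rewrite lee_fin !mulr_ge0 //.
by rewrite -lerBlDr sub0r; have := HC p.1 p.2; rewrite ler_norml => /andP[].
Qed.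

Lemma probability_fin d (T : measurableType d) (R : realType)
  (P : probability T R) : (P setT < +oo)%E.
Proof. by rewrite probability_setT ltry. Qed.

Lemma Rintegral_probability_cst d (T : measurableType d) (R : realType)
  (P : probability T R) (c : R) : \int[P]_w c = c.
Proof.
rewrite Rintegral_cst//; have -> : fine (P setT) = 1; last by rewrite mulr1.
by rewrite probability_setT.
Qed.

Lemma probability_integrable d (T : measurableType d) (R : realType)
    (P : probability T R) (f : T -> R) (C : R) :
  measurable_fun setT f -> (forall w, `|f w| <= C) ->
  P.-integrable setT (EFin \o f).
Proof.
move=> mf fC.
exact: (bounded_integrable measurableT (probability_fin P) mf (fun x _ => fC x)).
Qed.

Lemma Rintegral_probability_bound d (T : measurableType d) (R : realType)
    (P : probability T R) (f : T -> R) (C : R) :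
  measurable_fun setT f -> (forall w, `|f w| <= C) -> `|\int[P]_w f w| <= C.
Proof.
move=> mf fC.
apply: le_trans (Rintegral_bound measurableT (probability_fin P) mf (fun x _ => fC x)) _.
have -> : fine (P setT) = 1; last by rewrite mulr1.
by rewrite probability_setT.
Qed.

(** * Integration against a measure with a density *)

Section Density.
Local Open Scope ereal_scope.
Context d (T : measurableType d) (R : realType).
Variables (mu nu : {measure set T -> \bar R}) (p : T -> R).
Hypotheses (p_ge0 : forall x, (0 <= p x)%R) (mp : measurable_fun setT p).
Hypothesis nuE : forall A, measurable A -> nu A = \int[mu]_(x in A) (p x)%:E.

Import HBNNSimple.

(** For simple functions this is linearity and [nuE]; monotone convergence does the rest. It serves
    both the normal and the exponential law. *)
Lemma ge0_integral_density (f : T -> \bar R) : measurable_fun setT f ->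
  (forall x, 0 <= f x) -> \int[nu]_x f x = \int[mu]_x (f x * (p x)%:E).
Proof.
move=> mf f0; pose h := nnsfun_approx measurableT mf.
have mpE : measurable_fun setT (EFin \o p) by exact/measurable_EFinP.
have cnu : \int[nu]_x (EFin \o h n) x @[n --> \oo] --> \int[nu]_x f x.
  rewrite (eq_integral (fun x => limn (fun n => (h n x)%:E))); last first.
    by move=> x _; apply/esym/cvg_lim => //; exact: cvg_nnsfun_approx.
  apply: cvg_monotone_convergence => //.
  - by move=> n; apply/measurable_EFinP.
  - by move=> n x _ //=; rewrite lee_fin.
  - by move=> x _ a b ab; rewrite lee_fin; exact/lefP/nd_nnsfun_approx.
have cmu : \int[mu]_x ((h n x)%:E * (p x)%:E) @[n --> \oo] -->
    \int[mu]_x (f x * (p x)%:E).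
  rewrite (eq_integral (fun x => limn (fun n => (h n x)%:E * (p x)%:E))); last first.
    move=> x _; apply/esym/cvg_lim => //; apply: cvgeZr => //.
    exact: cvg_nnsfun_approx.
  apply: cvg_monotone_convergence => //.
  - by move=> n; apply/emeasurable_funM => //; exact/measurable_EFinP.
  - by move=> n x _ /=; rewrite mule_ge0 ?lee_fin.
  - move=> x _ a b ab/=; rewrite lee_wpmul2r ?lee_fin//.
    exact/lefP/nd_nnsfun_approx.
suff E n : \int[nu]_x (EFin \o h n) x = \int[mu]_x ((h n x)%:E * (p x)%:E).
  by move: cnu; under eq_fun do rewrite E; move=> cnu; exact: cvg_unique cnu cmu.
rewrite integralT_nnsfun sintegralE.
transitivity (\int[mu]_x
   (\sum_(y \in range (h n)) (y * \1_(h n @^-1` [set y]) x)%:E * (p x)%:E)); last first.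
  apply: eq_integral => x _.
  rewrite -ge0_mule_fsuml => [|y]; last exact: nnfun_muleindic_ge0.
  by rewrite fsumEFin // -(fimfunE _ x).
rewrite ge0_integral_fsum//; last 2 first.
  - move=> y; apply: emeasurable_funM => //.
    by apply/measurable_EFinP; apply: measurable_funM.
  - move=> m y _; apply: mule_ge0; last by rewrite lee_fin.
    by rewrite EFinM nnfun_muleindic_ge0.
apply: eq_fsbigr => y yh.
have y0 : (0 <= y)%R by move: yh; rewrite inE => -[t _ <-].
under eq_integral do rewrite EFinM -muleA.
rewrite ge0_integralZl//.
- congr (_ * _); rewrite nuE//.
  rewrite integral_mkcond; apply: eq_integral => x _.
  by rewrite patchE indicE; case: ifPn => _; rewrite ?mul1e ?mul0e.
- apply: emeasurable_funM => //; exact/measurable_EFinP.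
- by move=> t Et; rewrite mule_ge0 ?lee_fin.
Qed.

End Density.

(** * Gaussian moments *)

Section GaussianMoments.
Context d (T : measurableType d) (R : realType) (P : probability T R).
Variables (eta : T -> R) (s : R).
Hypotheses (s_gt0 : 0 < s) (meta : measurable_fun setT eta).
Hypothesis eta_law : forall B, measurable B ->
  P [set w | B (eta w)] = normal_prob 0 s B.

(** The dominating normal density has total mass 1, so its coefficient c bounds the expectation. All
    Gaussian moments below come from such comparisons of densities; none is computed by
    integration. *)
Lemma gaussian_integral_le (g : R -> R) (c m s' : R) :
  measurable_fun setT g -> (forall x, 0 <= g x) ->
  (forall x, g x * normal_pdf 0 s x <= c * normal_pdf m s' x) ->
  (\int[P]_w (g (eta w))%:E <= c%:E)%E.
Proof.
move=> mg g0 gle.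
have mgE : measurable_fun setT (EFin \o g) by exact/measurable_EFinP.
have meta' : @measurable_fun _ _ T (measurableTypeR R) setT eta by exact: meta.
pose eta_mfun : {RV P >-> measurableTypeR R} := HB.pack eta (isMeasurableFun.Build _ _ _ _ _ meta').
have -> : (\int[P]_w (g (eta w))%:E = \int[distribution P eta_mfun]_x (g x)%:E)%E.
  rewrite ge0_integral_distribution// => y; rewrite lee_fin.
rewrite (@ge0_integral_density _ (measurableTypeR R) R lebesgue_measure (distribution P eta_mfun) (normal_pdf 0 s)).
- apply: (@le_trans _ _ (\int[lebesgue_measure]_x (c * normal_pdf m s' x)%:E)%E).
    apply: ge0_le_integral => //.
    + by move=> x _; rewrite lee_fin mulr_ge0 ?normal_pdf_ge0.
    + apply/measurable_EFinP; apply: measurable_funM => //; exact: measurable_normal_pdf.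
    + apply/measurable_EFinP; apply: measurable_funM => //; exact: measurable_normal_pdf.
    + by move=> x _; rewrite -EFinM lee_fin gle.
  under eq_integral do rewrite EFinM.
  rewrite integralZl//; last exact: integrable_normal_pdf.
  by rewrite integral_normal_pdf mule1.
- exact: normal_pdf_ge0.
- exact: measurable_normal_pdf.
- by move=> A mA; rewrite /distribution /pushforward /= -[RHS]eta_law.
- by [].
- by move=> x; rewrite lee_fin.
Qed.

End GaussianMoments.

Section GaussianDensity.
Variable R : realType.
Implicit Types (s m x c : R).

Lemma normal_peakM c s : 0 < c -> normal_peak (c * s) = c^-1 * normal_peak s.
Proof.
move=> c0; rewrite /normal_peak -invfM; congr (_^-1).
by rewrite exprMn -mulrA -mulrnAr sqrtrM ?sqr_ge0// sqrtr_sqr gtr0_norm.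
Qed.

Lemma normal_pdf_expR m s x : 0 < s ->
  normal_pdf m s x = normal_peak s * expR (- (x - m) ^+ 2 / (2 * s ^+ 2)).
Proof.
move=> s0; rewrite normal_pdfE ?gt_eqF// /normal_fun; congr (_ * expR (_ / _)).
by rewrite mulr_natl.
Qed.

(* Doubling the standard deviation absorbs any polynomial factor, so absolute moments are
   bounded without being computed. *)
Lemma cube_normal_pdf_le s x : 0 < s ->
  `|x| ^+ 3 * normal_pdf 0 s x <= 32 * s ^+ 3 * normal_pdf 0 (2 * s) x.
Proof.
move=> s0; rewrite !normal_pdf_expR ?mulr_gt0// normal_peakM// subr0.
pose y := `|x| / s; have y0 : 0 <= y by rewrite divr_ge0// ltW.
have xE : `|x| = y * s by rewrite divfK// gt_eqF.
have xE2 : x ^+ 2 = y ^+ 2 * s ^+ 2 by rewrite -real_normK ?num_real// xE exprMn.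
have -> : - x ^+ 2 / (2 * s ^+ 2) = - (y ^+ 2 / 8) + (- (3 * y ^+ 2 / 16)) *+ 2.
  by rewrite xE2; field; rewrite gt_eqF.
have -> : - x ^+ 2 / (2 * (2 * s) ^+ 2) = - (y ^+ 2 / 8).
  by rewrite xE2; field; rewrite gt_eqF.
rewrite expRD (mulr2n (- _)) expRD (expRN (3 * _ / _)) xE exprMn.
set e := expR (- (y ^+ 2 / 8)); set f := expR (3 * y ^+ 2 / 16).
have f1 : 1 + 3 * y ^+ 2 / 16 <= f by exact: expR_ge1Dx.
have f0 : 0 < f by exact: expR_gt0.
(* The density with doubled deviation has half the peak, so the constant 32 leaves 16 here. The
   factor f, at least 1 + 3y^2/16, occurs squared, which beats y^3. *)
have key : y ^+ 3 * (f^-1 * f^-1) <= 16.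
  rewrite -expr2 exprVn ler_pdivrMr ?exprn_gt0//.
  have h : (1 + 3 * y ^+ 2 / 16) ^+ 2 <= f ^+ 2.
    have p0 : 0 <= 1 + 3 * y ^+ 2 / 16 by have := sqr_ge0 y; lra.
    by rewrite lerXn2r// nnegrE// ltW.
  apply: (@le_trans _ _ (16 * (1 + 3 * y ^+ 2 / 16) ^+ 2)); last by rewrite ler_pM2l.
  nra.
have pe : 0 <= normal_peak s * e * s ^+ 3.
  by rewrite !mulr_ge0 ?normal_peak_ge0 ?expR_ge0 ?exprn_ge0 ?ltW.
have := ler_wpM2r pe key.
lra.
Qed.

(** The likelihood ratio of the translated density is the exponential of (x m - m^2/2) / s^2, and
    exp(v) >= 1 + v. After integration this bounds the mean linearly in m, for both signs of m. *)
Lemma normal_pdf_shift_ge m s x : 0 < s ->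
  (1 + (x * m - m ^+ 2 / 2) / s ^+ 2) * normal_pdf 0 s x <= normal_pdf m s x.
Proof.
move=> s0; rewrite !normal_pdf_expR// subr0 mulrCA ler_wpM2l ?normal_peak_ge0//.
have -> : - (x - m) ^+ 2 / (2 * s ^+ 2) =
  (x * m - m ^+ 2 / 2) / s ^+ 2 + - x ^+ 2 / (2 * s ^+ 2).
  by field; rewrite gt_eqF.
by rewrite expRD ler_wpM2r ?expR_ge0// expR_ge1Dx.
Qed.

(** The same tangent inequality for the likelihood ratio of a dilation. Taking c above and below 1
    bounds the variance from both sides. *)
Lemma normal_pdf_dilation_ge c s x : 0 < c -> 0 < s ->
  (1 + (1 - c ^- 2) / (2 * s ^+ 2) * x ^+ 2) * normal_pdf 0 s x <=
  c * normal_pdf 0 (c * s) x.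
Proof.
move=> c0 s0; rewrite !normal_pdf_expR ?mulr_gt0// normal_peakM//.
rewrite -(mulrA c^-1) mulVKf ?gt_eqF// subr0 mulrCA ler_wpM2l ?normal_peak_ge0//.
have -> : - x ^+ 2 / (2 * (c * s) ^+ 2) =
  (1 - c ^- 2) / (2 * s ^+ 2) * x ^+ 2 + - x ^+ 2 / (2 * s ^+ 2).
  by field; rewrite !gt_eqF.
by rewrite expRD ler_wpM2r ?expR_ge0// expR_ge1Dx.
Qed.

End GaussianDensity.

Section GaussianMomentValues.
Context d (T : measurableType d) (R : realType) (P : probability T R).
Variables (eta : T -> R) (s : R).
Hypotheses (s_gt0 : 0 < s) (meta : measurable_fun setT eta).
Hypothesis eta_law : forall B, measurable B ->
  P [set w | B (eta w)] = normal_prob 0 s B.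

Lemma gaussian_cube_le : (\int[P]_w (`|eta w| ^+ 3)%:E <= (32 * s ^+ 3)%:E)%E.
Proof.
apply: (@gaussian_integral_le _ _ _ _ _ s _ _ (fun x => `|x| ^+ 3) _ 0 (2 * s)) => //.
- by apply: measurable_funX; exact: normr_measurable.
- by move=> x; exact: cube_normal_pdf_le.
Qed.

Lemma integrable_gaussian_cube : P.-integrable setT (fun w => (`|eta w| ^+ 3)%:E).
Proof.
apply/integrableP; split.
  by apply/measurable_EFinP; apply: measurable_funX; exact: measurableT_comp.
apply: le_lt_trans (ltry (32 * s ^+ 3)).
by apply: le_trans gaussian_cube_le; apply: ge0_le_integral => //;
  [apply: measurableT_comp => //| |move=> w _ /=; rewrite normrX normr_id] => //;
  apply/measurable_EFinP; apply: measurable_funX; exact: measurableT_comp.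
Qed.

Lemma integrable_le_gaussian_cube (f : T -> R) (C : R) : measurable_fun setT f ->
  (forall w, `|f w| <= C * (1 + `|eta w| ^+ 3)) ->
  P.-integrable setT (EFin \o f).
Proof.
move=> mf fC; apply: (@le_integrable _ _ _ _ _ measurableT _
  (EFin \o (fun w => C * (1 + `|eta w| ^+ 3)))).
- exact/measurable_EFinP.
- move=> w _; rewrite /= lee_fin (le_trans (fC w))// ler_norm//.
- rewrite (_ : EFin \o _ = (fun w => C%:E * (cst 1 \+ (fun w => (`|eta w| ^+ 3)%:E)) w)%E).
    apply: integrableZl => //; apply: integrableD => //; last exact: integrable_gaussian_cube.
    exact: finite_measure_integrable_cst.
  by apply/funext => w /=; rewrite EFinM EFinD.
Qed.

Lemma integrable_gaussian : P.-integrable setT (EFin \o eta).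
Proof.
apply: (integrable_le_gaussian_cube (C := 1)) => // w.
rewrite mul1r; have := normr_ge0 (eta w); set y := `|_| => y0.
have := mulr_ge0 y0 (sqr_ge0 (y - 1)); have := sqr_ge0 (y - 1).
have := exprn_ge0 3 y0; nra.
Qed.

Lemma integrable_gaussian_sqr : P.-integrable setT (EFin \o (fun w => eta w ^+ 2)).
Proof.
apply: (integrable_le_gaussian_cube (C := 1)) => [|w].
  exact: measurable_funX.
rewrite mul1r normrX; have := normr_ge0 (eta w); set y := `|_| => y0.
have := mulr_ge0 y0 (sqr_ge0 (y - 1)); have := sqr_ge0 (y - 1).
have := exprn_ge0 3 y0; nra.
Qed.

Lemma Rintegral_gaussian_cube_le : \int[P]_w (`|eta w| ^+ 3) <= 32 * s ^+ 3.
Proof.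
rewrite -lee_fin -EFin_Rintegral//; first exact: gaussian_cube_le.
exact: integrable_gaussian_cube.
Qed.

(** Here g may change sign: since c >= 0, its positive part satisfies the same domination, and
    [gaussian_integral_le] applies to that part. *)
Let Rintegral_le (g : R -> R) (c m s' : R) :
  P.-integrable setT (EFin \o (g \o eta)) -> measurable_fun setT g ->
  0 <= c ->
  (forall x, g x * normal_pdf 0 s x <= c * normal_pdf m s' x) ->
  \int[P]_w (g (eta w)) <= c.
Proof.
move=> gi mg c0 gle; rewrite -lee_fin -EFin_Rintegral//.
apply: (@le_trans _ _ (\int[P]_w (Num.max 0 (g (eta w)))%:E)%E).
  apply: le_integral => //.
    apply: (@le_integrable _ _ _ _ _ measurableT _ _ _ _ gi).
      apply/measurable_EFinP; apply: measurable_maxr => //.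
      exact: measurableT_comp.
    by move=> w _ /=; rewrite lee_fin ger0_norm ?le_max ?lexx// ge_max normr_ge0 ler_norm.
  by move=> w _; rewrite lee_fin le_max lexx orbT.
apply: (@gaussian_integral_le _ _ _ _ _ s _ _ (fun x => Num.max 0 (g x)) _ m s') => //.
- exact: measurable_maxr.
- by move=> x; rewrite le_max lexx.
- move=> x; rewrite maxr_pMl ?normal_pdf_ge0// mul0r ge_max gle mulr_ge0//.
  exact: normal_pdf_ge0.
Qed.

(** Shifted densities give m I <= m^2/2 for every m, where I is the mean; the choice m = I leaves
    I^2 <= I^2/2. *)
Lemma Rintegral_gaussian : \int[P]_w (eta w) = 0.
Proof.
have cst_int c : P.-integrable setT (EFin \o (fun=> c : R)).
  exact: finite_measure_integrable_cst.
have key m : m * \int[P]_w (eta w) <= m ^+ 2 / 2.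
  have h : \int[P]_w (1 - m ^+ 2 / 2 / s ^+ 2 + m / s ^+ 2 * eta w) <= 1.
    pose g x := 1 - m ^+ 2 / 2 / s ^+ 2 + m / s ^+ 2 * x.
    apply: (@Rintegral_le g 1 m s) => //.
    - by apply: eq_integrable (integrableD measurableT (cst_int (1 - m ^+ 2 / 2 / s ^+ 2))
        (integrableZl measurableT (m / s ^+ 2) integrable_gaussian)) => //.
    - by apply: measurable_funD => //; apply: measurable_funM.
    - move=> x; rewrite mul1r (le_trans _ (normal_pdf_shift_ge m x s_gt0))//.
      rewrite le_eqVlt; apply/orP; left; apply/eqP; congr (_ * _).
      by rewrite /g; field; rewrite gt_eqF.
  move: h; rewrite RintegralD//=; last first.
    exact: integrableZl integrable_gaussian.
  rewrite RintegralZl//; last exact: integrable_gaussian.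
  rewrite Rintegral_probability_cst.
  have s2 : 0 < s ^+ 2 by rewrite exprn_gt0.
  move=> h; rewrite -(ler_pM2r (_ : 0 < (s ^+ 2)^-1)) ?invr_gt0//.
  by move: h; set I := \int[P]_w _; rewrite mulrAC; lra.
set I := \int[P]_w _ in key *.
apply/eqP; rewrite -sqrf_eq0; apply/eqP/le_anti; rewrite sqr_ge0 andbT.
have := key I; rewrite -expr2; lra.
Qed.

(** With E the variance divided by s^2, dilations give (c^2 - 1) E <= 2 c^2 (c - 1) for all c > 0.
    Dividing by c - 1 and letting c tend to 1 from either side forces E = 1; the explicit e, chosen
    from the supposed distance of E to 1, replaces the two limits. *)
Lemma Rintegral_gaussian_sqr : \int[P]_w (eta w ^+ 2) = s ^+ 2.
Proof.
have cst_int c : P.-integrable setT (EFin \o (fun=> c : R)).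
  exact: finite_measure_integrable_cst.
have s2 : 0 < s ^+ 2 by rewrite exprn_gt0.
set I := \int[P]_w _; pose E := I / s ^+ 2.
have key c : 0 < c -> (c ^+ 2 - 1) * E <= 2 * c ^+ 2 * (c - 1).
  move=> c0; pose k := (1 - c ^- 2) / (2 * s ^+ 2).
  have h : \int[P]_w (1 + k * eta w ^+ 2) <= c.
    pose g x := 1 + k * x ^+ 2.
    apply: (@Rintegral_le g c 0 (c * s)) => //; last 2 first.
    - exact: ltW.
    - by move=> x; exact: normal_pdf_dilation_ge.
    - by apply: eq_integrable (integrableD measurableT (cst_int 1)
        (integrableZl measurableT k integrable_gaussian_sqr)) => //.
    - by apply: measurable_funD => //; apply: measurable_funM.
  move: h; rewrite RintegralD//=; last first.
    exact: integrableZl integrable_gaussian_sqr.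
  rewrite RintegralZl//; last exact: integrable_gaussian_sqr.
  rewrite Rintegral_probability_cst -/I.
  have -> : k * I = (1 - c ^- 2) * E / 2.
    by rewrite /k /E; field; rewrite !gt_eqF.
  have c2 : 0 < c ^+ 2 by rewrite exprn_gt0.
  move=> h; have := ler_wpM2l (ltW c2) h.
  have -> : c ^+ 2 * (1 + (1 - c ^- 2) * E / 2) = c ^+ 2 + (c ^+ 2 - 1) * E / 2.
    by field; rewrite gt_eqF.
  lra.
have E0 : 0 <= E.
  apply: divr_ge0; last exact: ltW.
  by apply: Rintegral_ge0 => w _; exact: sqr_ge0.
suff E1 : E = 1 by rewrite -[LHS](divfK (lt0r_neq0 s2)) -/E E1 mul1r.
apply/eqP; rewrite eq_le; apply/andP; split; rewrite leNgt; apply/negP => E1.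
- pose e := (E - 1) / (4 * E).
  have e0 : 0 < e by rewrite /e; apply: divr_gt0; lra.
  have eE : 4 * e * E = E - 1 by rewrite /e; field; rewrite gt_eqF//; lra.
  have e1 : e <= 1 / 4 by nra.
  have e2 : 4 * e <= E - 1 by nra.
  have h : (2 + e) * E <= 2 * (1 + e) ^+ 2.
    have h0 : 0 < 1 + e by lra.
    by rewrite -(ler_pM2l e0); have := key _ h0; lra.
  nra.
- pose e := (1 - E) / 4.
  have e0 : 0 < e by rewrite /e; lra.
  have e1 : e <= 1 / 4 by rewrite /e; lra.
  have h : 2 * (1 - e) ^+ 2 <= (2 - e) * E.
    have h0 : 0 < 1 - e by lra.
    by rewrite -(ler_pM2l e0); have := key _ h0; lra.
  have eE : E = 1 - 4 * e by rewrite /e; lra.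
  nra.
Qed.

(** Peak of the density times length of the interval; the estimate pi >= 2 brings the product below
    a. *)
Lemma gaussian_small_ball (a : R) : 0 < a ->
  (P [set w | (`|eta w| < a * s)%R] <= a%:E)%E.
Proof.
move=> a0; pose B := `]- (a * s), (a * s)[%classic : set R.
rewrite (_ : [set w | _] = [set w | B (eta w)]); last first.
  by apply/seteqP; split => w /=; rewrite /B /= in_itv/= ltr_norml.
rewrite eta_law; last exact: measurable_itv.
have as0 : 0 < a * s by rewrite mulr_gt0.
apply: (@le_trans _ _ (\int[lebesgue_measure]_(x in B) (normal_peak s)%:E)%E).
  have mB : measurable B by exact: measurable_itv.
  apply: (@ge0_le_integral _ _ _ lebesgue_measure B mB) => //.
  - by move=> x _; rewrite lee_fin normal_pdf_ge0.
  - by apply/measurable_EFinP/measurable_funTS; exact: measurable_normal_pdf.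
  - by move=> x _; rewrite lee_fin normal_pdf_ub// gt_eqF.
rewrite integral_cst; last exact: measurable_itv.
rewrite [X in (_ * X)%E](_ : _ = (2 * (a * s))%:E); last first.
  have h := lebesgue_measure_itv `](- (a * s)), (a * s)[; rewrite [LHS]h /=.
  by rewrite lte_fin gtrN// -EFinB opprK mulr_natl mulr2n.
rewrite -EFinM lee_fin.
have q0 : 0 < Num.sqrt (s ^+ 2 * pi *+ 2).
  by rewrite sqrtr_gt0 mulrn_wgt0// mulr_gt0 ?pi_gt0// exprn_gt0.
have pk : normal_peak s * s <= 2^-1.
  rewrite /normal_peak mulrC ler_pdivrMr//.
  suff : 2 * s <= Num.sqrt (s ^+ 2 * pi *+ 2) by lra.
  have -> : 2 * s = Num.sqrt ((2 * s) ^+ 2) by rewrite sqrtr_sqr gtr0_norm ?mulr_gt0.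
  apply: ler_wsqrtr.
  have p2 := pi_ge2 R; have s2 : 0 < s ^+ 2 by rewrite exprn_gt0.
  by rewrite -mulr_natr; nra.
by have := ler_wpM2l (ltW a0) pk; lra.
Qed.

End GaussianMomentValues.

(** * Products of independent variables *)

Section Independence.
Context d (T : measurableType d) (R : realType) (P : probability T R).
Variables (X Y : {RV P >-> R}).
Hypothesis XYindep : forall A B : set R, measurable A -> measurable B ->
  P (X @^-1` A `&` Y @^-1` B) = (P (X @^-1` A) * P (Y @^-1` B))%E.
Hypotheses (iX : P.-integrable setT (EFin \o X))
  (iY : P.-integrable setT (EFin \o Y)).

Let Z w : R * R := (X w, Y w).

Let mZ : measurable_fun setT Z.
Proof. exact/measurable_fun_pairP. Qed.

Let ZRV : {RV P >-> (R * R)%type} := HB.pack Z (isMeasurableFun.Build _ _ _ _ _ mZ).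

(** Rectangles determine a measure on the plane, so independence says that the joint law is the
    product of the marginals; integrability and the product formula then follow from Fubini under
    that product. *)
Let prod_law (A : set (R * R)) : measurable A ->
  (distribution P X \x distribution P Y)%E A = distribution P ZRV A.
Proof.
by move=> mA; apply: product_measure_unique => // B C mB mC; exact: XYindep.
Qed.

Let f (p : R * R) : \bar R := (p.1 * p.2)%:E.

Let mf : measurable_fun setT f.
Proof. by apply/measurable_EFinP; apply: measurable_funM. Qed.

Let intf : (distribution P X \x distribution P Y)%E.-integrable setT f.
Proof.
apply/integrable12ltyP => //.
have absE (V : {RV P >-> R}) :
    (\int[distribution P V]_y `|y|%:E = \int[P]_w `|V w|%:E)%E.
  rewrite ge0_integral_distribution//; apply/measurable_EFinP; exact: normr_measurable.
rewrite (eq_integral (fun x : R => `|x|%:E * \int[P]_w `|Y w|%:E)%E); last first.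
  move=> x _; under eq_integral do rewrite /f /= normrM EFinM.
  rewrite ge0_integralZl//=; last by apply/measurable_EFinP; exact: normr_measurable.
  by congr (_ * _)%E; exact: absE.
rewrite ge0_integralZr//=; last 2 first.
  by apply/measurable_EFinP; exact: normr_measurable.
  by apply: integral_ge0.
have := absE X; rewrite /= => ->.
move/integrableP : iX => [_ X1]; move/integrableP : iY => [_ Y1].
have X0 : (0 <= \int[P]_w `|X w|%:E)%E by apply: integral_ge0.
by apply: lte_mul_pinfty => //; rewrite ge0_fin_numE.
Qed.

Lemma integrable_indepM : P.-integrable setT (EFin \o (fun w => X w * Y w)).
Proof.
have /integrableP[_] := intf; rewrite (eq_measure_integral (distribution P ZRV)); last first.
  by move=> A mA _; exact: prod_law.
rewrite ge0_integral_distribution//; last exact: measurableT_comp.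
move=> h; apply/integrableP; split => //.
by apply/measurable_EFinP; apply: measurable_funM.
Qed.

Lemma Rintegral_indepM :
  \int[P]_w (X w * Y w) = \int[P]_w X w * \int[P]_w Y w.
Proof.
have iXY := integrable_indepM.
apply: EFin_inj; rewrite EFinM -!EFin_Rintegral//.
transitivity (\int[distribution P ZRV]_p f p)%E; first by rewrite integral_distribution.
transitivity (\int[(distribution P X \x distribution P Y)%E]_p f p)%E.
  by apply/esym/eq_measure_integral => A mA _; exact: prod_law.
have lawE (V : {RV P >-> R}) : P.-integrable setT (EFin \o V) ->
    (distribution P V).-integrable setT EFin /\
    (\int[distribution P V]_y y%:E = (\int[P]_w V w)%:E)%E.
  move=> iV; split; first exact: integrable_pushforward.
  by rewrite integral_distribution// EFin_Rintegral.
have [iX' EX] := lawE X iX; have [iY' EY] := lawE Y iY.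
rewrite -(integral12_prod_meas1 intf) /fubini_F.
rewrite (eq_integral (fun x : R => x%:E * (\int[P]_w Y w)%:E)%E); last first.
  move=> x _; under eq_integral do rewrite /f /= EFinM.
  by rewrite integralZl//=; congr (_ * _)%E.
by rewrite integralZr//; have := EX; rewrite /= => ->; rewrite !EFin_Rintegral.
Qed.

End Independence.

(** * Time averages of adapted processes *)

Lemma norm_sum_seq_le (R : realType) (I : Type) (l : seq I) (a : I -> R) (K : R) :
  (forall i, `|a i| <= K) -> `|\sum_(i <- l) a i| <= (size l)%:R * K.
Proof.
move=> aK; rewrite (le_trans (ler_norm_sum _ _ _))//.
elim: l => [|i l IH]; first by rewrite big_nil mul0r.
by rewrite big_cons /= -natr1 mulrDl mul1r addrC lerD.
Qed.

Section Sampling.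
Context d (T : measurableType d) (R : realType) (P : probability T R).
Variables (V : R -> T -> R) (K t : R).
Hypothesis mV : measurable_fun setT (fun p : R * T => V p.1 p.2).
Hypothesis VK : forall s w, `|V s w| <= K.
Hypothesis t_gt0 : 0 < t.

Let I : set (measurableTypeR R) := `[0, t]%classic.

Let mI : measurable I. Proof. exact: measurable_itv. Qed.

Let I_measure : lebesgue_measure I = t%:E.
Proof.
have h := lebesgue_measure_itv `[0, t]; rewrite [LHS]h /=.
by rewrite lte_fin t_gt0 -EFinB subr0.
Qed.

Let I_fin : (lebesgue_measure I < +oo)%E.
Proof. by rewrite I_measure ltry. Qed.

Definition time_mean (w : T) : R := t^-1 * Rintegral lebesgue_measure I (V ^~ w).

Let K_ge0 (w : T) : 0 <= K. Proof. exact: le_trans (VK 0 w). Qed.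

Lemma measurable_time_mean : measurable_fun setT time_mean.
Proof.
apply: measurable_funM => //.
have mV' : measurable_fun setT (fun p : T * measurableTypeR R => V p.2 p.1).
  exact: (measurableT_comp mV (@measurable_swap _ _ _ _)).
exact: (@measurable_Rintegral_slice1 _ _ T (measurableTypeR R) R
  (@lebesgue_measure R) setT I (fun w s => V s w) K measurableT mI
  I_fin mV' (fun w s => VK s w)).
Qed.

Let mVt w : measurable_fun setT (V ^~ w).
Proof. exact: (measurable_slice2 mV w). Qed.

Lemma time_mean_le w : `|time_mean w| <= K.
Proof.
rewrite /time_mean normrM gtr0_norm ?invr_gt0// ler_pdivrMl//.
have := @Rintegral_bound _ _ _ (@lebesgue_measure R) I (V ^~ w) K mI I_fin.
rewrite /= I_measure /= mulrC; apply => //; apply: measurable_funTS; exact: mVt.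
Qed.

(** On each path V minus its time average has integral 0 over [0, t], so by Fubini the cross term
    has time integral 0. If it exceeded 1 at every time of [0, t], this integral would be at least t
    > 0. *)
Lemma sampling_step (S : T -> R) (C : R) : measurable_fun setT S ->
  (forall w, `|S w| <= C) ->
  exists s, 0 <= s <= t /\ \int[P]_w (S w * (V s w - time_mean w)) <= 1.
Proof.
move=> mS SC; apply: contrapT => /forallNP h.
pose H (s : measurableTypeR R) w := S w * (V s w - time_mean w).
have mH : measurable_fun setT (fun p : measurableTypeR R * T => H p.1 p.2).
  apply: measurable_funM; first exact: measurableT_comp mS measurable_snd.
  apply: measurable_funB => //.
  exact: measurableT_comp measurable_time_mean measurable_snd.
have HC s w : `|H s w| <= C * (K + K).
  rewrite normrM ler_pM// (le_trans (ler_normB _ _))// lerD//.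
  exact: time_mean_le.
have := @Rintegral_Fubini _ _ _ _ _ (@lebesgue_measure R) P I setT H (C * (K + K))
  mI measurableT I_fin (probability_fin P) mH HC.
rewrite [RHS](_ : _ = 0); last first.
  rewrite -[RHS](Rintegral_probability_cst P); apply: eq_Rintegral => w _.
  have iV : (@lebesgue_measure R).-integrable I (EFin \o V ^~ w).
    by apply: (bounded_integrable (C := K)) => //; apply: measurable_funTS; exact: mVt.
  have ic c : (@lebesgue_measure R).-integrable I (EFin \o (fun=> c : R)).
    by apply: (bounded_integrable (C := `|c|)).
  rewrite /H RintegralZl//; last first.
    apply: (bounded_integrable (C := K + K)) => //.
      by apply: measurable_funTS; apply: measurable_funB => //; exact: mVt.
    move=> s _; rewrite (le_trans (ler_normB _ _))// lerD//; exact: time_mean_le.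
  rewrite RintegralB//  Rintegral_cst//= I_measure /= /time_mean.
  by rewrite mulrAC mulVf ?gt_eqF// mul1r subrr mulr0.
apply/eqP; rewrite gt_eqF//; apply: (lt_le_trans t_gt0).
have := Rintegral_cst (@lebesgue_measure R) mI 1; rewrite /= I_measure mul1r /= => <-.
apply: le_Rintegral => //.
- by apply: (bounded_integrable (C := 1)) => // x _; rewrite normr1.
- apply: (bounded_integrable (C := C * (K + K))) => //.
    by apply: (@measurable_Rintegral_slice1 _ _ _ _ _ P I setT H (C * (K + K)));
      rewrite ?probability_fin.
  move=> s _; apply: Rintegral_probability_bound => //; exact: (measurable_slice1 mH).
- move=> s; rewrite /I /= in_itv/= => s01; rewrite leNgt; apply/negP => h1.
  by apply: (h s); split => //; exact: ltW.
Qed.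

(* Sampling times are chosen greedily: at each step some time makes the cross term with the
   previous centred sum at most its time average, which is 0 up to the slack 1. *)
Lemma sampling n : exists l : seq R, [/\ size l = n, forall s, s \in l -> 0 <= s <= t
  & \int[P]_w ((\sum_(s <- l) V s w - n%:R * time_mean w) ^+ 2)
    <= (2 + (K + K) ^+ 2) * n%:R].
Proof.
elim: n => [|n [l [ln l0t lC]]].
  exists [::]; split => //; rewrite mulr0.
  rewrite (_ : (fun w => _) = (fun=> 0)) ?Rintegral_probability_cst//.
  by apply/funext => w; rewrite big_nil mul0r subr0 expr0n.
pose S w := \sum_(s <- l) V s w - n%:R * time_mean w.
have mVs s : measurable_fun setT (V s) by exact: measurable_slice1.
have mS : measurable_fun setT S.
  apply: measurable_funB; first exact: measurable_sum.
  by apply: measurable_funM => //; exact: measurable_time_mean.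
have SC w : `|S w| <= n%:R * K + n%:R * K.
  rewrite (le_trans (ler_normB _ _))// lerD//.
    by rewrite -ln; exact: norm_sum_seq_le.
  by rewrite normrM ger0_norm// ler_wpM2l// time_mean_le.
have [s [s0t sle]] := sampling_step mS SC.
exists (s :: l); split.
- by rewrite /= ln.
- by move=> x; rewrite inE => /predU1P[->//|]; exact: l0t.
pose Z w := V s w - time_mean w.
have mZ : measurable_fun setT Z.
  by apply: measurable_funB => //; exact: measurable_time_mean.
have ZK w : `|Z w| <= K + K.
  by rewrite (le_trans (ler_normB _ _))// lerD// time_mean_le.
rewrite (@eq_Rintegral _ _ _ P setT (fun w => S w ^+ 2 + (2 * (S w * Z w) + Z w ^+ 2))); last first.
  by move=> w _; rewrite big_cons /S /Z -natr1; ring.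
have i1 : P.-integrable setT (EFin \o (fun w => S w ^+ 2)).
  apply: (probability_integrable P (C := (n%:R * K + n%:R * K) ^+ 2)); first exact: measurable_funX.
  by move=> w; rewrite normrX lerXn2r// nnegrE// (le_trans _ (SC w)).
have i2 : P.-integrable setT (EFin \o (fun w => S w * Z w)).
  apply: (probability_integrable P (C := (n%:R * K + n%:R * K) * (K + K))); first exact: measurable_funM.
  by move=> w; rewrite normrM ler_pM.
have i3 : P.-integrable setT (EFin \o (fun w => Z w ^+ 2)).
  apply: (probability_integrable P (C := (K + K) ^+ 2)); first exact: measurable_funX.
  by move=> w; rewrite normrX lerXn2r// nnegrE// (le_trans _ (ZK w)).
have i2' : P.-integrable setT (EFin \o (fun w => 2 * (S w * Z w))).
  exact: (integrableZl measurableT 2 i2).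
rewrite RintegralD//; last exact: (integrableD measurableT i2' i3).
(* One more sample costs at most 2 from twice the cross term and (K + K)^2 from the square of [Z],
   hence the growth rate in the statement. *)
rewrite RintegralD// RintegralZl// -(natr1 n) mulrDr mulr1 lerD// lerD//.
  by rewrite -[leRHS]mulr1 ler_wpM2l.
rewrite -[leRHS](Rintegral_probability_cst P); apply: le_Rintegral => //.
  by apply: (probability_integrable P (C := `|(K + K) ^+ 2|)) => //.
move=> w _; rewrite -[leLHS]ger0_norm ?sqr_ge0// normrX lerXn2r// nnegrE//.
exact: le_trans (ZK w).
Qed.

End Sampling.

(** * Adaptedness and independence of Brownian increments *)

Section Past.
Context (R : realType) (dm : measure_display) (T : measurableType dm).
Variables (P : probability T R) (W : R -> T -> R).

Definition past_events (t : R) : set (set T) :=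
  [set A | (exists s : R, exists B : set R,
             0 <= s <= t /\ measurable B /\ A = (W s) @^-1` B)
           \/ (measurable A /\ P A = 0%E)].

(** Adaptedness is phrased as measurability for the generated sigma-algebra, so that the closure
    properties of measurable functions apply to it as they stand. *)
Definition past (t : R) (f : T -> R) : Prop :=
  @measurable_fun _ _ (g_sigma_algebraType (past_events t)) R setT f.

Lemma pastP t f : past t f <->
  forall B : set R, measurable B -> nat_filtration P W t (f @^-1` B).
Proof.
split => [pf B mB|h _ B mB]; last by rewrite setTI; exact: h.
by have := pf measurableT B mB; rewrite setTI.
Qed.

Hypothesis W_BM : standard_BM P W.

Lemma nat_filtration_measurable t A : nat_filtration P W t A -> measurable A.
Proof.
apply: smallest_sub; first exact: sigma_algebra_measurable.
move=> B [[s [C [/andP[s0 _] [mC ->]]]]|[]//].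
by case: W_BM => _ _ mW _ _; rewrite -[X in measurable X]setTI; exact: mW.
Qed.

Lemma past_measurable t f : past t f -> measurable_fun setT f.
Proof.
move=> /pastP h _ B mB; rewrite setTI; apply: (@nat_filtration_measurable t).
exact: h.
Qed.

Lemma past_mono s t f : s <= t -> past s f -> past t f.
Proof.
move=> st /pastP h; apply/pastP => B mB; move: (h B mB).
apply: sub_smallest2r; first exact: smallest_sigma_algebra.
move=> A [[u [C [/andP[u0 us] [mC ->]]]]|]; last by right.
by left; exists u, C; rewrite u0 (le_trans us).
Qed.

Lemma past_BM s t : 0 <= s <= t -> past t (W s).
Proof.
by move=> st; apply/pastP => B mB; apply: sub_gen_smallest; left; exists s, B.
Qed.

(** By completeness every subset of a null set is a measurable null set, hence one of the generators
    of the filtration; altering a function on such a set keeps it adapted. *)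
Lemma past_negligible t (f g : T -> R) (N : set T) : complete_prob_space P ->
  measurable N -> P N = 0%E -> past t f -> (forall w, ~ N w -> g w = f w) ->
  past t g.
Proof.
move=> Pcomp mN PN pf gf; apply/pastP => B mB.
have FN A : A `<=` N -> nat_filtration P W t A.
  move=> AN; apply: sub_gen_smallest; right.
  have mA : measurable A by exact: Pcomp PN _ AN.
  by split=> //; exact: (subset_measure0 mA mN AN PN).
have FNA A : nat_filtration P W t A -> nat_filtration P W t (A `&` ~` N).
  move=> FA; have FNc : nat_filtration P W t (~` N).
    by rewrite -setTD; apply: sigma_algebraCD; exact: FN.
  exact: (@measurableI _ (g_sigma_algebraType (past_events t)) A (~` N)).
rewrite (_ : g @^-1` B = (f @^-1` B `&` ~` N) `|` (g @^-1` B `&` N)).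
  apply: (@measurableU _ (g_sigma_algebraType (past_events t))).
    by apply: FNA; move/pastP : pf; exact.
  by apply: FN => w [].
apply/seteqP; split => w /=.
  by move=> Bg; have [Nw|Nw] := pselect (N w); [right|left; rewrite -gf].
by move=> [[Bf Nw]|[]//]; rewrite gf.
Qed.

Section Increment.
Variables (s t : R).
Hypotheses (s_ge0 : 0 <= s) (st : s < t).

Definition increment w := W t w - W s w.

Lemma measurable_increment : measurable_fun setT increment.
Proof.
by case: W_BM => _ _ mW _ _; apply: measurable_funB; apply: mW => //;
  rewrite (le_trans s_ge0) // ltW.
Qed.

Lemma increment_law B : measurable B ->
  P [set w | B (increment w)] = normal_prob 0 (Num.sqrt (t - s)) B.
Proof. by case: W_BM => _ _ _ h _; exact: h. Qed.

Lemma sqrt_increment_gt0 : 0 < Num.sqrt (t - s).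
Proof. by rewrite sqrtr_gt0 subr_gt0. Qed.

(** The independence clause of [standard_BM] concerns events; this is its form for expectations, the
    one place where martingale-type cancellation comes from. *)
Lemma Rintegral_past_increment (f : T -> R) (g : R -> R) :
  past s f -> measurable_fun setT g ->
  P.-integrable setT (EFin \o f) -> P.-integrable setT (EFin \o (g \o increment)) ->
  \int[P]_w (f w * g (increment w)) = \int[P]_w f w * \int[P]_w g (increment w).
Proof.
move=> pf mg fi gi.
have mf := past_measurable pf.
have mgi : measurable_fun setT (g \o increment).
  exact: measurableT_comp mg measurable_increment.
pose X : {RV P >-> R} := HB.pack f (isMeasurableFun.Build _ _ _ _ _ mf).
pose Y : {RV P >-> R} := HB.pack (g \o increment) (isMeasurableFun.Build _ _ _ _ _ mgi).
apply: (@Rintegral_indepM _ _ _ P X Y) => // A B mA mB.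
have mgB : measurable (g @^-1` B) by rewrite -[X in measurable X]setTI; exact: mg.
case: W_BM => _ _ _ _ h; apply: (h s t s_ge0 st _ _ _ mgB).
by move/pastP : pf; exact.
Qed.

End Increment.
End Past.

Lemma nneseries_fin_cvg0 (R : realType) (u : nat -> R) :
  (forall n, 0 <= u n) -> (\sum_(0 <= n <oo) (u n)%:E < +oo)%E ->
  u n @[n --> \oo] --> (0 : R).
Proof.
move=> u0 ufin; apply: cvg_series_cvg_0; apply: nondecreasing_is_cvgn.
  by apply/nondecreasing_seqP => n; rewrite /series /= big_nat_recr//= lerDl.
exists (fine (\sum_(0 <= n <oo) (u n)%:E)%E) => _ [n _ <-].
rewrite -lee_fin fineK; last first.
  by rewrite ge0_fin_numE//; apply: nneseries_ge0 => k _ _; rewrite lee_fin.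
rewrite /series /= -sumEFin; apply: nneseries_lim_ge => k _ _.
by rewrite lee_fin.
Qed.

(** The squared errors have a summable sequence of expectations, so their sum is integrable, hence
    finite off a null set, and there the terms tend to 0. *)
Lemma ae_cvg_of_summable_L2 d (T : measurableType d) (R : realType)
    (P : probability T R) (f_ : nat -> T -> R) (f : T -> R) (C K : R) :
  (forall n, measurable_fun setT (f_ n)) -> measurable_fun setT f ->
  (forall n w, `|f_ n w| <= K) -> (forall w, `|f w| <= K) -> 0 <= C ->
  (forall n, \int[P]_w ((f_ n w - f w) ^+ 2) <= C / (2 ^ n.+1)%:R) ->
  exists N, [/\ measurable N, P N = 0%E &
    forall w, ~ N w -> f_ n w @[n --> \oo] --> f w].
Proof.
move=> mf_ mf f_K fK C0 fC.
pose g n w := (f_ n w - f w) ^+ 2.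
have mg n : measurable_fun setT (g n).
  by apply: measurable_funX; exact: measurable_funB.
have mgE n : measurable_fun setT (EFin \o g n) by exact/measurable_EFinP.
have g0 n w : 0 <= g n w by exact: sqr_ge0.
have gi n : P.-integrable setT (EFin \o g n).
  apply: (probability_integrable P (C := (K + K) ^+ 2)) => // w.
  have h : `|f_ n w - f w| <= K + K by rewrite (le_trans (ler_normB _ _))// lerD.
  by rewrite normrX lerXn2r// nnegrE// (le_trans _ h).
pose G w := (\sum_(0 <= n <oo) (g n w)%:E)%E.
have G0 w : (0 <= G w)%E by apply: nneseries_ge0 => n _ _; rewrite lee_fin.
have iG : P.-integrable setT G.
  apply/integrableP; split.
    by apply: ge0_emeasurable_sum; [move=> n w _ _; rewrite lee_fin|move=> n _; exact: mgE].
  apply: (@le_lt_trans _ _ C%:E); last exact: ltry.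
  under eq_integral do rewrite gee0_abs//.
  rewrite integral_nneseries//; last by move=> n w _; rewrite lee_fin.
  apply: le_trans (epsilon_trick0 xpredT C0); apply: lee_nneseries.
    by move=> n _ _; apply: integral_ge0 => w _; rewrite lee_fin.
  move=> n _; rewrite EFin_Rintegral// lee_fin; exact: fC.
have [N [mN PN sN]] := integrable_ae measurableT iG.
exists N; split => // w Nw.
have Gfin : G w \is a fin_num.
  by apply: contrapT => h; apply: Nw; apply: sN => /= /(_ I).
have Glty : (G w < +oo)%E by rewrite -ge0_fin_numE.
have cg := @nneseries_fin_cvg0 _ (g ^~ w) (g0 ^~ w) Glty.
apply/cvgrPdist_le => e e0.
have e2 : 0 < e ^+ 2 by rewrite exprn_gt0.
move/cvgrPdist_le : cg => /(_ _ e2); apply: filterS => n.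
rewrite sub0r normrN ger0_norm// /g -real_normK ?num_real// => h.
by rewrite distrC -ler_sqr ?nnegrE ?(ltW e0).
Qed.

Section PastTimeMean.
Context (R : realType) (dm : measure_display) (T : measurableType dm).
Variables (P : probability T R) (W : R -> T -> R).
Hypotheses (Pcomp : complete_prob_space P) (W_BM : standard_BM P W).
Variables (V : R -> T -> R) (K t : R).
Hypothesis mV : measurable_fun setT (fun p : R * T => V p.1 p.2).
Hypothesis VK : forall s w, `|V s w| <= K.
Hypothesis t_gt0 : 0 < t.
Hypothesis pV : forall s, 0 <= s <= t -> past P W t (V s).

(* The time average is an almost sure limit of averages over finitely many fixed times, which
   are known at time t; completeness of P disposes of the exceptional null set. *)
Lemma past_time_mean : past P W t (time_mean V t).
Proof.
pose c : R := 2 + (K + K) ^+ 2.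
have c0 : 0 <= c by rewrite addr_ge0// sqr_ge0.
(* With 2^(n+1) sampling times the mean square error is at most c / 2^(n+1), which is summable in
   n. *)
pose f_ n w : R := let l := projT1 (cid (sampling P mV VK t_gt0 (2 ^ n.+1)%N)) in
  (2 ^ n.+1)%:R^-1 * \sum_(s <- l) V s w.
have pf n : past P W t (f_ n).
  rewrite /f_; case: cid => l /= [_ lt _]; apply: measurable_funM => //.
  elim: l lt => [|s l IH] lt.
    rewrite (_ : (fun w => _) = cst 0); first exact: measurable_cst.
    by apply/funext => w; rewrite big_nil.
  rewrite (_ : (fun w => _) = V s \+ (fun w => \sum_(x <- l) V x w)); last first.
    by apply/funext => w; rewrite big_cons.
  apply: measurable_funD; first by apply: pV; apply: lt; rewrite mem_head.
  by apply: IH => x xl; apply: lt; rewrite inE xl orbT.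
have mf n := past_measurable W_BM (pf n).
have p2 n : 0 < (2 ^ n.+1)%:R :> R by rewrite ltr0n expn_gt0.
have fK n w : `|f_ n w| <= K.
  rewrite /f_; case: cid => l /= [ln _ _].
  rewrite normrM ger0_norm ?invr_ge0// ler_pdivrMl// -ln.
  exact: norm_sum_seq_le.
have fC n : \int[P]_w ((f_ n w - time_mean V t w) ^+ 2) <= c / (2 ^ n.+1)%:R.
  rewrite /f_; case: cid => l /= [ln _ lC].
  rewrite (@eq_Rintegral _ _ _ P setT (fun w => ((2 ^ n.+1)%:R ^- 2) *
    ((\sum_(s <- l) V s w - (2 ^ n.+1)%:R * time_mean V t w) ^+ 2))); last first.
    by move=> w _; field; rewrite gt_eqF.
  rewrite RintegralZl//; last first.
    apply: (probability_integrable P (C := ((2 ^ n.+1)%:R * (K + K)) ^+ 2)).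
      apply: measurable_funX; apply: measurable_funB.
        by apply: measurable_sum => s; exact: measurable_slice1.
      by apply: measurable_funM => //; exact: measurable_time_mean.
    move=> w; rewrite normrX lerXn2r// ?nnegrE ?mulr_ge0 ?addr_ge0 ?(le_trans _ (VK 0 w))//.
    rewrite (le_trans (ler_normB _ _))// mulrDr lerD//.
      by rewrite -ln; exact: norm_sum_seq_le.
    by rewrite normrM ger0_norm// ler_wpM2l// time_mean_le.
  rewrite ler_pdivrMl ?exprn_gt0//; apply: (le_trans lC).
  rewrite le_eqVlt; apply/orP; left; apply/eqP; rewrite /c; field.
  by rewrite gt_eqF.
have [N [mN PN fN]] := ae_cvg_of_summable_L2 mf (measurable_time_mean mV VK t_gt0)
  fK (time_mean_le mV VK t_gt0) c0 fC.
(* The upper limit is defined and adapted everywhere, including on N where the averages may diverge;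
   off N it is the time average. *)
have plim : past P W t (fun w => fine (limn_esup (fun n => (f_ n w)%:E))).
  apply: (measurableT_comp (fine_measurable measurableT)).
  apply: measurable_fun_limn_esup => n; apply/measurable_EFinP; exact: pf.
apply: (past_negligible Pcomp mN PN plim) => w Nw.
have h : (f_ n w)%:E @[n --> \oo] --> (time_mean V t w)%:E.
  by apply: cvg_EFin; [exact: nearW|exact: fN].
by rewrite (cvg_limn_einf_sup h).2.
Qed.

End PastTimeMean.

Section PositivePart.
Variable R : realType.
Implicit Types s t : R.

Lemma max0_lip s t : `|Num.max 0 t - Num.max 0 s| <= `|t - s|.
Proof.
have := ler_norm (t - s); have := ler_norm (s - t); rewrite (distrC s t).
by rewrite /Num.max; case: ltP => h1; case: ltP => h2;
  rewrite ?subrr ?normr_ge0// ler_norml; lra.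
Qed.

Lemma continuous_max0 : continuous (fun t : R => Num.max 0 t).
Proof.
move=> t; apply/cvgrPdist_le => e e0; near=> s.
by rewrite (le_trans (max0_lip _ _))//; near: s; apply: cvgr_dist_le => //; exact: cvg_id.
Unshelve. all: by end_near. Qed.

End PositivePart.

(** * The controlled process and its drawdown *)

Section ControlledProcess.
Context (R : realType) (dm : measure_display) (T : measurableType dm).
Variables (P : probability T R) (W : R -> T -> R) (mu sigma u0 : R).
Hypotheses (Pcomp : complete_prob_space P) (W_BM : standard_BM P W).
Variable U : R -> T -> R.
Hypothesis U_adm : admissible P W u0 U.

(* The processes are frozen for negative times, so that they are defined and measurable on the
   whole line. *)
Definition control (t : R) (w : T) : R := U (Num.max 0 t) w.
Definition cumulated (t : R) (w : T) : R :=
  Rintegral lebesgue_measure (`[0, t]%classic : set (measurableTypeR R)) (U ^~ w).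
Local Notation X := (Xproc W mu sigma U).

Lemma control_itv t w : 0 <= control t w <= u0.
Proof. by case: U_adm => _ _; apply; rewrite le_max lexx. Qed.

Lemma control_norm_le t w : `|control t w| <= u0.
Proof. by have /andP[h1 h2] := control_itv t w; rewrite ger0_norm. Qed.

Lemma u0_ge0 : 0 <= u0.
Proof.
by have /andP[h1 h2] := control_itv 0 point; exact: le_trans h1 h2.
Qed.

Lemma controlE t w : 0 <= t -> control t w = U t w.
Proof. by move=> t0; rewrite /control max_r. Qed.

Lemma measurable_clamp d2 (T2 : measurableType d2) (f : R -> R) (V : R -> T2 -> R) :
  measurable_fun setT (fun p : R * T2 => V p.1 p.2) -> measurable_fun setT f ->
  measurable_fun setT (fun p : R * T2 => V (f p.1) p.2).
Proof.
move=> mV mf.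
have mg : measurable_fun setT (fun p : R * T2 => (f p.1, p.2)).
  apply/measurable_fun_pairP; split; last exact: measurable_snd.
  exact: measurableT_comp mf measurable_fst.
exact: (measurableT_comp mV mg).
Qed.

Lemma measurable_control : measurable_fun setT (fun p : R * T => control p.1 p.2).
Proof.
case: U_adm => mU _ _; apply: (measurable_clamp mU (f := Num.max 0)).
exact: measurable_maxr.
Qed.

Lemma cumulated_control t w :
  cumulated t w = Rintegral lebesgue_measure (`[0, t]%classic : set (measurableTypeR R)) (control ^~ w).
Proof.
apply: eq_Rintegral => s; rewrite inE /= in_itv/= => /andP[s0 _].
by rewrite controlE.
Qed.

Lemma cumulated0 w : cumulated 0 w = 0.
Proof. by rewrite /cumulated set_itv1 Rintegral_set1. Qed.

Let control_integrable (D : set (measurableTypeR R)) w : measurable D ->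
  (lebesgue_measure D < +oo)%E ->
  (@lebesgue_measure R).-integrable D (EFin \o control ^~ w).
Proof.
move=> mD Dfin; apply: (bounded_integrable (C := u0)) => //.
  by apply: measurable_funTS; exact: (measurable_slice2 measurable_control w).
by move=> s _; exact: control_norm_le.
Qed.

Lemma cumulatedB s t w : 0 <= s <= t -> cumulated t w - cumulated s w =
  Rintegral lebesgue_measure (`]s, t]%classic : set (measurableTypeR R)) (control ^~ w).
Proof.
move=> /andP[s0 st]; rewrite !cumulated_control.
rewrite (Rintegral_itvB (a := BLeft 0) (b := BRight t)) ?bnd_simp//.
apply: control_integrable => //.
have h := lebesgue_measure_itv `[0, t]; rewrite [X in (X < _)%E]h /=.
by case: ifP => _; rewrite ?ltry// -EFinB ltry.
Qed.

Lemma cumulated_incr_itv s t w : 0 <= s <= t ->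
  0 <= cumulated t w - cumulated s w <= u0 * (t - s).
Proof.
move=> st; rewrite cumulatedB//; have /andP[s0 st'] := st.
have Dm : lebesgue_measure (`]s, t]%classic : set (measurableTypeR R)) = (t - s)%:E.
  have h := lebesgue_measure_itv `]s, t]; rewrite [LHS]h /=.
  by rewrite lte_fin; case: ltgtP st' => // ->; rewrite subrr.
apply/andP; split.
  by apply: Rintegral_ge0 => x _; have /andP[] := control_itv x w.
rewrite (le_trans (ler_norm _))//.
have mD : measurable (`]s, t]%classic : set (measurableTypeR R)) by exact: measurable_itv.
have Dfin : (lebesgue_measure (`]s, t]%classic : set (measurableTypeR R)) < +oo)%E.
  by rewrite Dm ltry.
have mc := measurable_slice2 measurable_control w.
have := Rintegral_bound mD Dfin (measurable_funTS mc) (fun x _ => control_norm_le x w).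
by rewrite /= Dm.
Qed.

(** The restriction of U to [0, t] is not assumed jointly measurable for the filtration at time t,
    so Fubini alone would not give this; [past_time_mean] does. *)
Lemma past_cumulated t : 0 <= t -> past P W t (cumulated t).
Proof.
rewrite le_eqVlt => /predU1P[<-|t0].
  rewrite (_ : cumulated 0 = cst 0); first exact: measurable_cst.
  by apply/funext => w; rewrite cumulated0.
(* Clamping time to [0, t] bounds the process for every real s and leaves its integral over [0, t]
   unchanged. *)
pose clamp s : R := Num.max 0 (Num.min s t).
have clamp_itv s : 0 <= clamp s <= t.
  by rewrite /clamp le_max lexx /= ge_max ltW//= ge_min lexx orbT.
pose V s w := U (clamp s) w.
have mV : measurable_fun setT (fun p : R * T => V p.1 p.2).
  case: U_adm => mU _ _; apply: (measurable_clamp mU (f := clamp)).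
  by apply: measurable_maxr => //; exact: measurable_minr.
have VK s w : `|V s w| <= u0.
  have /andP[c0 _] := clamp_itv s.
  by case: U_adm => _ _ /(_ _ w c0) /andP[h1 h2]; rewrite ger0_norm.
have pV s : 0 <= s <= t -> past P W t (V s).
  move=> st; have /andP[c0 ct] := clamp_itv s; apply: (past_mono ct).
  by apply/pastP; case: U_adm => _ h _; exact: h.
have := past_time_mean Pcomp W_BM mV VK t0 pV.
move=> h; rewrite (_ : cumulated t = fun w => t * time_mean V t w).
  exact: measurable_funM.
apply/funext => w; rewrite /time_mean mulVKf ?gt_eqF//.
apply: eq_Rintegral => s; rewrite inE /= in_itv/= => /andP[s0 st].
by rewrite /V /clamp min_l// max_r.
Qed.

Lemma XprocE t w : X t w = mu * t + sigma * W t w - cumulated t w.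
Proof. by []. Qed.

Lemma past_Xproc s t : 0 <= s <= t -> past P W t (X s).
Proof.
move=> /andP[s0 st]; apply: (past_mono st).
apply: measurable_funB; last exact: past_cumulated.
apply: measurable_funD; first exact: measurable_cst.
by apply: measurable_funM => //; apply: past_BM; rewrite s0 lexx.
Qed.

Lemma Xproc0 w : X 0 w = 0.
Proof.
by rewrite XprocE cumulated0; case: W_BM => -> _ _ _ _; rewrite !mulr0 addr0 subr0.
Qed.

Lemma Xproc_incr s t w : X t w - X s w =
  mu * (t - s) + sigma * increment W s t w - (cumulated t w - cumulated s w).
Proof. by rewrite !XprocE /increment; ring. Qed.

Lemma cumulated_lip s t w : 0 <= s -> 0 <= t ->
  `|cumulated t w - cumulated s w| <= u0 * `|t - s|.
Proof.
wlog st : s t / s <= t => [H s0 t0|s0 t0].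
  by have [st|/ltW ts] := leP s t; [exact: H|rewrite distrC (distrC t); exact: H].
have /(@cumulated_incr_itv _ _ w)/andP[h1 h2] : 0 <= s <= t by rewrite s0.
by rewrite (ger0_norm h1) ger0_norm ?subr_ge0.
Qed.

Lemma continuous_cumulated_max w : continuous (fun t : R => cumulated (Num.max 0 t) w).
Proof.
move=> t; apply/cvgrPdist_le => e e0.
have u00 := u0_ge0.
near=> s.
rewrite (le_trans (cumulated_lip _ _ _)) ?le_max ?lexx//.
have h := max0_lip s t.
have h2 : `|t - s| <= e / (u0 + 1).
  near: s; exists (e / (u0 + 1)) => /=; last by move=> x /= /ltW.
  by rewrite divr_gt0// ltr_wpDl.
have h3 : u0 * (e / (u0 + 1)) <= e.
  by rewrite mulrCA ler_piMr ?(ltW e0)// ler_pdivrMr ?mul1r ?lerDl// ltr_wpDl.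
by rewrite (le_trans _ h3)// ler_wpM2l// (le_trans h).
Unshelve. all: by end_near. Qed.

Lemma continuous_BM_max w : continuous (fun t : R => W (Num.max 0 t) w).
Proof.
have /(_ w) /subspace_continuousP cW : forall w, {within [set t : R | 0 <= t], continuous (W ^~ w)}.
  by case: W_BM.
move=> t; have m0 : 0 <= Num.max 0 t by rewrite le_max lexx.
apply: cvg_comp (cW _ m0) => B /= [e e0 eB].
exists e => // s /= ts; apply: eB => /=; last by rewrite le_max lexx.
apply: le_lt_trans ts.
exact: max0_lip.
Qed.

Lemma continuous_Xproc_max w : continuous (fun t : R => X (Num.max 0 t) w).
Proof.
change (continuous (fun t : R => mu * Num.max 0 t + sigma * W (Num.max 0 t) w -
  cumulated (Num.max 0 t) w)).
move=> t.
apply: cvgB; last exact: continuous_cumulated_max.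
apply: cvgD; last by apply: cvgM; [exact: cvg_cst|exact: continuous_BM_max].
apply: cvgM; first exact: cvg_cst.
exact: continuous_max0.
Qed.

Section RunningMaximum.
Variables (z : R).
Local Notation M := (Mproc W mu sigma U z).

Lemma Xproc_sup_attained t w : 0 <= t ->
  exists2 c, 0 <= c <= t & forall s, 0 <= s <= t -> X s w <= X c w.
Proof.
move=> t0; have [c] := EVT_max t0 (continuous_subspaceT (@continuous_Xproc_max w)).
rewrite in_itv/= => ct h; exists c => // s st.
have /andP[s0 _] := st; have /andP[c0 _] := ct.
by have := h s; rewrite in_itv/= st !max_r//; exact.
Qed.

Let Xset t w := [set X s w | s in `[0, t]].

Let Xset_has_sup t w : 0 <= t -> has_sup (Xset t w).
Proof.
move=> t0; split; first by exists (X 0 w), 0 => //=; rewrite in_itv/= lexx.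
have [c _ hc] := Xproc_sup_attained w t0.
by exists (X c w) => _ [s /=] + <-; rewrite in_itv/= => st; exact: hc.
Qed.

Lemma Mproc_ge_start t w : z <= M t w.
Proof. by rewrite /Mproc le_max lexx. Qed.

Lemma Xproc_le_Mproc s t w : 0 <= s <= t -> X s w <= M t w.
Proof.
move=> st; have /andP[s0 st'] := st; rewrite /Mproc le_max; apply/orP; right.
apply: ub_le_sup; last by exists s => //=; rewrite in_itv.
by case: (@Xset_has_sup t w (le_trans s0 st')).
Qed.

Lemma Mproc_le t w b : 0 <= t -> z <= b -> (forall s, 0 <= s <= t -> X s w <= b) ->
  M t w <= b.
Proof.
move=> t0 zb Xb; rewrite /Mproc ge_max zb /=; apply: ge_sup.
  by exists (X 0 w), 0 => //=; rewrite in_itv/= lexx.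
by move=> _ [s /=] + <-; rewrite in_itv/= => st; exact: Xb.
Qed.

Lemma Dproc_ge0 t w : 0 <= t -> 0 <= Dproc W mu sigma U z t w.
Proof. by move=> t0; rewrite /Dproc subr_ge0 Xproc_le_Mproc// t0 lexx. Qed.

End RunningMaximum.

End ControlledProcess.

Lemma measurable_nat_family d1 d2 (T1 : measurableType d1) (T2 : measurableType d2)
    (R : realType) (k : T1 -> nat) (f : nat -> T2 -> R) :
  (forall n, measurable [set x | k x = n]) ->
  (forall n, measurable_fun setT (f n)) ->
  measurable_fun setT (fun p : T1 * T2 => f (k p.1) p.2).
Proof.
move=> mk mf _ B mB; rewrite setTI.
rewrite (_ : _ @^-1` B = \bigcup_n ([set x | k x = n] `*` (f n @^-1` B))).
  apply: bigcup_measurable => n _; apply: measurableX => //.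
  by rewrite -[X in measurable X]setTI; exact: mf.
by apply/seteqP; split => [[x y] /= h|[x y] [n _ [/= <-]]//]; exists (k x).
Qed.

(** * Uniform time grids *)

Section Grid.
Variable R : realType.
Implicit Types h t : R.

Definition grid_index h t : nat := Num.truncn (t / h).

Lemma grid_index_itv h t : 0 < h -> 0 <= t ->
  (grid_index h t)%:R * h <= t < (grid_index h t).+1%:R * h.
Proof.
move=> h0 t0; have /andP[a b] := truncn_itv (divr_ge0 t0 (ltW h0)).
by rewrite -ler_pdivlMr// -ltr_pdivrMr// a.
Qed.

Lemma le_grid_index h s t : 0 < h -> s <= t -> (grid_index h s <= grid_index h t)%N.
Proof. by move=> h0 st; apply: le_truncn; rewrite ler_pM2r ?invr_gt0. Qed.

Lemma grid_index_eq h t (n : nat) : 0 < h -> n%:R * h <= t < n.+1%:R * h ->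
  grid_index h t = n.
Proof.
by move=> h0 /andP[a b]; apply: truncn_def; rewrite ler_pdivlMr// ltr_pdivrMr// a.
Qed.

Lemma measurable_grid_index h n :
  measurable ([set t | grid_index h t = n] : set R).
Proof.
have mdiv : measurable_fun setT (fun t : R => t / h) by exact: measurable_funM.
have mle m : measurable ([set t | (grid_index h t <= m)%N] : set R).
  rewrite (_ : [set t | _] = (fun t : R => t / h) @^-1` `]-oo, m.+1%:R[).
    by rewrite -[X in measurable X]setTI; apply: mdiv => //; exact: measurable_itv.
  by apply/seteqP; split => t /=; rewrite /grid_index truncn_le_nat in_itv.
case: n => [|n].
  rewrite (_ : [set t | _] = [set t | (grid_index h t <= 0)%N])//.
  by apply/seteqP; split => t /=; [move=> ->|rewrite leqn0 => /eqP].
rewrite (_ : [set t | _] = [set t | (grid_index h t <= n.+1)%N] `\` [set t | (grid_index h t <= n)%N]).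
  exact: measurableD.
apply/seteqP; split => t /=; first by move=> ->; rewrite leqnn ltnn.
by move=> [a /negP]; rewrite -ltnNge => b; apply/eqP; rewrite eqn_leq a.
Qed.

Lemma cvg_grid (h_ : nat -> R) t : (forall n, 0 < h_ n) ->
  h_ n @[n --> \oo] --> 0 -> 0 <= t ->
  (grid_index (h_ n) t)%:R * h_ n @[n --> \oo] --> t.
Proof.
move=> h0 hc t0; apply/cvgrPdist_le => e e0.
move/cvgrPdist_le : hc => /(_ _ e0); apply: filterS => n.
rewrite sub0r normrN gtr0_norm// => he.
have /andP[a] := grid_index_itv (h0 n) t0; rewrite -natr1 mulrDl mul1r => b.
by rewrite ger0_norm ?subr_ge0//; lra.
Qed.

End Grid.

(** * Discrete reflection *)

Section DiscreteReflection.
Context (R : realType) (dm : measure_display) (T : measurableType dm).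
Variables (P : probability T R) (W : R -> T -> R) (mu sigma u0 : R).
Hypotheses (Pcomp : complete_prob_space P) (W_BM : standard_BM P W).
Variable U : R -> T -> R.
Hypothesis U_adm : admissible P W u0 U.
Variable z : R.
Hypothesis z_ge0 : 0 <= z.
Local Notation X := (Xproc W mu sigma U).
Local Notation M := (Mproc W mu sigma U z).
Local Notation Delta := (Dproc W mu sigma U z).

Fixpoint grid_max (h : R) (n : nat) (w : T) : R :=
  if n is m.+1 then Num.max (grid_max h m w) (X (n%:R * h) w) else z.

Definition grid_drawdown h n w : R := grid_max h n w - X (n%:R * h) w.

Lemma grid_max_ge_start h n w : z <= grid_max h n w.
Proof. by elim: n => [//|n IH] /=; rewrite le_max IH. Qed.

Lemma Xproc_le_grid_max h (j n : nat) w : (j <= n)%N ->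
  X (j%:R * h) w <= grid_max h n w.
Proof.
elim: n => [|n IH]; first by rewrite leqn0 => /eqP -> /=; rewrite mul0r (Xproc0 _ _ W_BM).
by rewrite leq_eqVlt => /predU1P[->|/IH jn]; rewrite [leRHS]/= le_max ?lexx ?orbT// jn.
Qed.

Lemma grid_drawdown0 h w : grid_drawdown h 0 w = z.
Proof. by rewrite /grid_drawdown /= mul0r (Xproc0 _ _ W_BM) subr0. Qed.

(** Lindley's recursion: the next value depends on the past only through the current one and the new
    increment of X. *)
Lemma grid_drawdownS h n w : grid_drawdown h n.+1 w =
  Num.max 0 (grid_drawdown h n w - (X (n.+1%:R * h) w - X (n%:R * h) w)).
Proof.
rewrite /grid_drawdown [grid_max _ _.+1 _]/=.
set a := grid_max h n w; set b := X _ _; set c := X _ _.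
rewrite (_ : a - c - (b - c) = a - b); last by ring.
by rewrite addr_maxl subrr maxC.
Qed.

Lemma grid_max_le h n w b : 0 < h -> z <= b ->
  (forall s, 0 <= s <= n%:R * h -> X s w <= b) -> grid_max h n w <= b.
Proof.
move=> h0 zb; elim: n => [//|n IH] Xb /=; rewrite ge_max IH ?Xb//.
  by rewrite lexx mulr_ge0// ltW.
move=> s /andP[s0 sn]; apply: Xb; rewrite s0 (le_trans sn)//.
by rewrite ler_wpM2r ?(ltW h0)// ler_nat.
Qed.

Lemma past_grid_drawdown h n : 0 < h -> past P W (n%:R * h) (grid_drawdown h n).
Proof.
move=> h0; apply: measurable_funB; last first.
  by apply: (past_Xproc _ _ Pcomp W_BM U_adm); rewrite lexx mulr_ge0// ltW.
have : forall m, (m <= n)%N -> past P W (n%:R * h) (grid_max h m).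
  elim => [_|m IH mn] /=; first exact: measurable_cst.
  apply: measurable_maxr; first by apply: IH; exact: ltnW.
  apply: (past_Xproc _ _ Pcomp W_BM U_adm); rewrite mulr_ge0//=; last exact: ltW.
  by rewrite ler_wpM2r ?(ltW h0)// ler_nat.
exact.
Qed.

(** The grid maximum never exceeds the true one. Conversely, X attains its supremum on [0, t] at
    some c, and the last grid point up to c, which enters the grid maximum, carries a value of X
    close to that at c by continuity. *)
Lemma cvg_grid_drawdown (h_ : nat -> R) t w : (forall n, 0 < h_ n) ->
  h_ n @[n --> \oo] --> 0 -> 0 <= t ->
  grid_drawdown (h_ n) (grid_index (h_ n) t) w @[n --> \oo] --> Delta t w.
Proof.
move=> h0 hc t0.
have [c /andP[c0 ct] cmax] := Xproc_sup_attained mu sigma W_BM U_adm w t0.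
have cvgX s : 0 <= s ->
    X ((grid_index (h_ n) s)%:R * h_ n) w @[n --> \oo] --> X s w.
  move=> s0.
  have cX := @continuous_Xproc_max _ _ _ _ _ mu sigma _ W_BM _ U_adm w s.
  have := cvg_comp _ _ (cvg_grid h0 hc s0) cX; rewrite max_r//.
  apply: cvg_trans; apply: near_eq_cvg; apply: nearW => n /=.
  by rewrite max_r// mulr_ge0// ltW.
apply: cvgB; last exact: cvgX.
apply/cvgrPdist_le => e e0.
move/cvgrPdist_le : (cvgX _ c0) => /(_ _ e0); apply: filterS => n Xce.
set j := grid_index _ c in Xce.
have /andP[k1 k2] := grid_index_itv (h0 n) t0.
have Mle : grid_max (h_ n) (grid_index (h_ n) t) w <= M t w.
  apply: grid_max_le => //; first exact: Mproc_ge_start.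
  move=> s /andP[s0 sk]; apply: (Xproc_le_Mproc mu sigma W_BM U_adm).
  by rewrite s0 (le_trans sk).
rewrite ger0_norm ?subr_ge0// lerBlDr.
have XcM : X c w <= e + grid_max (h_ n) (grid_index (h_ n) t) w.
  have := Xproc_le_grid_max (h_ n) w (le_grid_index (h0 n) ct).
  rewrite -/j; have := le_trans (ler_norm _) Xce; lra.
apply: Mproc_le => //.
- by rewrite (le_trans (grid_max_ge_start (h_ n) (grid_index (h_ n) t) w))// lerDr ltW.
- by move=> s /cmax /le_trans; apply.
Qed.

Lemma measurable_grid_drawdown h n : 0 < h -> measurable_fun setT (grid_drawdown h n).
Proof. by move=> h0; apply: (past_measurable W_BM (t := n%:R * h)); exact: past_grid_drawdown. Qed.

Definition step_drawdown h (t : R) (w : T) : R :=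
  grid_drawdown h (grid_index h (Num.max 0 t)) w.

Lemma measurable_step_drawdown h : 0 < h ->
  measurable_fun setT (fun p : R * T => step_drawdown h p.1 p.2).
Proof.
move=> h0; apply: (@measurable_nat_family _ _ _ _ _ (fun t : R => grid_index h (Num.max 0 t))
  (grid_drawdown h)) => [n|n]; last exact: measurable_grid_drawdown.
have mmax : measurable_fun setT (fun t : R => Num.max 0 t) by exact: measurable_maxr.
have := mmax measurableT _ (measurable_grid_index h n).
by rewrite setTI.
Qed.

Definition drawdown (t : R) (w : T) : R := Delta (Num.max 0 t) w.

Lemma cvg_step_drawdown (h_ : nat -> R) t w : (forall n, 0 < h_ n) ->
  h_ n @[n --> \oo] --> 0 -> step_drawdown (h_ n) t w @[n --> \oo] --> drawdown t w.
Proof. by move=> h0 hc; apply: cvg_grid_drawdown => //; rewrite le_max lexx. Qed.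

(** Joint measurability passes to the pointwise limit from the step processes, which take their
    values from countably many random variables. *)
Lemma measurable_drawdown : measurable_fun setT (fun p : R * T => drawdown p.1 p.2).
Proof.
apply: (measurable_fun_cvg (h := fun n p => step_drawdown (n.+1%:R^-1) p.1 p.2)).
  by move=> n; apply: measurable_step_drawdown; rewrite invr_gt0.
move=> p _; apply: cvg_step_drawdown => [n|]; first by rewrite invr_gt0.
exact: cvg_harmonic.
Qed.

Lemma drawdown_ge0 t w : 0 <= drawdown t w.
Proof. by apply: (Dproc_ge0 mu sigma W_BM U_adm); rewrite le_max lexx. Qed.

End DiscreteReflection.

(** * Dynkin's formula *)

(* The clause [test_neg] makes the reflection at 0 invisible: [F (max 0 x) = F x]. *)
Record smooth_test (R : realType) (F F1 F2 : R -> R) (K : R) : Prop := SmoothTest {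
  test_continuous : continuous F;
  test_continuous1 : continuous F1;
  test_continuous2 : continuous F2;
  test_bound : forall x, `|F x| <= K;
  test_bound1 : forall x, `|F1 x| <= K;
  test_bound2 : forall x, `|F2 x| <= K;
  test_taylor : forall x y,
    `|F (x - y) - F x + F1 x * y - F2 x / 2 * y ^+ 2| <= K * `|y| ^+ 3;
  test_neg : forall x, x <= 0 -> F x = F 0 }.

(** The two summands bound the coefficients of |e|^3 and of h^(3/2) in the pathwise remainder, e
    being the Brownian increment. The factor 32 is the bound on the third absolute moment, and each
    4 comes from (p + q)^3 <= 4 p^3 + 4 q^3. *)
Definition step_const (R : realType) (mu sigma u0 K : R) : R :=
  32 * (K * (4 * sigma ^+ 3 + sigma * (`|mu| + u0))) +
  K * (4 * (`|mu| + u0) ^+ 3 + sigma * (`|mu| + u0) + (`|mu| + u0) ^+ 2).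

Section TestFunction.
Context (R : realType) (dm : measure_display) (T : measurableType dm).
Variables (P : probability T R) (W : R -> T -> R) (mu sigma u0 : R).
Hypotheses (Pcomp : complete_prob_space P) (W_BM : standard_BM P W).
Hypothesis sigma_gt0 : 0 < sigma.
Variable U : R -> T -> R.
Hypothesis U_adm : admissible P W u0 U.
Variable z : R.
Hypothesis z_ge0 : 0 <= z.
Variables (F F1 F2 : R -> R) (K : R).
Hypothesis F_test : smooth_test F F1 F2 K.

Let cF : continuous F := test_continuous F_test.
Let cF1 : continuous F1 := test_continuous1 F_test.
Let cF2 : continuous F2 := test_continuous2 F_test.
Let FK : forall x, `|F x| <= K := test_bound F_test.
Let F1K : forall x, `|F1 x| <= K := test_bound1 F_test.
Let F2K : forall x, `|F2 x| <= K := test_bound2 F_test.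
Let taylor := test_taylor F_test.
Let F_neg : forall x, x <= 0 -> F x = F 0 := test_neg F_test.

Let X := Xproc W mu sigma U.
Let D := grid_drawdown W mu sigma U z.
Let c := sigma ^+ 2 / 2.
Let B := `|mu| + u0.
Let K1 := K * (4 * sigma ^+ 3 + sigma * B).
Let K2 := K * (4 * B ^+ 3 + sigma * B + B ^+ 2).

Let u0_ge0' : 0 <= u0. Proof. exact: u0_ge0 U_adm. Qed.
Let K_ge0 : 0 <= K. Proof. exact: le_trans (FK 0). Qed.
Let B_ge0 : 0 <= B. Proof. by rewrite addr_ge0. Qed.

Let mF : measurable_fun setT F. Proof. exact: continuous_measurable_fun. Qed.
Let mF1 : measurable_fun setT F1. Proof. exact: continuous_measurable_fun. Qed.
Let mF2 : measurable_fun setT F2. Proof. exact: continuous_measurable_fun. Qed.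

(** A pathwise estimate: e stands for the Brownian increment, a for the amount paid during the step,
    s for the square root of h. The terms in e and in e^2 - h are removed on the left because their
    expectations will vanish; what remains has order |e|^3 + s^3. *)
Lemma one_step_remainder (h s x e a : R) : 0 <= s <= 1 -> s ^+ 2 = h ->
  0 <= a <= u0 * h ->
  `|F (Num.max 0 (x - (mu * h + sigma * e - a))) - F x - F1 x * (a - mu * h)
    - c * h * F2 x + sigma * (F1 x * e) - c * (F2 x * (e ^+ 2 - h))|
  <= K1 * `|e| ^+ 3 + K2 * s ^+ 3.
Proof.
move=> /andP[s0 s1] sh /andP[a0 ah]; pose b := a - mu * h.
pose y := sigma * e - b.
have -> : mu * h + sigma * e - a = y by rewrite /y /b; ring.
have -> : F (Num.max 0 (x - y)) = F (x - y).
  by case: leP => // /ltW /F_neg ->.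
have h0 : 0 <= h by rewrite -sh sqr_ge0.
have bB : `|b| <= B * h.
  have : `|b| <= `|a| + `|mu * h| by exact: ler_normB.
  by rewrite normrM (ger0_norm h0) (ger0_norm a0) /B; lra.
have yB : `|y| <= sigma * `|e| + B * h.
  by rewrite /y (le_trans (ler_normB _ _))// lerD// normrM gtr0_norm.
set g := `|e| in yB *; have g0 : 0 <= g by exact: normr_ge0.
(* In y^2 the part sigma^2 e^2 is already accounted for on the left; only the terms containing the
   drift b remain beside the Taylor remainder. *)
have -> : F (x - y) - F x - F1 x * (a - mu * h) - c * h * F2 x
    + sigma * (F1 x * e) - c * (F2 x * (e ^+ 2 - h)) =
    (F (x - y) - F x + F1 x * y - F2 x / 2 * y ^+ 2) +
    F2 x * ((b ^+ 2 - 2 * sigma * e * b) / 2).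
  by rewrite /y /c -/b; field.
have s3 : s ^+ 4 <= s ^+ 3 by rewrite exprS ler_piMl// exprn_ge0.
have s6 : s ^+ 6 <= s ^+ 3.
  by rewrite (exprD s 3 3) ler_piMl ?exprn_ge0// exprn_ile1.
(* Since h = s^2, this product is at most the cube of the larger of g and s. *)
have gh : g * h <= g ^+ 3 + s ^+ 3.
  rewrite -sh; have [gs|/ltW sg] := leP g s.
    have : g * s ^+ 2 <= s * s ^+ 2 by rewrite ler_wpM2r ?sqr_ge0.
    by have := exprn_ge0 3 g0; rewrite -exprS; lra.
  have : g * s ^+ 2 <= g * g ^+ 2 by rewrite ler_wpM2l// lerXn2r// nnegrE.
  by have := exprn_ge0 3 s0; rewrite -exprS; lra.
have y3 : `|y| ^+ 3 <= 4 * sigma ^+ 3 * g ^+ 3 + 4 * B ^+ 3 * s ^+ 3.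
  have : `|y| ^+ 3 <= (sigma * g + B * h) ^+ 3.
    by rewrite lerXn2r// nnegrE ?addr_ge0 ?mulr_ge0// ltW.
  move/le_trans; apply.
  have p0 : 0 <= sigma * g by rewrite mulr_ge0// ltW.
  have q0 : 0 <= B * h by rewrite mulr_ge0.
  have : (sigma * g + B * h) ^+ 3 <= 4 * (sigma * g) ^+ 3 + 4 * (B * h) ^+ 3.
    move: (sigma * g) (B * h) p0 q0 => p q p0 q0.
    have : 0 <= (p + q) * (p - q) ^+ 2 by rewrite mulr_ge0 ?addr_ge0 ?sqr_ge0.
    nra.
  rewrite !exprMn -sh -exprM.
  have : B ^+ 3 * s ^+ 6 <= B ^+ 3 * s ^+ 3 by rewrite ler_wpM2l// exprn_ge0.
  lra.
have rest : `|(b ^+ 2 - 2 * sigma * e * b) / 2| <=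
    sigma * B * g ^+ 3 + (sigma * B + B ^+ 2) * s ^+ 3.
  have -> : (b ^+ 2 - 2 * sigma * e * b) / 2 = b ^+ 2 / 2 - sigma * e * b.
    by field.
  rewrite (le_trans (ler_normB _ _))//.
  have : `|b ^+ 2 / 2| <= B ^+ 2 * s ^+ 3.
    rewrite normrM normrX (ger0_norm (_ : 0 <= 2^-1))//.
    have : `|b| ^+ 2 <= (B * h) ^+ 2 by rewrite lerXn2r// nnegrE mulr_ge0.
    rewrite exprMn -sh -exprM => h1.
    have h2 : B ^+ 2 * s ^+ 4 <= B ^+ 2 * s ^+ 3 by rewrite ler_wpM2l// sqr_ge0.
    have h3 : 0 <= B ^+ 2 * s ^+ 3 by rewrite mulr_ge0 ?sqr_ge0 ?exprn_ge0.
    by move: h1 h2; rewrite (_ : (2 * 2)%N = 4%N)//; lra.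
  have : `|sigma * e * b| <= sigma * B * (g ^+ 3 + s ^+ 3).
    rewrite !normrM (gtr0_norm sigma_gt0) -/g.
    apply: (@le_trans _ _ (sigma * g * (B * h))).
      by rewrite ler_wpM2l// mulr_ge0// ltW.
    rewrite (_ : sigma * g * (B * h) = sigma * B * (g * h)); last by ring.
    by rewrite ler_wpM2l// mulr_ge0// ltW.
  lra.
apply: (le_trans (ler_normD _ _)).
have := taylor x y; have := ler_wpM2l K_ge0 y3.
have : `|F2 x * ((b ^+ 2 - 2 * sigma * e * b) / 2)| <=
    K * (sigma * B * g ^+ 3 + (sigma * B + B ^+ 2) * s ^+ 3).
  by rewrite normrM ler_pM.
rewrite /K1 /K2; lra.
Qed.

Let C1 := step_const mu sigma u0 K.

Let K1_ge0 : 0 <= K1.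
Proof. by rewrite mulr_ge0// addr_ge0// mulr_ge0 ?exprn_ge0// ltW. Qed.

Let int_bounded (f : T -> R) C : measurable_fun setT f -> (forall w, `|f w| <= C) ->
  P.-integrable setT (EFin \o f).
Proof. exact: probability_integrable. Qed.

(** The drawdown at the grid point is known before the increment e, so F'(D) e and F''(D)(e^2 - h)
    have mean 0. The payment during the step may depend on e, but it is of order h and its products
    with e are in the remainder. *)
Lemma one_step h n : 0 < h <= 1 ->
  `|\int[P]_w F (D h n.+1 w) - \int[P]_w F (D h n w)
    - \int[P]_w (F1 (D h n w) *
        (cumulated U (n.+1%:R * h) w - cumulated U (n%:R * h) w - mu * h)
        + c * h * F2 (D h n w))|
  <= C1 * (h * Num.sqrt h).
Proof.
move=> /andP[h0 h1].
pose s := Num.sqrt h; have s2 : s ^+ 2 = h by rewrite sqr_sqrtr// ltW.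
have s0 : 0 < s by rewrite sqrtr_gt0.
have s01 : 0 <= s <= 1 by rewrite ltW//= -sqrtr1 ler_wsqrtr.
pose t := n%:R * h; pose t' := n.+1%:R * h.
have t0 : 0 <= t by rewrite mulr_ge0// ltW.
have tt' : t < t' by rewrite ltr_pM2r// ltr_nat.
have t'E : t' - t = h by rewrite /t' /t -natr1; ring.
pose e := increment W t t'; pose a w := cumulated U t' w - cumulated U t w.
have me : measurable_fun setT e by exact: (measurable_increment W_BM).
have elaw : forall A, measurable A -> P [set w | A (e w)] = normal_prob 0 s A.
  by move=> A mA; rewrite (increment_law W_BM t0 tt' mA) t'E.
have ma : measurable_fun setT a.
  have pc u : 0 <= u -> measurable_fun setT (cumulated U u).
    by move=> u0'; apply: (past_measurable W_BM (t := u)); exact: (past_cumulated Pcomp W_BM U_adm).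
  by apply: measurable_funB; apply: pc => //; exact: ltW (le_lt_trans t0 tt').
have a_itv w : 0 <= a w <= u0 * h.
  by rewrite -t'E; apply: (cumulated_incr_itv U_adm); rewrite t0 ltW.
have pD : past P W t (D h n) by exact: (past_grid_drawdown mu sigma Pcomp W_BM U_adm).
have mD m : measurable_fun setT (D h m).
  exact: (measurable_grid_drawdown mu sigma Pcomp W_BM U_adm).
have mc (f : R -> R) m : measurable_fun setT f -> measurable_fun setT (fun w => f (D h m w)).
  by move=> mf; exact: (measurableT_comp mf (mD m)).
have pc (f : R -> R) : measurable_fun setT f -> past P W t (fun w => f (D h n w)).
  by move=> mf; exact: (measurableT_comp mf pD).
have DS w : D h n.+1 w = Num.max 0 (D h n w - (mu * h + sigma * e w - a w)).
  by rewrite /D grid_drawdownS Xproc_incr -/t -/t' t'E.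
have ie := integrable_gaussian s0 me elaw.
have ie2 := integrable_gaussian_sqr s0 me elaw.
have ie3 := integrable_gaussian_cube s0 me elaw.
have icst r : P.-integrable setT (EFin \o (fun=> r : R)).
  exact: finite_measure_integrable_cst.
have iq : P.-integrable setT (EFin \o (fun w => e w ^+ 2 - h)).
  exact: (integrableB measurableT ie2 (icst h)).
have iFn m : P.-integrable setT (EFin \o (fun w => F (D h m w))).
  by apply: (int_bounded (C := K)) => //; exact: mc.
have iF1 : P.-integrable setT (EFin \o (fun w => F1 (D h n w))).
  by apply: (int_bounded (C := K)) => //; exact: mc.
have iF2 : P.-integrable setT (EFin \o (fun w => F2 (D h n w))).
  by apply: (int_bounded (C := K)) => //; exact: mc.
have dom (f : T -> R) : measurable_fun setT f ->
    (forall w, `|f w| <= K * (1 + `|h| + `|e w| + e w ^+ 2)) -> P.-integrable setT (EFin \o f).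
  move=> mf fle; apply: (@le_integrable _ _ _ _ _ measurableT _
    (EFin \o (fun w => K * (1 + `|h| + `|e w| + e w ^+ 2)))) => //.
  - exact/measurable_EFinP.
  - by move=> w _; rewrite /= lee_fin (le_trans (fle w))// ler_norm.
  - have ia := integrable_norm ie.
    exact: (integrableZl measurableT K (integrableD measurableT
      (integrableD measurableT (icst (1 + `|h|)) ia) ie2)).
have ie1 : P.-integrable setT (EFin \o (fun w => F1 (D h n w) * e w)).
  apply: dom => [|w]; first by apply: measurable_funM => //; exact: mc.
  rewrite normrM ler_pM// -addrA addrCA lerDl.
  by rewrite !addr_ge0 ?sqr_ge0.
have iq2 : P.-integrable setT (EFin \o (fun w => F2 (D h n w) * (e w ^+ 2 - h))).
  apply: dom => [|w].
    apply: measurable_funM; first exact: mc.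
    by apply: measurable_funB => //; exact: measurable_funX.
  rewrite normrM ler_pM// (le_trans (ler_normB _ _))// (ger0_norm (sqr_ge0 _)).
  by have := normr_ge0 (e w); lra.
have ia : P.-integrable setT (EFin \o (fun w => F1 (D h n w) * (a w - mu * h))).
  apply: (int_bounded (C := K * (u0 * h + `|mu * h|))).
    by apply: measurable_funM; [exact: mc|exact: measurable_funB].
  move=> w; rewrite normrM ler_pM// (le_trans (ler_normB _ _))// lerD2r.
  by have /andP[aw1 aw2] := a_itv w; rewrite ger0_norm.
have zero1 : \int[P]_w (F1 (D h n w) * e w) = 0.
  rewrite (@Rintegral_past_increment _ _ _ P W W_BM t t' t0 tt' (fun w => F1 (D h n w)) id)//.
    by rewrite (Rintegral_gaussian s0 me elaw) mulr0.
  exact: pc.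
have zero2 : \int[P]_w (F2 (D h n w) * (e w ^+ 2 - h)) = 0.
  rewrite (@Rintegral_past_increment _ _ _ P W W_BM t t' t0 tt' (fun w => F2 (D h n w)) (fun x => x ^+ 2 - h))//.
  - rewrite RintegralB// (Rintegral_gaussian_sqr s0 me elaw) s2.
    by rewrite Rintegral_probability_cst subrr mulr0.
  - exact: pc.
  - by apply: measurable_funB => //; exact: measurable_funX.
pose Err w := F (D h n.+1 w) - F (D h n w)
   - (F1 (D h n w) * (a w - mu * h) + c * h * F2 (D h n w))
   + (sigma * (F1 (D h n w) * e w) - c * (F2 (D h n w) * (e w ^+ 2 - h))).
pose f3 w := F1 (D h n w) * (a w - mu * h) + c * h * F2 (D h n w).
pose f4 w := sigma * (F1 (D h n w) * e w) - c * (F2 (D h n w) * (e w ^+ 2 - h)).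
have i3 : P.-integrable setT (EFin \o f3).
  exact: (integrableD measurableT ia (integrableZl measurableT (c * h) iF2)).
have j1 : P.-integrable setT (EFin \o (fun w => sigma * (F1 (D h n w) * e w))).
  exact: (integrableZl measurableT sigma ie1).
have j2 : P.-integrable setT (EFin \o (fun w => c * (F2 (D h n w) * (e w ^+ 2 - h)))).
  exact: (integrableZl measurableT c iq2).
have i4 : P.-integrable setT (EFin \o f4) by exact: (integrableB measurableT j1 j2).
have i12 : P.-integrable setT (EFin \o (fun w => F (D h n.+1 w) - F (D h n w))).
  exact: (integrableB measurableT (iFn n.+1) (iFn n)).
have i123 : P.-integrable setT (EFin \o (fun w => F (D h n.+1 w) - F (D h n w) - f3 w)).
  exact: (integrableB measurableT i12 i3).
have iErr : P.-integrable setT (EFin \o Err) by exact: (integrableD measurableT i123 i4).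
have E4 : \int[P]_w f4 w = 0.
  by rewrite RintegralB// !RintegralZl// zero1 zero2 !mulr0 subrr.
have ErrE : \int[P]_w Err w = \int[P]_w F (D h n.+1 w) - \int[P]_w F (D h n w)
    - \int[P]_w f3 w.
  transitivity (\int[P]_w (F (D h n.+1 w) - F (D h n w) - f3 w) + \int[P]_w f4 w).
    exact: (RintegralD measurableT i123 i4).
  rewrite E4 addr0 (RintegralB measurableT i12 i3); congr (_ - _).
  exact: (RintegralB measurableT (iFn n.+1) (iFn n)).
(* [Err] differs from the quantity to be bounded by [f4], of mean 0, and it is [Err] that the
   pathwise remainder controls. *)
rewrite -ErrE.
apply: (le_trans (le_normr_Rintegral measurableT iErr)).
have iB : P.-integrable setT (EFin \o (fun w => K1 * `|e w| ^+ 3 + K2 * s ^+ 3)).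
  exact: (integrableD measurableT (integrableZl measurableT K1 ie3) (icst (K2 * s ^+ 3))).
apply: (@le_trans _ _ (\int[P]_w (K1 * `|e w| ^+ 3 + K2 * s ^+ 3))).
  apply: le_Rintegral => //; first exact: (integrable_norm iErr).
  move=> w _; have := one_step_remainder (D h n w) (e w) s01 s2 (a_itv w).
  rewrite -DS; congr (`| _ | <= _); rewrite /Err; ring.
rewrite RintegralD//; last exact: (integrableZl measurableT K1 ie3).
rewrite RintegralZl// Rintegral_probability_cst.
have -> : h * Num.sqrt h = s ^+ 3 by rewrite -/s -s2 -exprSr.
rewrite /C1 /step_const -/B -/K1 -/K2 mulrDl lerD// (_ : 32 * K1 * s ^+ 3 = K1 * (32 * s ^+ 3)); last by ring.
by apply: ler_wpM2l => //; exact: (Rintegral_gaussian_cube_le s0 me elaw).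
Qed.

End TestFunction.

(** * From one step to continuous time *)

Section Dynkin.
Context (R : realType) (dm : measure_display) (T : measurableType dm).
Variables (P : probability T R) (W : R -> T -> R) (mu sigma u0 : R).
Hypotheses (Pcomp : complete_prob_space P) (W_BM : standard_BM P W).
Hypothesis sigma_gt0 : 0 < sigma.
Variable U : R -> T -> R.
Hypothesis U_adm : admissible P W u0 U.
Variable z : R.
Hypothesis z_ge0 : 0 <= z.
Variables (F F1 F2 : R -> R) (K : R).
Hypothesis F_test : smooth_test F F1 F2 K.

Let cF : continuous F := test_continuous F_test.
Let cF1 : continuous F1 := test_continuous1 F_test.
Let cF2 : continuous F2 := test_continuous2 F_test.
Let FK : forall x, `|F x| <= K := test_bound F_test.
Let F1K : forall x, `|F1 x| <= K := test_bound1 F_test.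
Let F2K : forall x, `|F2 x| <= K := test_bound2 F_test.
Let taylor := test_taylor F_test.
Let F_neg : forall x, x <= 0 -> F x = F 0 := test_neg F_test.

Let X := Xproc W mu sigma U.
Let D := grid_drawdown W mu sigma U z.
Let c := sigma ^+ 2 / 2.

Let u0_ge0' : 0 <= u0. Proof. exact: u0_ge0 U_adm. Qed.
Let K_ge0 : 0 <= K. Proof. exact: le_trans (FK 0). Qed.

Let mF : measurable_fun setT F. Proof. exact: continuous_measurable_fun. Qed.
Let mF1 : measurable_fun setT F1. Proof. exact: continuous_measurable_fun. Qed.
Let mF2 : measurable_fun setT F2. Proof. exact: continuous_measurable_fun. Qed.

Let C1 := step_const mu sigma u0 K.
(** The generator of the drawdown applied to F: drift control minus mu, since the drawdown moves
    opposite to X, and variance sigma^2. *)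
Let G (s : R) (w : T) (x : R) : R := F1 x * (control U s w - mu) + c * F2 x.

Let KG := K * (u0 + `|mu|) + c * K.

Let c_ge0 : 0 <= c. Proof. by rewrite divr_ge0// sqr_ge0. Qed.

Let GK s w x : `|G s w x| <= KG.
Proof.
rewrite /G (le_trans (ler_normD _ _))// lerD//.
  rewrite normrM ler_pM// (le_trans (ler_normB _ _))// lerD2r.
  exact: control_norm_le U_adm _ _.
by rewrite normrM (ger0_norm c_ge0) ler_wpM2l.
Qed.

Let mG (V : R -> T -> R) : measurable_fun setT (fun p : R * T => V p.1 p.2) ->
  measurable_fun setT (fun p : R * T => G p.1 p.2 (V p.1 p.2)).
Proof.
move=> mV; apply: measurable_funD.
  apply: measurable_funM; first exact: (measurableT_comp mF1 mV).
  by apply: measurable_funB => //; exact: (measurable_control U_adm).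
by apply: measurable_funM => //; exact: (measurableT_comp mF2 mV).
Qed.

Let Dst := step_drawdown W mu sigma U z.
Let Dr := drawdown W mu sigma U z.
Let g_ h s := \int[P]_w G s w (Dst h s w).
Let g s := \int[P]_w G s w (Dr s w).

Let itv_integrable (f : R -> R) (C : R) (i : interval R) :
  measurable_fun setT f -> (forall s, `|f s| <= C) ->
  (lebesgue_measure ([set` i] : set (measurableTypeR R)) < +oo)%E ->
  (@lebesgue_measure R).-integrable ([set` i] : set (measurableTypeR R)) (EFin \o f).
Proof.
move=> mf fC ifin; apply: (bounded_integrable (C := C)) => //.
  by apply: measurable_funTS.
Qed.

Let itv_fin (b1 b2 : bool) (x y : R) : (lebesgue_measure
  ([set` Interval (BSide b1 x) (BSide b2 y)] : set (measurableTypeR R)) < +oo)%E.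
Proof.
have h := lebesgue_measure_itv (Interval (BSide b1 x) (BSide b2 y)).
rewrite [X in (X < _)%E]h /=; by case: ifP => _; rewrite ?ltry// -EFinB ltry.
Qed.

Let m_expect (V : R -> T -> R) : measurable_fun setT (fun p : R * T => V p.1 p.2) ->
  measurable_fun setT (fun s => \int[P]_w G s w (V s w)).
Proof.
move=> mV.
exact: (@measurable_Rintegral_slice1 _ _ (measurableTypeR R) T R P setT setT
  (fun s w => G s w (V s w)) KG measurableT measurableT (probability_fin P) (mG mV)
  (fun s w => GK s w _)).
Qed.

Let expect_le (V : R -> T -> R) : measurable_fun setT (fun p : R * T => V p.1 p.2) ->
  forall s, `|\int[P]_w G s w (V s w)| <= KG.
Proof.
move=> mV s; apply: (Rintegral_probability_bound P (C := KG)) => [|w]; last exact: GK.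
exact: (@measurable_slice1 _ _ R T R (fun s w => G s w (V s w)) (mG mV) s).
Qed.

(** The one-step errors add up. On a cell the step drawdown is frozen at the left grid point, so
    integrating the generator over the cell reproduces the compensator of [one_step] exactly. *)
Lemma grid_dynkin h n : 0 < h <= 1 ->
  `|\int[P]_w F (D h n w) - F z
     - Rintegral lebesgue_measure (`[0, n%:R * h]%classic : set (measurableTypeR R)) (g_ h)|
  <= n%:R * (C1 * (h * Num.sqrt h)).
Proof.
move=> h01; have /andP[h0 h1] := h01.
have mst : measurable_fun setT (fun p : R * T => Dst h p.1 p.2).
  exact: (measurable_step_drawdown mu sigma Pcomp W_BM U_adm).
have ig (i : interval R) : (lebesgue_measure ([set` i] : set (measurableTypeR R)) < +oo)%E ->
    (@lebesgue_measure R).-integrable ([set` i] : set (measurableTypeR R)) (EFin \o g_ h).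
  by move=> ifin; apply: (itv_integrable (m_expect mst) (expect_le mst)).
elim: n => [|n IH].
  rewrite mul0r set_itv1 Rintegral_set1 subr0 mul0r.
  rewrite (@eq_Rintegral _ _ _ P setT (fun=> F z)); last first.
    by move=> w _; rewrite /D (grid_drawdown0 _ _ W_BM).
  by rewrite Rintegral_probability_cst subrr normr0.
pose t := n%:R * h; pose t' := n.+1%:R * h.
have t0 : 0 <= t by rewrite mulr_ge0// ltW.
have tt' : t < t' by rewrite ltr_pM2r// ltr_nat.
have t'E : t' - t = h by rewrite /t' /t -natr1; ring.
have step : Rintegral lebesgue_measure (`]t, t']%classic : set (measurableTypeR R)) (g_ h) =
    \int[P]_w (F1 (D h n w) * (cumulated U t' w - cumulated U t w - mu * h)
        + c * h * F2 (D h n w)).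
  have mDn := measurable_grid_drawdown mu sigma Pcomp W_BM U_adm z n h0.
  have mV : measurable_fun setT (fun p : R * T => D h n p.2).
    exact: (measurableT_comp mDn measurable_snd).
  pose I : set (measurableTypeR R) := `]t, t']%classic.
  have mI : measurable I by exact: measurable_itv.
  have Im : lebesgue_measure I = h%:E.
    have hh := lebesgue_measure_itv `]t, t']; rewrite [LHS]hh /=.
    by rewrite lte_fin tt' -EFinB t'E.
  transitivity (Rintegral lebesgue_measure I (fun s => \int[P]_w G s w (D h n w))).
    (* Grid cells are closed on the left, the intervals of [cumulatedB] on the right. The comparison
       is made on the open interval, the endpoint being null. *)
    have iV : (@lebesgue_measure R).-integrable (`]t, t'[%classic : set (measurableTypeR R))
        (EFin \o (fun s => \int[P]_w G s w (D h n w))).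
      apply: (itv_integrable (m_expect (V := fun s w => D h n w) mV)
        (expect_le (V := fun s w => D h n w) mV)); exact: itv_fin.
    have ig' := ig `]t, t'[ (itv_fin _ _ _ _).
    transitivity (Rintegral lebesgue_measure (`]t, t'[%classic : set (measurableTypeR R)) (g_ h)).
      exact: (esym (Rintegral_itv_bndo_bndc ig')).
    transitivity (Rintegral lebesgue_measure (`]t, t'[%classic : set (measurableTypeR R))
        (fun s => \int[P]_w G s w (D h n w))); last first.
      exact: (Rintegral_itv_bndo_bndc iV).
    apply: eq_Rintegral => s; rewrite inE /= in_itv/= => /andP[ts st'].
    apply: eq_Rintegral => w _; rewrite /Dst /step_drawdown max_r; last first.
      by rewrite (le_trans t0)// ltW.
    by rewrite (grid_index_eq h0 (n := n))// (ltW ts).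
  (* With the drawdown frozen, the time integral acts on the control alone and yields the increment
     of [cumulated]. *)
  apply: (etrans (@Rintegral_Fubini _ _ (measurableTypeR R) T R (@lebesgue_measure R) P I setT
    (fun s w => G s w (D h n w)) KG mI measurableT (itv_fin _ _ _ _) (probability_fin P)
    (mG (V := fun s w => D h n w) mV) (fun s w => GK s w _))).
  apply: eq_Rintegral => w _.
  rewrite (cumulatedB U_adm w (_ : 0 <= t <= t')) ?t0 ?(ltW tt')// -/I.
  have ictl : (@lebesgue_measure R).-integrable I (EFin \o control U ^~ w).
    apply: (bounded_integrable (C := u0)) => //; first exact: itv_fin.
      by apply: measurable_funTS; exact: (measurable_slice2 (measurable_control U_adm) w).
    by move=> s _; exact: (control_norm_le U_adm).
  have icst r : (@lebesgue_measure R).-integrable I (EFin \o (fun=> r : R)).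
    by apply: (bounded_integrable (C := `|r|)) => //; exact: itv_fin.
  have iB : (@lebesgue_measure R).-integrable I (EFin \o (fun s => control U s w - mu)).
    exact: (integrableB mI ictl (icst mu)).
  have iM : (@lebesgue_measure R).-integrable I
      (EFin \o (fun s => F1 (D h n w) * (control U s w - mu))).
    exact: (integrableZl mI (F1 (D h n w)) iB).
  rewrite /G RintegralD// RintegralZl// RintegralB// !Rintegral_cst//.
  rewrite /= Im /=; ring.
have split : Rintegral lebesgue_measure (`[0, t']%classic : set (measurableTypeR R)) (g_ h) =
   Rintegral lebesgue_measure (`[0, t]%classic : set (measurableTypeR R)) (g_ h) +
   Rintegral lebesgue_measure (`]t, t']%classic : set (measurableTypeR R)) (g_ h).
  rewrite -(Rintegral_itvB (a := BLeft 0) (b := BRight t')) ?bnd_simp ?(ltW tt')//.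
    by rewrite addrC subrK.
  by apply: ig; exact: itv_fin.
have st : `|\int[P]_w F (D h n.+1 w) - \int[P]_w F (D h n w) -
    Rintegral lebesgue_measure (`]t, t']%classic : set (measurableTypeR R)) (g_ h)|
    <= C1 * (h * Num.sqrt h).
  by rewrite step; exact: (one_step mu Pcomp W_BM sigma_gt0 U_adm z F_test n h01).
move: IH; rewrite -/t -/t' split => IH.
have telescope (p q f i j : R) : q - f - (i + j) = (p - f - i) + (q - p - j) by ring.
rewrite (telescope (\int[P]_w F (D h n w))) -natr1 mulrDl mul1r.
exact: (le_trans (ler_normD _ _) (lerD IH st)).
Qed.

Let mDr : measurable_fun setT (fun p : R * T => Dr p.1 p.2).
Proof. exact: (measurable_drawdown mu sigma Pcomp W_BM U_adm z_ge0). Qed.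

Let cvg_expect (h_ : nat -> R) : (forall n, 0 < h_ n) -> h_ n @[n --> \oo] --> 0 ->
  forall s, g_ (h_ n) s @[n --> \oo] --> g s.
Proof.
move=> h0 hc s.
have slice (V : R -> T -> R) : measurable_fun setT (fun p : R * T => V p.1 p.2) ->
    measurable_fun setT (fun w => G s w (V s w)).
  by move=> mV; exact: (@measurable_slice1 _ _ R T R (fun s w => G s w (V s w)) (mG mV) s).
apply: (bounded_convergence (C := KG) measurableT (probability_fin P)).
- by move=> n; apply: slice; exact: (measurable_step_drawdown mu sigma Pcomp W_BM U_adm).
- by apply: slice.
- by move=> n w _; exact: GK.
- move=> w _; have cD := cvg_step_drawdown (mu := mu) (sigma := sigma) (t := s) (w := w) W_BM U_adm z_ge0 h0 hc.
  apply: cvgD; apply: cvgM; [|exact: cvg_cst|exact: cvg_cst|].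
    apply: continuous_cvg; [exact: cF1|exact: cD].
  apply: continuous_cvg; [exact: cF2|exact: cD].
Qed.

Lemma drawdown0 w : drawdown W mu sigma U z 0 w = z.
Proof.
have h0 n : 0 < n.+1%:R^-1 :> R by rewrite invr_gt0.
have := cvg_step_drawdown (mu := mu) (sigma := sigma) (t := 0) (w := w)
  W_BM U_adm z_ge0 h0 (@cvg_harmonic R).
rewrite (_ : (fun n => _) = (fun=> z)) => [c0|].
  by apply: (cvg_unique _ c0 (cvg_cst z)).
apply/funext => n; rewrite /step_drawdown maxxx (grid_index_eq (h0 n) (n := 0)).
  by rewrite (grid_drawdown0 _ _ W_BM).
by rewrite mul0r lexx mul1r h0.
Qed.

Lemma expectation_drawdown t : 0 <= t -> \int[P]_w F (drawdown W mu sigma U z t w) =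
  F z + Rintegral lebesgue_measure (`[0, t]%classic : set (measurableTypeR R)) g.
Proof.
rewrite le_eqVlt => /predU1P[<-|t0].
  rewrite set_itv1 Rintegral_set1 addr0 -[RHS](Rintegral_probability_cst P).
  by apply: eq_Rintegral => w _; rewrite drawdown0.
pose N := Num.truncn t.
(* The mesh t / k makes t itself a grid point, and k > t keeps the mesh at most 1. The accumulated
   error k C1 h^(3/2) is then t C1 sqrt h, which vanishes. *)
pose k m := (m + N).+1; pose h_ m : R := t / (k m)%:R.
have k0 m : 0 < (k m)%:R :> R by rewrite ltr0n.
have h0 m : 0 < h_ m by rewrite divr_gt0.
have h1 m : h_ m <= 1.
  rewrite /h_ ler_pdivrMr// mul1r; apply: ltW; apply: lt_le_trans (truncnS_gt t) _.
  by rewrite ler_nat ltnS leq_addl.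
have khE m : (k m)%:R * h_ m = t by rewrite mulrC divfK// gt_eqF.
have hc : h_ m @[m --> \oo] --> 0.
  have : (t * (m + N).+1%:R^-1) @[m --> \oo] --> t * 0.
    by apply: cvgMr; have := @cvg_harmonic R; rewrite -(cvg_shiftn N).
  by rewrite mulr0.
pose a m := \int[P]_w F (D (h_ m) (k m) w) - F z -
  Rintegral lebesgue_measure (`[0, t]%classic : set (measurableTypeR R)) (g_ (h_ m)).
have Dk m w : D (h_ m) (k m) w = Dst (h_ m) t w.
  rewrite /Dst /step_drawdown max_r ?(ltW t0)// (grid_index_eq (h0 m) (n := k m))//.
  by rewrite khE lexx /= -natr1 mulrDl khE mul1r ltrDl.
have kE m : (k m)%:R * (C1 * (h_ m * Num.sqrt (h_ m))) = t * (C1 * Num.sqrt (h_ m)).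
  by rewrite mulrCA (mulrA (k m)%:R) khE mulrCA.
have ale m : `|a m| <= t * (C1 * Num.sqrt (h_ m)).
  have h01 : 0 < h_ m <= 1 by rewrite h0 h1.
  by have := grid_dynkin (k m) h01; rewrite khE kE.
pose L := \int[P]_w F (Dr t w) - F z -
  Rintegral lebesgue_measure (`[0, t]%classic : set (measurableTypeR R)) g.
have ac : a m @[m --> \oo] --> L.
  apply: cvgB; first apply: cvgB; last 2 first.
  - exact: cvg_cst.
  - have mI : measurable (`[0, t]%classic : set (measurableTypeR R)).
      exact: measurable_itv.
    apply: (bounded_convergence (C := KG) mI (itv_fin _ _ _ _)).
    + by move=> m; apply: measurable_funTS; apply: m_expect; exact: (measurable_step_drawdown mu sigma Pcomp W_BM U_adm).
    + by apply: measurable_funTS; exact: m_expect.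
    + by move=> m s _; apply: expect_le; exact: (measurable_step_drawdown mu sigma Pcomp W_BM U_adm).
    + by move=> s _; exact: cvg_expect.
  apply: (bounded_convergence (C := K) measurableT (probability_fin P)).
  - move=> m; apply: (measurableT_comp mF).
    exact: (measurable_grid_drawdown mu sigma Pcomp W_BM U_adm z (k m) (h0 m)).
  - by apply: (measurableT_comp mF); exact: (@measurable_slice1 _ _ R T R _ mDr t).
  - by move=> m w _; exact: FK.
  - move=> w _; have cD := cvg_step_drawdown (mu := mu) (sigma := sigma) (t := t) (w := w) W_BM U_adm z_ge0 h0 hc.
    apply: continuous_cvg; first exact: cF.
    by rewrite (_ : (fun m => D (h_ m) (k m) w) = (fun m => Dst (h_ m) t w)) //; apply/funext => m.
have bc : t * (C1 * Num.sqrt (h_ m)) @[m --> \oo] --> 0.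
  rewrite (_ : 0 = t * (C1 * Num.sqrt 0)); last by rewrite sqrtr0 !mulr0.
  by apply: cvgMr; apply: cvgMr; exact: (cvg_comp _ _ hc (@sqrt_continuous R 0)).
have L0 : `|L| <= 0.
  by apply: (ler_cvg_to (cvg_norm ac) bc); apply: nearW.
have : L = 0 by apply/eqP; rewrite -normr_le0.
by move/eqP; rewrite /L -addrA -opprD subr_eq0 => /eqP.
Qed.

End Dynkin.

(** * Exponential discounting *)

Section Discounting.
Variables (R : realType) (r : R).
Hypothesis r_gt0 : 0 < r.
Notation leb := (@lebesgue_measure R).

Let half_line : set (measurableTypeR R) := `[0, +oo[%classic.

Let mhalf : measurable half_line. Proof. exact: measurable_itv. Qed.

Definition exponential_law : probability (measurableTypeR R) R :=
  exponential_distribution_exponential_prob__canonical__probability_measure_Probability r_gt0.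

Notation nu := exponential_law.

Let pdf := exponential_pdf r.

Let pdf_ge0 x : 0 <= pdf x. Proof. by apply: exponential_pdf_ge0; exact: ltW. Qed.

Let mpdf : measurable_fun setT pdf. Proof. exact: measurable_exponential_pdf. Qed.

Lemma ge0_integral_exponential (f : R -> \bar R) : measurable_fun setT f ->
  (forall x, 0 <= f x)%E ->
  (\int[nu]_x f x = \int[leb]_x (f x * (pdf x)%:E))%E.
Proof.
move=> mf f0.
exact: (@ge0_integral_density _ (measurableTypeR R) R leb nu pdf pdf_ge0 mpdf _ f mf f0).
Qed.

Let cexpNM : continuous (fun x : R => expR (- r * x)).
Proof.
move=> x; apply: continuous_comp; last exact: continuous_expR.
by apply: cvgM; [exact: cvg_cst|exact: cvg_id].
Qed.

Lemma exponential_law_tail s : 0 <= s ->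
  (\int[leb]_(t in (`[s, +oo[%classic : set (measurableTypeR R))) (pdf t)%:E =
   (expR (- r * s))%:E)%E.
Proof.
move=> s0.
rewrite (@ge0_continuous_FTC2y _ _ (fun x => - (expR (- r * x))) _ 0)//.
- by rewrite EFinN oppeK add0e.
- apply: (@continuous_subspaceW R^o _ _ [set` `[0, +oo[%R]).
    by apply: subset_itvr; rewrite bnd_simp.
  exact: within_continuous_exponential_pdf.
- rewrite -oppr0; apply: cvgN.
  rewrite (_ : (fun x => expR (- r * x)) =
               (fun z => expR (- z)) \o (fun z => r * z)); last first.
    by apply: eq_fun => x; rewrite mulNr.
  apply: (@cvg_comp _ _ _ _ _ _ (pinfty_nbhs R)); last exact: cvgr_expR.
  exact: gt0_cvgMry.
- by apply: cvgN; apply/cvg_at_right_filter; exact: cexpNM.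
- move=> x; rewrite in_itv/= andbT => sx; apply: derive1_exponential_pdf.
  by rewrite in_itv/= andbT (le_lt_trans s0).
Qed.

(** The exponential density is r exp(-r t), whence the factor 1/r. The nonnegative case is read off
    the density; f is reached by subtracting the identity for C from that for f + C. *)
Lemma Rintegral_discount (f : R -> R) (C : R) : measurable_fun setT f ->
  (forall t, `|f t| <= C) ->
  Rintegral leb half_line (fun t => expR (- r * t) * f t) = r^-1 * \int[nu]_t f t.
Proof.
move=> mf fC; have C0 : 0 <= C by exact: le_trans (fC 0).
have mexp : measurable_fun setT (fun t : R => expR (- r * t)).
  exact: continuous_measurable_fun.
have ge0_case (h : R -> R) : measurable_fun setT h -> (forall t, 0 <= h t) ->
    (\int[nu]_t (h t)%:E = r%:E * \int[leb]_(t in half_line) (expR (- r * t) * h t)%:E)%E.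
  move=> mh h0; rewrite ge0_integral_exponential; last 2 first.
  - exact/measurable_EFinP.
  - by move=> x; rewrite lee_fin.
  rewrite -ge0_integralZl//; last 3 first.
  - by apply/measurable_EFinP; apply: measurable_funTS; exact: measurable_funM.
  - by move=> t _; rewrite lee_fin mulr_ge0// expR_ge0.
  - by rewrite lee_fin ltW.
  rewrite [RHS]integral_mkcond; apply: eq_integral => t _.
  rewrite /pdf /exponential_pdf !patchE; case: ifP => _; last by rewrite mule0.
  by rewrite -!EFinM; congr _%:E; ring.
pose q t := expR (- r * t) * f t; pose q0 t := expR (- r * t) * C.
have iC : nu.-integrable setT (EFin \o (fun=> C)).
  exact: finite_measure_integrable_cst.
have iq0 : leb.-integrable half_line (EFin \o q0).
  apply/integrableP; split.
    by apply/measurable_EFinP; apply: measurable_funTS; exact: measurable_funM.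
  have h : (\int[nu]_t C%:E < +oo)%E.
    by rewrite (EFin_Rintegral measurableT iC) ltry.
  rewrite (eq_integral (fun t : measurableTypeR R => (q0 t)%:E)); last first.
    by move=> t _; rewrite /= ger0_norm// mulr_ge0// expR_ge0.
  (* An infinite integral of [q0] would make the mean of the constant C infinite. *)
  move: h; rewrite (ge0_case (fun=> C))//.
  set I := (\int[_]_(_ in _) _)%E; case: I => [x _|h|_]; [exact: ltry| |by []].
  by move: h; rewrite gt0_muley ?lte_fin// ltxx.
have iq : leb.-integrable half_line (EFin \o q).
  apply: (le_integrable mhalf _ _ iq0).
    by apply/measurable_EFinP; apply: measurable_funTS; exact: measurable_funM.
  by move=> t _; rewrite /= lee_fin /q /q0 !normrM (ger0_norm C0) ler_wpM2l.
have if_ : nu.-integrable setT (EFin \o f) by exact: (probability_integrable nu mf fC).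
have real_case (h : R -> R) : measurable_fun setT h -> (forall t, 0 <= h t) ->
    nu.-integrable setT (EFin \o h) ->
    leb.-integrable half_line (EFin \o (fun t => expR (- r * t) * h t)) ->
    \int[nu]_t h t = r * Rintegral leb half_line (fun t => expR (- r * t) * h t).
  move=> mh h0 ih ih'; apply: EFin_inj.
  by rewrite EFinM -!EFin_Rintegral// ge0_case.
have fC0 x : 0 <= f x + C.
  by rewrite -lerBlDr sub0r; have := fC x; rewrite ler_norml => /andP[].
have i2 : leb.-integrable half_line (EFin \o (fun t => q t + q0 t)).
  exact: (integrableD mhalf iq iq0).
have i2' : leb.-integrable half_line (EFin \o (fun t => expR (- r * t) * (f t + C))).
  by rewrite (_ : (fun t => _ * _) = (fun t => q t + q0 t))//; apply/funext => t; rewrite /q /q0 mulrDr.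
have e1 := real_case (fun=> C) (measurable_cst _) (fun=> C0) iC iq0.
have e2 := real_case (fun t => f t + C) (measurable_funD mf (measurable_cst _)) fC0
  (integrableD measurableT if_ iC) i2'.
have e3 : Rintegral leb half_line (fun t => expR (- r * t) * (f t + C)) =
    Rintegral leb half_line q + Rintegral leb half_line q0.
  rewrite -(RintegralD mhalf iq iq0); apply: eq_Rintegral => t _.
  by rewrite /q /q0 mulrDr.
rewrite (RintegralD measurableT if_ iC) e1 e3 mulrDr in e2.
by move/addIr : e2 => ->; rewrite mulKf// gt_eqF.
Qed.

Let kernel (g : R -> R) (p : measurableTypeR R * measurableTypeR R) : \bar R :=
  (if (0 <= p.2) && (p.2 <= p.1) then g p.2 else 0)%:E.

Let measurable_kernel (g : R -> R) : measurable_fun setT g -> measurable_fun setT (kernel g).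
Proof.
move=> mg; apply/measurable_EFinP; apply: measurable_fun_ifT => //.
- apply: measurable_and; apply: measurable_fun_ler => //.
- exact: (measurableT_comp mg measurable_snd).
Qed.

Let kernelE (g : R -> R) (t : R) :
  (\int[leb]_(s in (`[0%R, t]%classic : set (measurableTypeR R))) (g s)%:E =
   \int[leb]_s kernel g (t, s))%E.
Proof.
rewrite integral_mkcond; apply: eq_integral => s _.
by rewrite /kernel patchE mem_setE in_itv /=; case: ifP.
Qed.

(** By Tonelli, g(s) is weighted by the probability that the exponential time exceeds s, namely
    exp(-r s), which is 1/r times the density at s. *)
Lemma ge0_integral_exponential_cumulative (g : R -> R) : measurable_fun setT g ->
  (forall s, 0 <= g s) ->
  (\int[nu]_t \int[leb]_(s in (`[0%R, t]%classic : set (measurableTypeR R))) (g s)%:E =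
   (r^-1)%:E * \int[nu]_s (g s)%:E)%E.
Proof.
move=> mg g0; pose H := kernel g.
have mH : measurable_fun setT H by exact: measurable_kernel.
have H0 p : (0 <= H p)%E by rewrite lee_fin; case: ifP.
transitivity (\int[nu]_t \int[leb]_s H (t, s))%E.
  by apply: eq_integral => t _; rewrite kernelE.
rewrite (fubini_tonelli H)//.
rewrite ge0_integral_exponential; last 2 first.
- exact/measurable_EFinP.
- by move=> x; rewrite lee_fin.
rewrite -ge0_integralZl//; last 3 first.
- apply: emeasurable_funM; exact/measurable_EFinP.
- by move=> t _; rewrite mule_ge0// lee_fin.
- by rewrite lee_fin invr_ge0 ltW.
apply: eq_integral => s _.
rewrite ge0_integral_exponential//; last exact: measurableT_comp mH (measurable_pair2 _).
have [s0|s0] := leP 0 s; last first.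
  rewrite /pdf lt0_exponential_pdf// !mule0; apply: integral0_eq => t _.
  by rewrite /H /kernel /= leNgt s0 /= mul0e.
pose tail : measurableTypeR R -> \bar R := (EFin \o pdf) \_ `[s, +oo[.
have mtail : measurable_fun setT tail.
  apply/(measurable_restrictT _ _).1; first exact: measurable_itv.
  by apply: measurable_funTS; exact/measurable_EFinP.
have tail0 t : (0 <= tail t)%E.
  by rewrite /tail patchE; case: ifP => // _; rewrite lee_fin.
transitivity (\int[leb]_t ((g s)%:E * tail t))%E.
  apply: eq_integral => t _; rewrite /H /kernel /tail /= s0 /= patchE mem_setE in_itv /= andbT.
  by case: ifP => _; rewrite ?mul0e ?mule0.
rewrite ge0_integralZl ?lee_fin//.
rewrite -integral_mkcond exponential_law_tail// -!EFinM; congr _%:E.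
by rewrite /pdf exponential_pdfE//; field; rewrite gt_eqF.
Qed.

Lemma Rintegral_exponential_cumulative (g : R -> R) (C : R) : measurable_fun setT g ->
  (forall s, `|g s| <= C) ->
  \int[nu]_t (Rintegral leb (`[0, t]%classic : set (measurableTypeR R)) g) =
  r^-1 * \int[nu]_t g t.
Proof.
move=> mg gC; have C0 : 0 <= C by exact: le_trans (gC 0).
have Ifin (t : R) : (leb (`[0%R, t]%classic : set (measurableTypeR R)) < +oo)%E.
  have h := lebesgue_measure_itv `[0, t]; rewrite [X in (X < _)%E]h /=.
  by case: ifP => _; rewrite ?ltry// -EFinB ltry.
have mI (t : R) : measurable (`[0%R, t]%classic : set (measurableTypeR R)).
  exact: measurable_itv.
pose cum (h : R -> R) (t : measurableTypeR R) := Rintegral leb (`[0, t]%classic : set (measurableTypeR R)) h.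
have ig (h : R -> R) K t : measurable_fun setT h -> (forall s, `|h s| <= K) ->
    leb.-integrable (`[0, t]%classic : set (measurableTypeR R)) (EFin \o h).
  by move=> mh hK; exact: (bounded_integrable (mI t) (Ifin t) (measurable_funTS mh) (fun s _ => hK s)).
have ge0_case (h : R -> R) K : measurable_fun setT h -> (forall s, `|h s| <= K) ->
    (forall s, 0 <= h s) ->
    nu.-integrable setT (EFin \o cum h) /\ \int[nu]_t cum h t = r^-1 * \int[nu]_t h t.
  move=> mh hK h0; have ih : nu.-integrable setT (EFin \o h).
    exact: (probability_integrable nu mh hK).
  have E : (\int[nu]_t (cum h t)%:E = (r^-1 * \int[nu]_t h t)%:E)%E.
    rewrite EFinM -EFin_Rintegral// -ge0_integral_exponential_cumulative//.
    by apply: eq_integral => t _; rewrite (EFin_Rintegral (mI t) (ig h K t mh hK)).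
  have cum0 t : 0 <= cum h t by apply: Rintegral_ge0.
  split; last by rewrite /Rintegral E.
  apply/integrableP; split; last first.
    under eq_integral do rewrite /= ger0_norm//.
    by rewrite E ltry.
  have -> : EFin \o cum h = fubini_F leb (kernel h).
    apply/funext => t; rewrite /fubini_F -kernelE.
    by rewrite (EFin_Rintegral (mI t) (ig h K t mh hK)).
  apply: measurable_fun_fubini_tonelli_F; first exact: measurable_kernel.
  by move=> p; rewrite lee_fin; case: ifP.
have gC0 x : 0 <= g x + C.
  by rewrite -lerBlDr sub0r; have := gC x; rewrite ler_norml => /andP[].
have CC (s : R) : `|C| <= C by rewrite ger0_norm.
have gCK x : `|g x + C| <= C + C by rewrite (le_trans (ler_normD _ _))// lerD// ger0_norm.
have [i1 e1] := ge0_case (fun=> C) C (measurable_cst _) CC (fun=> C0).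
have [i2 e2] := ge0_case (fun x => g x + C) _ (measurable_funD mg (measurable_cst _)) gCK gC0.
have gE t : cum g t = cum (fun x => g x + C) t - cum (fun=> C) t.
  rewrite /cum RintegralD ?addrK//; last 2 first.
  - exact: (ig _ C).
  - exact: (ig (fun=> C) C).
rewrite (@eq_Rintegral _ _ _ nu setT (fun t => cum (fun x => g x + C) t - cum (fun=> C) t)); last first.
  by move=> t _; rewrite -gE.
rewrite (RintegralB measurableT i2 i1) e1 e2 -mulrBr; congr (_ * _).
rewrite (RintegralD measurableT) ?addrK//; last 2 first.
- exact: (probability_integrable nu mg gC).
- exact: (probability_integrable nu (measurable_cst _) CC).
Qed.

End Discounting.

(** * Dynkin's formula in resolvent form *)

Section Resolvent.
Context (R : realType) (dm : measure_display) (T : measurableType dm).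
Variables (P : probability T R) (W : R -> T -> R) (mu sigma u0 r : R).
Hypotheses (Pcomp : complete_prob_space P) (W_BM : standard_BM P W).
Hypotheses (sigma_gt0 : 0 < sigma) (r_gt0 : 0 < r).
Variable U : R -> T -> R.
Hypothesis U_adm : admissible P W u0 U.
Variable z : R.
Hypothesis z_ge0 : 0 <= z.

Notation nu := (exponential_law r_gt0).
Let c := sigma ^+ 2 / 2.
Let Dr := drawdown W mu sigma U z.

Let mDr : measurable_fun setT (fun p : R * T => Dr p.1 p.2).
Proof. exact: (measurable_drawdown mu sigma Pcomp W_BM U_adm z_ge0). Qed.

Definition generator_term (F1 F2 : R -> R) (t : R) (w : T) : R :=
  F1 (Dr t w) * (control U t w - mu) + c * F2 (Dr t w).

(** This is (r - L) F / r along the path, with L the controlled generator; its mean at an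
    independent exponential time is F(z). *)
Definition resolvent_term (F F1 F2 : R -> R) (t : R) (w : T) : R :=
  F (Dr t w) - r^-1 * generator_term F1 F2 t w.

Section Bounds.
Variables (F F1 F2 : R -> R) (K : R).
Hypotheses (mF : measurable_fun setT F) (mF1 : measurable_fun setT F1)
  (mF2 : measurable_fun setT F2).
Hypotheses (FK : forall x, `|F x| <= K) (F1K : forall x, `|F1 x| <= K)
  (F2K : forall x, `|F2 x| <= K).

Definition generator_bound := K * (u0 + `|mu|) + c * K.

Let c_ge0 : 0 <= c. Proof. by rewrite divr_ge0// sqr_ge0. Qed.

Lemma generator_term_le t w : `|generator_term F1 F2 t w| <= generator_bound.
Proof.
rewrite /generator_term (le_trans (ler_normD _ _))// lerD//.
  rewrite normrM ler_pM// (le_trans (ler_normB _ _))// lerD2r.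
  exact: control_norm_le U_adm _ _.
by rewrite normrM (ger0_norm c_ge0) ler_wpM2l.
Qed.

Lemma resolvent_term_le t w :
  `|resolvent_term F F1 F2 t w| <= K + r^-1 * generator_bound.
Proof.
rewrite /resolvent_term (le_trans (ler_normB _ _))// lerD//.
by rewrite normrM ger0_norm ?invr_ge0 ?(ltW r_gt0)// ler_wpM2l ?invr_ge0 ?(ltW r_gt0)// generator_term_le.
Qed.

Lemma measurable_generator_term :
  measurable_fun setT (fun p : R * T => generator_term F1 F2 p.1 p.2).
Proof.
apply: measurable_funD.
  apply: measurable_funM; first exact: (measurableT_comp mF1 mDr).
  by apply: measurable_funB => //; exact: (measurable_control U_adm).
by apply: measurable_funM => //; exact: (measurableT_comp mF2 mDr).
Qed.

Lemma measurable_resolvent_term :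
  measurable_fun setT (fun p : R * T => resolvent_term F F1 F2 p.1 p.2).
Proof.
apply: measurable_funB; first exact: (measurableT_comp mF mDr).
by apply: measurable_funM => //; exact: measurable_generator_term.
Qed.

End Bounds.

Lemma measurable_expectation (H : R -> T -> R) C :
  measurable_fun setT (fun p : R * T => H p.1 p.2) -> (forall t w, `|H t w| <= C) ->
  measurable_fun setT (fun t : R => \int[P]_w H t w).
Proof.
move=> mH HC.
exact: (@measurable_Rintegral_slice1 _ _ (measurableTypeR R) T R P setT setT
  H C measurableT measurableT (probability_fin P) mH HC).
Qed.

Lemma norm_expectation_le (H : R -> T -> R) C :
  measurable_fun setT (fun p : R * T => H p.1 p.2) -> (forall t w, `|H t w| <= C) ->
  forall t, `|\int[P]_w H t w| <= C.
Proof.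
move=> mH HC t; apply: (Rintegral_probability_bound P (C := C)) => //.
exact: (@measurable_slice1 _ _ R T R H mH t).
Qed.

Lemma discounted_convergence (H_ : nat -> R -> T -> R) (H : R -> T -> R) C :
  (forall n, measurable_fun setT (fun p : R * T => H_ n p.1 p.2)) ->
  measurable_fun setT (fun p : R * T => H p.1 p.2) ->
  (forall n t w, `|H_ n t w| <= C) -> (forall t w, `|H t w| <= C) ->
  (forall t w, H_ n t w @[n --> \oo] --> H t w) ->
  \int[nu]_t (\int[P]_w H_ n t w) @[n --> \oo] --> \int[nu]_t (\int[P]_w H t w).
Proof.
move=> mH_ mH H_C HC cH.
apply: (bounded_convergence (C := C) measurableT (probability_fin nu)).
- by move=> n; exact: (measurable_expectation (mH_ n) (H_C n)).
- exact: (measurable_expectation mH HC).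
- by move=> n t _; exact: (norm_expectation_le (mH_ n) (H_C n)).
- move=> t _; apply: (bounded_convergence (C := C) measurableT (probability_fin P)).
  + by move=> n; exact: (@measurable_slice1 _ _ R T R (H_ n) (mH_ n) t).
  + exact: (@measurable_slice1 _ _ R T R H mH t).
  + by move=> n w _; exact: H_C.
  + by move=> w _; exact: cH.
Qed.

(** Averaging Dynkin's formula over the exponential time turns the integral up to t of the generator
    into 1/r times its average, by [Rintegral_exponential_cumulative]. *)
Lemma resolvent_test (F F1 F2 : R -> R) (K : R) : smooth_test F F1 F2 K ->
  \int[nu]_t (\int[P]_w resolvent_term F F1 F2 t w) = F z.
Proof.
move=> FT.
have mF := continuous_measurable_fun (test_continuous FT).
have mF1 := continuous_measurable_fun (test_continuous1 FT).
have mF2 := continuous_measurable_fun (test_continuous2 FT).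
have [[FK F1K] F2K] := (test_bound FT, test_bound1 FT, test_bound2 FT).
pose g t := \int[P]_w generator_term F1 F2 t w.
have mG := measurable_generator_term mF1 mF2.
have GK := generator_term_le F1K F2K.
have mg : measurable_fun setT g by exact: (measurable_expectation mG GK).
have gK := norm_expectation_le mG GK.
have mFD : measurable_fun setT (fun p : R * T => F (Dr p.1 p.2)).
  exact: (measurableT_comp mF mDr).
have FDK t w : `|F (Dr t w)| <= K by [].
pose phi t := \int[P]_w F (Dr t w).
have mphi : measurable_fun setT phi by exact: (measurable_expectation (H := fun t w => F (Dr t w)) mFD FDK).
have phiK := norm_expectation_le (H := fun t w => F (Dr t w)) mFD FDK.
pose cum (t : R) := Rintegral (@lebesgue_measure R) (`[0, t]%classic : set (measurableTypeR R)) g.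
have phiE t : phi t - F z = cum t.
  have dyn s : 0 <= s -> phi s - F z = cum s.
    move=> s0; have := expectation_drawdown mu Pcomp W_BM sigma_gt0 U_adm z_ge0 FT s0.
    by rewrite -/Dr -/(phi s) => ->; rewrite addrC addKr.
  (* At negative times the drawdown is frozen at its initial value and the interval of integration
     is empty, so the identity persists. *)
  have [t0|t0] := leP 0 t; first exact: dyn.
  have -> : phi t = phi 0.
    apply: eq_Rintegral => w _; congr F.
    by rewrite /Dr /drawdown maxxx max_l// ltW.
  rewrite dyn// /cum set_itv1 Rintegral_set1 set_itv_ge ?Rintegral_set0// bnd_simp.
  by rewrite -ltNge.
have iphi : nu.-integrable setT (EFin \o phi) by exact: (probability_integrable nu mphi phiK).
have ig : nu.-integrable setT (EFin \o g) by exact: (probability_integrable nu mg gK).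
have icst : nu.-integrable setT (EFin \o (fun=> F z)).
  exact: finite_measure_integrable_cst.
have E1 := Rintegral_exponential_cumulative r_gt0 mg gK.
have E2 : \int[nu]_t cum t = \int[nu]_t phi t - F z.
  rewrite -(Rintegral_probability_cst nu (F z)) -(RintegralB measurableT iphi icst).
  by apply: eq_Rintegral => t _; rewrite phiE.
have E3 t : \int[P]_w resolvent_term F F1 F2 t w = phi t - r^-1 * g t.
  have i1 : P.-integrable setT (EFin \o (fun w => F (Dr t w))).
    apply: (probability_integrable P (C := K)) => //.
    exact: (@measurable_slice1 _ _ R T R (fun t w => F (Dr t w)) mFD t).
  have i2 : P.-integrable setT (EFin \o generator_term F1 F2 t).
    apply: (probability_integrable P (C := generator_bound K)) => //.
    exact: (@measurable_slice1 _ _ R T R _ mG t).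
  rewrite -(RintegralZl r^-1 measurableT i2).
  exact: (RintegralB measurableT i1 (integrableZl measurableT r^-1 i2)).
rewrite (@eq_Rintegral _ _ _ nu setT (fun t => phi t - r^-1 * g t)); last first.
  by move=> t _; rewrite E3.
rewrite (RintegralB measurableT iphi (integrableZl measurableT r^-1 ig)).
rewrite (RintegralZl r^-1 measurableT ig) -E1; have -> := E2.
by rewrite opprB addrC subrK.
Qed.

(** The constants [K_ n], which govern the Taylor remainders, may be unbounded: the mesh has already
    been sent to 0 in the identity for each n. Only the bounds on F and its two derivatives must be
    uniform. *)
Lemma resolvent_limit (F_ F1_ F2_ : nat -> R -> R) (K_ : nat -> R)
    (F F1 F2 : R -> R) (K : R) :
  (forall n, smooth_test (F_ n) (F1_ n) (F2_ n) (K_ n)) ->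
  (forall n x, `|F_ n x| <= K) -> (forall n x, `|F1_ n x| <= K) ->
  (forall n x, `|F2_ n x| <= K) ->
  (forall x, `|F x| <= K) -> (forall x, `|F1 x| <= K) -> (forall x, `|F2 x| <= K) ->
  (forall x, F_ n x @[n --> \oo] --> F x) ->
  (forall x, F1_ n x @[n --> \oo] --> F1 x) ->
  (forall x, F2_ n x @[n --> \oo] --> F2 x) ->
  \int[nu]_t (\int[P]_w resolvent_term F F1 F2 t w) = F z.
Proof.
move=> FT FnK F1nK F2nK FK F1K F2K cF cF1 cF2.
have mFn n := continuous_measurable_fun (test_continuous (FT n)).
have mF1n n := continuous_measurable_fun (test_continuous1 (FT n)).
have mF2n n := continuous_measurable_fun (test_continuous2 (FT n)).
have mF : measurable_fun setT F by apply: (measurable_fun_cvg mFn) => x _; exact: cF.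
have mF1 : measurable_fun setT F1 by apply: (measurable_fun_cvg mF1n) => x _; exact: cF1.
have mF2 : measurable_fun setT F2 by apply: (measurable_fun_cvg mF2n) => x _; exact: cF2.
have := discounted_convergence (H_ := fun n => resolvent_term (F_ n) (F1_ n) (F2_ n))
  (H := resolvent_term F F1 F2) (C := K + r^-1 * generator_bound K).
have mr n := measurable_resolvent_term (mFn n) (mF1n n) (mF2n n).
move=> /(_ mr (measurable_resolvent_term mF mF1 mF2)).
move=> /(_ (fun n => resolvent_term_le (FnK n) (F1nK n) (F2nK n)) (resolvent_term_le FK F1K F2K)).
have pc t w : resolvent_term (F_ n) (F1_ n) (F2_ n) t w @[n --> \oo] -->
    resolvent_term F F1 F2 t w.
  apply: cvgB; first exact: cF.
  apply: cvgMr; apply: cvgD; first by apply: cvgMl; exact: cF1.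
  by apply: cvgMr; exact: cF2.
move=> /(_ pc) h.
have E : (fun n => \int[nu]_t (\int[P]_w resolvent_term (F_ n) (F1_ n) (F2_ n) t w)) = F_ ^~ z.
  by apply/funext => n; rewrite (resolvent_test (FT n)).
by move: h; rewrite E => h; exact: (cvg_unique _ h (cF z)).
Qed.

End Resolvent.

(** * From smooth test functions to C^1 functions *)

Definition has_derivative (R : realType) (f f' : R -> R) : Prop :=
  forall x : R, is_derive x (1 : R) f (f' x).

Section RealCalculus.
Variable R : realType.
Implicit Types (f g : R -> R) (a b x y B : R).

Lemma mean_value_bound f f' a b B : has_derivative f f' ->
  (forall x, Num.min a b <= x <= Num.max a b -> `|f' x| <= B) ->
  `|f b - f a| <= B * `|b - a|.
Proof.
move=> df; wlog ab : a b / a < b => [H fB|].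
  have [ab|ba|->] := ltgtP a b; first exact: H.
  - by rewrite distrC (distrC b); apply: H => // x; rewrite minC maxC; exact: fB.
  - by rewrite !subrr normr0 mulr0.
rewrite min_l ?max_r ?(ltW ab)// => fB.
have cf : {within `[a, b], continuous f}.
  apply: continuous_subspaceT => x; apply: differentiable_continuous.
  by apply/derivable1_diffP; exact: ex_derive.
have [c] := MVT ab (fun x _ => df x) cf.
rewrite in_itv/= => /andP[ac cb] ->; rewrite normrM ler_wpM2r//.
by apply: fB; rewrite !ltW.
Qed.

Lemma is_derive_continuous f f' : has_derivative f f' -> continuous f.
Proof.
move=> df x; apply: differentiable_continuous.
by apply/derivable1_diffP; exact: ex_derive.
Qed.

Lemma lipschitz_continuous f B : (forall x y, `|f x - f y| <= B * `|x - y|) -> continuous f.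
Proof.
move=> fB x; have B0 : 0 <= B.
  by have := le_trans (normr_ge0 _) (fB 1 0); rewrite subr0 normr1 mulr1.
apply/cvgrPdist_le => e e0; near=> y.
apply: (le_trans (fB _ _)).
have h : `|x - y| <= e / (B + 1).
  near: y; exists (e / (B + 1)) => /=; last by move=> u /= /ltW.
  by rewrite divr_gt0// ltr_wpDl.
apply: (le_trans (ler_wpM2l B0 h)).
by rewrite mulrCA ler_piMr ?(ltW e0)// ler_pdivrMr ?mul1r ?lerDl// ltr_wpDl.
Unshelve. all: by end_near. Qed.

(** The mean value inequality is applied twice in the displacement: the Lipschitz bound gives L u^2
    for [psi], and then L |y|^3 for [phi]. The factorials of the sharp remainder are given away. *)
Lemma taylor2_bound (F F1 F2 : R -> R) (L : R) :
  has_derivative F F1 -> has_derivative F1 F2 ->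
  (forall x y, `|F2 x - F2 y| <= L * `|x - y|) ->
  forall x y, `|F (x - y) - F x + F1 x * y - F2 x / 2 * y ^+ 2| <= L * `|y| ^+ 3.
Proof.
move=> dF dF1 F2L x y.
have L0 : 0 <= L.
  by have := le_trans (normr_ge0 _) (F2L 1 0); rewrite subr0 normr1 mulr1.
pose phi u := F (x - u) - F x + F1 x * u - F2 x / 2 * u ^+ 2.
pose psi u := F1 x - F1 (x - u) - F2 x * u.
have dsub (u : R) : is_derive u (1 : R) (fun u : R => x - u) (-1).
  by apply: is_derive_eq; ring.
have dphi (u : R) : is_derive u (1 : R) phi (psi u).
  have := @is_derive1_comp _ F (fun u => x - u) u _ _ (dF (x - u)) (dsub u).
  move=> h; apply: is_derive_eq.
  by rewrite /psi /GRing.scale /=; field.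
have dpsi (u : R) : is_derive u (1 : R) psi (F2 (x - u) - F2 x).
  have := @is_derive1_comp _ F1 (fun u => x - u) u _ _ (dF1 (x - u)) (dsub u).
  move=> h; apply: is_derive_eq.
  by rewrite /GRing.scale /=; ring.
have between a u : Num.min 0 a <= u <= Num.max 0 a -> `|u| <= `|a|.
  have [a0|a0] := leP 0 a; move=> /andP[h1 h2].
    by rewrite !ger0_norm.
  by rewrite !ler0_norm ?lerN2// ltW.
have psi_le u : `|psi u| <= L * `|u| ^+ 2.
  have psi0 : psi 0 = 0 by rewrite /psi subr0 subrr mulr0 subr0.
  have := @mean_value_bound psi _ 0 u (L * `|u|) dpsi.
  rewrite psi0 !subr0 expr2 mulrA; apply => v /between vu.
  by rewrite (le_trans (F2L _ _))// ler_wpM2l// addrAC subrr add0r normrN.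
have phi0 : phi 0 = 0.
  by rewrite /phi subr0 subrr mulr0 expr0n /= mulr0 addr0 subr0.
have := @mean_value_bound phi _ 0 y (L * `|y| ^+ 2) dphi.
rewrite phi0 !subr0 -mulrA -exprSr; apply => v /between vy.
by rewrite (le_trans (psi_le _))// ler_wpM2l// lerXn2r// nnegrE.
Qed.

End RealCalculus.

Section BackwardAverage.
Variable R : realType.
Variables (G V V1 V2 : R -> R) (K : R).
Hypotheses (dG : has_derivative G V) (dV : has_derivative V V1).
Hypotheses (VK : forall x, `|V x| <= K) (V1K : forall x, `|V1 x| <= K).
Hypothesis V1_lip : forall x y, `|V1 x - V1 y| <= K * `|x - y|.
Hypotheses (V_neg : forall x, x <= 0 -> V x = V 0).

(* The quotient is taken backwards so that it is constant below 0 when f is. *)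
Definition backward_quotient (f : R -> R) (n : nat) (x : R) : R :=
  (f x - f (x - n.+1%:R^-1)) * n.+1%:R.

Hypothesis V2_lim : forall x, backward_quotient V1 n x @[n --> \oo] --> V2 x.

Let K_ge0 : 0 <= K. Proof. exact: le_trans (VK 0). Qed.

Let bq_derive f f' n : has_derivative f f' ->
  has_derivative (backward_quotient f n) (backward_quotient f' n).
Proof.
move=> df x; set e : R := n.+1%:R^-1.
have dsub : is_derive x (1 : R) (fun u : R => u - e) 1.
  by apply: is_derive_eq; rewrite subr0.
have h := @is_derive1_comp _ f (fun u => u - e) x _ _ (df (x - e)) dsub.
rewrite (_ : backward_quotient f n = n.+1%:R \*: (f - (f \o (fun u : R => u - e)))); last first.
  by apply/funext => y; rewrite /backward_quotient mulrC.
apply: (is_derive_eq (is_deriveZ n.+1%:R (is_deriveB (df x) h))).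
by rewrite /backward_quotient /GRing.scale /= mulr1 mulrC.
Qed.

Let bq_bound f B n x : (forall x y, `|f x - f y| <= B * `|x - y|) ->
  `|backward_quotient f n x| <= B.
Proof.
move=> fB; rewrite /backward_quotient normrM (gtr0_norm (ltr0Sn R n)) -ler_pdivlMr//.
by rewrite (le_trans (fB _ _))// opprB addrC subrK gtr0_norm ?invr_gt0.
Qed.

Let lip f f' : has_derivative f f' -> (forall x, `|f' x| <= K) ->
  forall x y, `|f x - f y| <= K * `|x - y|.
Proof. by move=> df f'K x y; apply: (mean_value_bound df) => u _. Qed.

(** The quotient of the antiderivative G is the average of V over a short interval to the left, so
    it has one derivative more than V; its second derivative, the quotient of V', is Lipschitz with
    a constant of order n. Left of 0 its derivative, the quotient of V, vanishes, which gives
    [test_neg]. *)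
Lemma backward_quotient_test n : exists K_,
  smooth_test (backward_quotient G n) (backward_quotient V n) (backward_quotient V1 n) K_.
Proof.
set e : R := n.+1%:R^-1; have n0 : 0 < n.+1%:R :> R by rewrite ltr0Sn.
pose L := (K + K) * n.+1%:R.
have L0 : 0 <= L by rewrite mulr_ge0 ?addr_ge0.
have bqV1_lip x y : `|backward_quotient V1 n x - backward_quotient V1 n y| <= L * `|x - y|.
  rewrite /backward_quotient -mulrBl normrM (gtr0_norm n0) /L mulrAC ler_wpM2r ?(ltW n0)//.
  have -> : V1 x - V1 (x - e) - (V1 y - V1 (y - e)) =
    (V1 x - V1 y) - (V1 (x - e) - V1 (y - e)) by ring.
  rewrite (le_trans (ler_normB _ _))// mulrDl lerD// (le_trans (V1_lip _ _))//.
  by rewrite (_ : x - e - (y - e) = x - y)//; ring.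
have le_KL B x : x <= K * B -> 0 <= B -> x <= (K + L) * B.
  by move=> xK B0; rewrite (le_trans xK)// ler_wpM2r// lerDl.
exists (K + L); split.
- exact: (is_derive_continuous (bq_derive n dG)).
- exact: (is_derive_continuous (bq_derive n dV)).
- exact: (lipschitz_continuous bqV1_lip).
- by move=> x; rewrite (le_trans (bq_bound n x (lip dG VK)))// lerDl.
- by move=> x; rewrite (le_trans (bq_bound n x (lip dV V1K)))// lerDl.
- by move=> x; rewrite (le_trans (bq_bound n x V1_lip))// lerDl.
- move=> x y; have := taylor2_bound (bq_derive n dG) (bq_derive n dV) bqV1_lip x y.
  by move=> h; rewrite (le_trans h)// ler_wpM2r ?exprn_ge0// lerDr.
- move=> x x0; apply/eqP; rewrite -subr_eq0 -normr_le0.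
  have := @mean_value_bound _ _ _ 0 x 0 (bq_derive n dG).
  rewrite mul0r; apply => u; rewrite min_r// max_l// => /andP[_ u0'].
  rewrite /backward_quotient (V_neg u0') (V_neg (_ : u - n.+1%:R^-1 <= 0)) ?subrr ?mul0r ?normr0//.
  by rewrite subr_le0 (le_trans u0')// invr_ge0.
Qed.

Lemma backward_quotient_cvg f f' x : has_derivative f f' ->
  backward_quotient f n x @[n --> \oo] --> f' x.
Proof.
move=> df; have [dfx dfv] := df x.
have hc : h^-1 *: (f (h *: 1 + x) - f x) @[h --> 0^'] --> f' x.
  by rewrite -dfv; exact: dfx.
have sc : - n.+1%:R^-1 @[n --> \oo] --> (0 : R)^'.
  move=> B /= [e e0 eB].
  have : - n.+1%:R^-1 @[n --> \oo] --> (0 : R).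
    by rewrite -oppr0; apply: cvgN; exact: cvg_harmonic.
  move=> /(_ (ball 0 e)) /= h; have {}h := h (nbhsx_ballx _ _ e0).
  have {}h : \forall n \near \oo, ball (0 : R) e (- n.+1%:R^-1) by exact: h.
  change (\forall n \near \oo, B (- n.+1%:R^-1 : R)).
  move: h; apply: filterS => n hn; apply: (eB _ hn).
  by rewrite /= oppr_eq0 invr_eq0 pnatr_eq0.
have := cvg_comp _ _ sc hc; apply: cvg_trans; apply: near_eq_cvg; apply: nearW => n /=.
rewrite /backward_quotient /GRing.scale /= mulr1 invrN invrK (addrC _ x).
by rewrite mulNr mulrC -mulNr opprB.
Qed.

Section ResolventC11.
Context (dm : measure_display) (T : measurableType dm).
Variables (P : probability T R) (W : R -> T -> R) (mu sigma u0 r : R).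
Hypotheses (Pcomp : complete_prob_space P) (W_BM : standard_BM P W).
Hypotheses (sigma_gt0 : 0 < sigma) (r_gt0 : 0 < r).
Variable U : R -> T -> R.
Hypothesis U_adm : admissible P W u0 U.
Variable z : R.
Hypothesis z_ge0 : 0 <= z.
Hypothesis V2K : forall x, `|V2 x| <= K.

(** V'' enters only as the pointwise limit of backward quotients of V', so it may jump; the
    Lipschitz constant of V' bounds those quotients uniformly in n. *)
Lemma resolvent_C11 : \int[exponential_law r_gt0]_t
  (\int[P]_w resolvent_term W mu sigma r U z V V1 V2 t w) = V z.
Proof.
pose K_ n := projT1 (cid (backward_quotient_test n)).
apply: (@resolvent_limit _ _ _ P W mu sigma u0 r Pcomp W_BM sigma_gt0 r_gt0 U U_adm z z_ge0
  (backward_quotient G) (backward_quotient V) (backward_quotient V1) K_ V V1 V2 K) => //.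
- by move=> n; rewrite /K_; case: cid.
- by move=> n x; exact: (bq_bound n x (lip dG VK)).
- by move=> n x; exact: (bq_bound n x (lip dV V1K)).
- by move=> n x; exact: (bq_bound n x V1_lip).
- by move=> x; exact: backward_quotient_cvg.
- by move=> x; exact: backward_quotient_cvg.
Qed.

End ResolventC11.

End BackwardAverage.

(** * The candidate value function *)

Section Glue.
Variable R : realType.
Implicit Types (f g : R -> R) (c x y : R).

Lemma is_derive_cvg f x l :
  h^-1 *: (f (h *: 1 + x) - f x) @[h --> (0 : R)^'] --> (l : R) -> is_derive x (1 : R) f l.
Proof.
move=> fl; split; last exact/cvg_lim.
by apply/cvg_ex; exists l.
Qed.

Lemma is_derive_difference f x l : is_derive x (1 : R) f l ->
  h^-1 *: (f (h *: 1 + x) - f x) @[h --> (0 : R)^'] --> (l : R).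
Proof. by move=> [df <-]; exact: df. Qed.

Definition glue c f g x := if x <= c then f x else g x.

Lemma has_derivative_glue c f f' g g' : has_derivative f f' -> has_derivative g g' ->
  f c = g c -> f' c = g' c -> has_derivative (glue c f g) (glue c f' g').
Proof.
move=> df dg fgc fgc' x; apply: is_derive_cvg; rewrite /glue.
have near_side (e : R) (Q : R -> Prop) : 0 < e -> (forall h, `|h| < e -> Q h) ->
    \forall h \near (0 : R)^', Q h.
  by move=> e0 hQ; exists e => // h /=; rewrite sub0r normrN => he _; exact: hQ.
have [xc|xc|->] := ltgtP x c.
- apply: cvg_trans (is_derive_difference (df x)); apply: near_eq_cvg.
  apply: (near_side (c - x)); first by rewrite subr_gt0.
  by move=> h /ltr_normlW hc; rewrite ifT// /GRing.scale /= mulr1; lra.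
- apply: cvg_trans (is_derive_difference (dg x)); apply: near_eq_cvg.
  apply: (near_side (x - c)); first by rewrite subr_gt0.
  move=> h; rewrite ltr_norml => /andP[hc _].
  by rewrite /GRing.scale /= mulr1 leNgt (_ : c < h + x)//; lra.
- have cf := is_derive_difference (df c).
  have := is_derive_difference (dg c); rewrite -fgc' => cg.
  move=> B Bl.
  have fB : \forall h \near (0 : R)^', B (h^-1 *: (f (h *: 1 + c) - f c)) by exact: cf B Bl.
  have gB : \forall h \near (0 : R)^', B (h^-1 *: (g (h *: 1 + c) - g c)) by exact: cg B Bl.
  change (\forall h \near (0 : R)^', B (h^-1 *:
    ((if h *: 1 + c <= c then f (h *: 1 + c) else g (h *: 1 + c)) - f c))).
  apply: filterS2 fB gB => h fB gB; case: ifP => _; first by [].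
  by rewrite fgc.
Qed.

Lemma has_derivative_ext f f1 g g1 : has_derivative f g -> f =1 f1 -> g =1 g1 ->
  has_derivative f1 g1.
Proof. by move=> df /funext <- /funext <-. Qed.

Lemma has_derivative_affine (k l : R) : has_derivative (fun x => k * x + l) (fun=> k).
Proof. by move=> x; apply: is_derive_eq; rewrite /GRing.scale /=; ring. Qed.

Lemma has_derivative_exp (a c : R) :
  has_derivative (fun x => expR (a * (x - c))) (fun x => a * expR (a * (x - c))).
Proof.
move=> x.
have dl : has_derivative (fun x : R => a * (x - c)) (fun=> a).
  by apply: has_derivative_ext (has_derivative_affine a (- (a * c))) _ _ => y //=; ring.
have := @is_derive1_comp _ expR (fun x : R => a * (x - c)) x _ _ (is_derive_expR _) (dl x).
by rewrite mulrC.
Qed.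

Lemma has_derivativeD f f' g g' : has_derivative f f' -> has_derivative g g' ->
  has_derivative (fun x => f x + g x) (fun x => f' x + g' x).
Proof. by move=> df dg x; exact: is_deriveD. Qed.

Lemma has_derivativeZ (k : R) f f' : has_derivative f f' ->
  has_derivative (fun x => k * f x) (fun x => k * f' x).
Proof. by move=> df x; exact: (is_deriveZ k (df x)). Qed.

Lemma lipschitz_join f (D : set R) c B : D c ->
  (forall x y, D x -> D y -> x <= c -> y <= c -> `|f x - f y| <= B * `|x - y|) ->
  (forall x y, D x -> D y -> c <= x -> c <= y -> `|f x - f y| <= B * `|x - y|) ->
  forall x y, D x -> D y -> `|f x - f y| <= B * `|x - y|.
Proof.
move=> Dc fl fr; have H x y : D x -> D y -> x <= c -> c <= y -> `|f x - f y| <= B * `|x - y|.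
  move=> Dx Dy xc cy.
  rewrite (_ : f x - f y = (f x - f c) + (f c - f y)); last by ring.
  apply: (le_trans (ler_normD _ _)); apply: (le_trans (lerD (fl x c Dx Dc xc (lexx _))
    (fr c y Dc Dy (lexx _) cy))).
  rewrite -mulrDr ler0_norm ?subr_le0// (ler0_norm (_ : c - y <= 0)) ?subr_le0//.
  by rewrite ler0_norm ?subr_le0 ?(le_trans xc)// (_ : - (x - c) + - (c - y) = - (x - y)) //; ring.
move=> x y Dx Dy; have [xc|/ltW cx] := leP x c; have [yc|/ltW cy] := leP y c.
- exact: fl.
- exact: H.
- by rewrite distrC (distrC x); exact: H.
- exact: fr.
Qed.

(** Backward quotients see only points to the left of x. At a junction the formula of the left piece
    therefore decides the limit. *)
Lemma backward_quotient_local f g x e l : 0 < e ->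
  (forall y, x - e < y <= x -> f y = g y) ->
  backward_quotient g n x @[n --> \oo] --> (l : R) ->
  backward_quotient f n x @[n --> \oo] --> (l : R).
Proof.
move=> e0 fg; apply: cvg_trans; apply: near_eq_cvg; near=> n.
have n0 : 0 < n.+1%:R^-1 :> R by rewrite invr_gt0 ltr0Sn.
have ne : n.+1%:R^-1 < e by near: n; exact: (near_infty_natSinv_lt (PosNum e0)).
rewrite /backward_quotient; move: n.+1%:R^-1 n0 ne => k n0 ne.
by rewrite !fg//; apply/andP; split; lra.
Unshelve. all: by end_near. Qed.

End Glue.

Section CandidateValue.
Variables (R : realType) (a1 a2 u0 r beta d : R).
Hypotheses (a1_gt0 : 0 < a1) (a2_gt0 : 0 < a2) (r_gt0 : 0 < r) (d_gt0 : 0 < d).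

(** The value has the form of a particular solution plus exponentials on each piece, with no growing
    exponential beyond d. Zero slope at 0 fixes the ratio of the two coefficients on [0, d];
    matching value and slope at d fixes their scale [kap] and the coefficient [gam] beyond d. *)
Let kap : R := r^-1 / ((a1 + a2) * expR (a1 * d)).
Let gam : R := r^-1 * ((a1 * (expR (a1 * d) - expR (- a2 * d))) / ((a1 + a2) * expR (a1 * d))).
Let zet : R := zeta a1 a2 r d.
Let f : R -> R := fbar a1 a2 u0 r beta d.
Let g : R -> R := gbar a1 a2 u0 r beta d.
Let f1 x := - kap * a1 * a2 * (expR (a1 * x) - expR (- a2 * x)).
Let f2 x := - kap * a1 * a2 * (a1 * expR (a1 * x) + a2 * expR (- a2 * x)).
Let g1 x := - a2 * gam * expR (- a2 * (x - d)).
Let g2 x := a2 ^+ 2 * gam * expR (- a2 * (x - d)).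
Let fint x := beta * u0 / r * x
  - kap * (a2 / a1 * expR (a1 * x) - a1 / a2 * expR (- a2 * x)).
Let gint0 x := (beta * u0 - 1) / r * x - gam / a2 * expR (- a2 * (x - d)).
(** The added constant makes the antiderivative continuous at d. *)
Let gint x := gint0 x + (fint d - gint0 d).

Definition piecewise (p q s : R -> R) : R -> R := glue 0 p (glue d q s).

Definition candidate : R -> R := piecewise (fun=> f 0) f g.
Definition candidate1 : R -> R := piecewise (fun=> 0) f1 g1.
(* At 0 and d this is the left second derivative, the limit of backward quotients. *)
Definition candidate2 : R -> R := piecewise (fun=> 0) f2 g2.
Definition candidate_int : R -> R := piecewise (fun x => f 0 * x + fint 0) fint gint.

Let a12_gt0 : 0 < a1 + a2. Proof. by rewrite addr_gt0. Qed.
Let e_neq0 : expR (a1 * d) != 0. Proof. by rewrite gt_eqF// expR_gt0. Qed.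
Let a12_neq0 : a1 + a2 != 0. Proof. by rewrite gt_eqF. Qed.
Let a1_neq0 : a1 != 0. Proof. by rewrite gt_eqF. Qed.
Let a2_neq0 : a2 != 0. Proof. by rewrite gt_eqF. Qed.
Let r_neq0 : r != 0. Proof. by rewrite gt_eqF. Qed.

Let kap_gt0 : 0 < kap.
Proof. by rewrite divr_gt0 ?invr_gt0// mulr_gt0// expR_gt0. Qed.

Let k0 : 0 <= kap * a1 * a2.
Proof.
by apply: mulr_ge0; rewrite ?(ltW a2_gt0)//; apply: mulr_ge0; rewrite ltW.
Qed.

Let exp_le : expR (- a2 * d) <= expR (a1 * d).
Proof.
rewrite ler_expR ler_wpM2r ?(ltW d_gt0)// (@le_trans _ _ 0) ?(ltW a1_gt0)//.
by rewrite oppr_le0 ltW.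
Qed.

Let gam_ge0 : 0 <= gam.
Proof.
apply: mulr_ge0; first by rewrite invr_ge0 ltW.
apply: divr_ge0; first by rewrite mulr_ge0 ?subr_ge0 ?(ltW a1_gt0).
by rewrite mulr_ge0 ?expR_ge0 ?(ltW a12_gt0).
Qed.

Let zetE : zet = a2 * gam.
Proof. by rewrite /zet /zeta /gam; field; rewrite e_neq0 a12_neq0. Qed.

Let fE x : f x = beta * u0 / r - kap * (a2 * expR (a1 * x) + a1 * expR (- a2 * x)).
Proof. by rewrite /f /fbar /kap; field; rewrite e_neq0 a12_neq0. Qed.

Let gE x : g x = (beta * u0 - 1) / r + gam * expR (- a2 * (x - d)).
Proof. by []. Qed.

Let exp_derivative a : has_derivative (fun x : R => expR (a * x)) (fun x => a * expR (a * x)).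
Proof.
by apply: has_derivative_ext (has_derivative_exp a 0) _ _ => x; rewrite subr0.
Qed.

Let df : has_derivative f f1.
Proof.
apply: has_derivative_ext (has_derivativeD (has_derivative_affine 0 (beta * u0 / r))
  (has_derivativeZ (- kap) (has_derivativeD (has_derivativeZ a2 (exp_derivative a1))
   (has_derivativeZ a1 (exp_derivative (- a2)))))) _ _ => x.
- by rewrite fE; ring.
- by rewrite /f1; ring.
Qed.

Let df1 : has_derivative f1 f2.
Proof.
apply: has_derivative_ext (has_derivativeZ (- kap * a1 * a2)
  (has_derivativeD (exp_derivative a1) (has_derivativeZ (-1) (exp_derivative (- a2))))) _ _ => x.
- by rewrite /f1; ring.
- by rewrite /f2; ring.
Qed.

Let dfint : has_derivative fint f.
Proof.
apply: has_derivative_ext (has_derivativeD (has_derivative_affine (beta * u0 / r) 0)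
  (has_derivativeZ (- kap) (has_derivativeD (has_derivativeZ (a2 / a1) (exp_derivative a1))
   (has_derivativeZ (- (a1 / a2)) (exp_derivative (- a2)))))) _ _ => x.
- by rewrite /fint; ring.
- by rewrite fE; field; rewrite ?a1_neq0 ?a2_neq0 ?r_neq0 ?e_neq0 ?a12_neq0.
Qed.

Let dg : has_derivative g g1.
Proof.
apply: has_derivative_ext (has_derivativeD (has_derivative_affine 0 ((beta * u0 - 1) / r))
  (has_derivativeZ gam (has_derivative_exp (- a2) d))) _ _ => x.
- by rewrite gE mul0r add0r.
- by rewrite /g1; ring.
Qed.

Let dg1 : has_derivative g1 g2.
Proof.
apply: has_derivative_ext (has_derivativeZ (- a2 * gam) (has_derivative_exp (- a2) d)) _ _ => x.
- by [].
- by rewrite /g2; ring.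
Qed.

Let dgint : has_derivative gint g.
Proof.
apply: has_derivative_ext (has_derivativeD
  (has_derivative_affine ((beta * u0 - 1) / r) (fint d - gint0 d))
  (has_derivativeZ (- (gam / a2)) (has_derivative_exp (- a2) d))) _ _ => x.
- by rewrite /gint {2}/gint0; ring.
- by rewrite gE (_ : - (gam / a2) * (- a2 * _) = gam * expR (- a2 * (x - d)))//; field.
Qed.

Let fg_d : f d = g d.
Proof.
rewrite fE gE subrr mulr0 expR0 mulr1 /kap /gam.
by field; rewrite a12_neq0 e_neq0 r_neq0.
Qed.

Let fg1_d : f1 d = g1 d.
Proof.
rewrite /f1 /g1 subrr mulr0 expR0 mulr1 /kap /gam.
by field; rewrite a12_neq0 e_neq0 r_neq0.
Qed.

Let f1_0 : f1 0 = 0.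
Proof. by rewrite /f1 !mulr0 subrr mulr0. Qed.

Let glue_0 (p q : R -> R) : glue d p q 0 = p 0.
Proof. by rewrite /glue ltW. Qed.

Lemma has_derivative_candidate_int : has_derivative candidate_int candidate.
Proof.
apply: has_derivative_glue; rewrite ?glue_0//; last by rewrite mulr0 add0r.
  exact: has_derivative_affine.
by apply: has_derivative_glue => //; rewrite /gint addrC subrK.
Qed.

Lemma has_derivative_candidate : has_derivative candidate candidate1.
Proof.
apply: has_derivative_glue; rewrite ?glue_0//.
  by apply: has_derivative_ext (has_derivative_affine 0 (f 0)) _ _ => x; ring.
exact: has_derivative_glue.
Qed.

Lemma candidate_neg x : x <= 0 -> candidate x = candidate 0.
Proof. by move=> x0; rewrite /candidate /piecewise /glue x0 lexx. Qed.

Lemma candidateE x : 0 <= x -> candidate x = if x <= d then f x else g x.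
Proof.
rewrite /candidate /piecewise /glue le_eqVlt => /predU1P[<-|x0].
  by rewrite lexx (ltW d_gt0).
by rewrite leNgt x0.
Qed.

Let expa1_le x : x <= d -> 0 <= expR (a1 * x) <= expR (a1 * d).
Proof. by move=> xd; rewrite expR_ge0 ler_expR ler_wpM2l ?(ltW a1_gt0). Qed.

Let expa2_le x : 0 <= x -> 0 <= expR (- a2 * x) <= 1.
Proof.
move=> x0; rewrite expR_ge0 -expR0 ler_expR mulNr oppr_le0.
by rewrite mulr_ge0 ?(ltW a2_gt0).
Qed.

Lemma piecewise_bounded p q s K0 K1 K2 : (forall x, x <= 0 -> `|p x| <= K0) ->
  (forall x, 0 <= x <= d -> `|q x| <= K1) -> (forall x, d <= x -> `|s x| <= K2) ->
  forall x, `|piecewise p q s x| <= K0 + K1 + K2.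
Proof.
move=> pK qK sK x.
have K0_ge0 := le_trans (normr_ge0 _) (pK 0 (lexx _)).
have K1_ge0 : 0 <= K1 by apply: le_trans (normr_ge0 _) (qK 0 _); rewrite lexx ltW.
have K2_ge0 := le_trans (normr_ge0 _) (sK d (lexx _)).
rewrite /piecewise /glue; have [x0|x0] := leP x 0.
  by have := pK x x0; lra.
have [xd|xd] := leP x d; last by have := sK x (ltW xd); lra.
by have := qK x; rewrite xd ltW// => /(_ isT); lra.
Qed.

Lemma candidate_bounded : exists K, [/\ forall x, `|candidate x| <= K,
  forall x, `|candidate1 x| <= K & forall x, `|candidate2 x| <= K].
Proof.
have bound (h : R -> R) A B C : (forall x, h x = A + B * expR (a1 * x) + C * expR (- a2 * x)) ->
    forall x, 0 <= x <= d -> `|h x| <= `|A| + `|B| * expR (a1 * d) + `|C|.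
  move=> hE x /andP[/expa2_le/andP[x2 x2'] /expa1_le/andP[x1 x1']]; rewrite hE.
  apply: (le_trans (ler_normD _ _)); apply: lerD.
    apply: (le_trans (ler_normD _ _)); apply: lerD => //.
    by rewrite normrM (ger0_norm x1) ler_wpM2l.
  by rewrite normrM (ger0_norm x2) ler_piMr.
have boundg (h : R -> R) A B : (forall x, h x = A + B * expR (- a2 * (x - d))) ->
    forall x, d <= x -> `|h x| <= `|A| + `|B|.
  move=> hE x; rewrite -subr_ge0 => /expa2_le/andP[x2 x2']; rewrite hE.
  apply: (le_trans (ler_normD _ _)); apply: lerD => //.
  by rewrite normrM (ger0_norm x2) ler_piMr.
have [A K0] : exists K, forall x, `|candidate x| <= K.
  eexists; apply: piecewise_bounded; first by move=> x _; exact: lexx.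
    apply: (bound f (beta * u0 / r) (- kap * a2) (- kap * a1)) => x.
    by rewrite fE; ring.
  exact: (boundg g ((beta * u0 - 1) / r) gam).
have [B K1] : exists K, forall x, `|candidate1 x| <= K.
  eexists; apply: piecewise_bounded; first by move=> x _; exact: lexx.
    apply: (bound f1 0 (- kap * a1 * a2) (kap * a1 * a2)) => x.
    by rewrite /f1; ring.
  by apply: (boundg g1 0 (- a2 * gam)) => x; rewrite add0r.
have [C K2] : exists K, forall x, `|candidate2 x| <= K.
  eexists; apply: piecewise_bounded; first by move=> x _; exact: lexx.
    apply: (bound f2 0 (- kap * a1 * a2 * a1) (- kap * a1 * a2 * a2)) => x.
    by rewrite /f2; ring.
  by apply: (boundg g2 0 (a2 ^+ 2 * gam)) => x; rewrite add0r.
have A0 := le_trans (normr_ge0 _) (K0 0).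
have B0 := le_trans (normr_ge0 _) (K1 0).
have C0 := le_trans (normr_ge0 _) (K2 0).
exists (A + B + C); split=> x.
- by apply: (le_trans (K0 x)); lra.
- by apply: (le_trans (K1 x)); lra.
- by apply: (le_trans (K2 x)); lra.
Qed.

Let candidate1_0 x : x <= 0 -> candidate1 x = 0.
Proof. by move=> x0; rewrite /candidate1 /piecewise /glue x0. Qed.

Let candidate1_f x : 0 <= x <= d -> candidate1 x = f1 x.
Proof.
rewrite /candidate1 /piecewise /glue => /andP[]; rewrite le_eqVlt => /predU1P[<-|x0 ->].
  by rewrite lexx f1_0.
by rewrite leNgt x0.
Qed.

Let candidate1_g x : d <= x -> candidate1 x = g1 x.
Proof.
rewrite /candidate1 /piecewise /glue => dx; rewrite leNgt (lt_le_trans d_gt0 dx)/=.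
by case: ifP => // xd; rewrite -(@le_anti _ _ d x) ?dx.
Qed.

Let candidate2_0 x : x <= 0 -> candidate2 x = 0.
Proof. by move=> x0; rewrite /candidate2 /piecewise /glue x0. Qed.

Let candidate2_f x : 0 < x <= d -> candidate2 x = f2 x.
Proof.
by rewrite /candidate2 /piecewise /glue => /andP[x0 ->]; rewrite leNgt x0.
Qed.

Let candidate2_g x : d < x -> candidate2 x = g2 x.
Proof.
rewrite /candidate2 /piecewise /glue => dx; rewrite leNgt (lt_trans d_gt0 dx)/=.
by rewrite leNgt dx.
Qed.

Lemma candidate1_lipschitz : exists L, forall x y,
  `|candidate1 x - candidate1 y| <= L * `|x - y|.
Proof.
pose Lf := kap * a1 * a2 * (a1 * expR (a1 * d) + a2).
pose Lg := a2 ^+ 2 * gam.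
have Lf0 : 0 <= Lf.
  apply: mulr_ge0 => //; rewrite addr_ge0 ?(ltW a2_gt0)//.
  by rewrite mulr_ge0 ?expR_ge0 ?(ltW a1_gt0).
have Lg0 : 0 <= Lg by rewrite mulr_ge0 ?exprn_ge0 ?(ltW a2_gt0).
have f2L x : 0 <= x <= d -> `|f2 x| <= Lf.
  move=> /andP[/expa2_le/andP[x2 x2'] /expa1_le/andP[x1 x1']].
  have -> : f2 x = - (kap * a1 * a2 * (a1 * expR (a1 * x) + a2 * expR (- a2 * x))).
    by rewrite /f2; ring.
  rewrite normrN ger0_norm; last first.
    apply: mulr_ge0 => //.
    by rewrite addr_ge0 // mulr_ge0 ?(ltW a1_gt0) ?(ltW a2_gt0).
  apply: ler_wpM2l => //; apply: lerD; first by rewrite ler_wpM2l ?(ltW a1_gt0).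
  by apply: ler_piMr => //; exact: ltW.
have g2L x : d <= x -> `|g2 x| <= Lg.
  rewrite -subr_ge0 => /expa2_le/andP[x2 x2'].
  by rewrite /g2 normrM (ger0_norm x2) (ger0_norm Lg0) ler_piMr.
have le_norm (A B C x y : R) : A <= B * `|x - y| -> B <= C -> A <= C * `|x - y|.
  by move=> AB BC; apply: le_trans AB _; rewrite ler_wpM2r.
have mv (h h' : R -> R) (x y a b B : R) : has_derivative h h' -> a <= x <= b -> a <= y <= b ->
    (forall z, a <= z <= b -> `|h' z| <= B) -> `|h x - h y| <= B * `|x - y|.
  move=> dh /andP[ax xb] /andP[ay yb] hB; apply: (mean_value_bound dh) => z /andP[zm zM].
  by apply: hB; rewrite (le_trans _ zm) ?le_min ?ax ?ay//= (le_trans zM)// ge_max xb yb.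
exists (Lf + Lg) => x y.
apply: (@lipschitz_join _ _ setT 0) => // {}x {}y _ _ x0 y0.
  by rewrite !candidate1_0// subrr normr0 mulr_ge0 ?addr_ge0.
apply: (@lipschitz_join _ _ [set z | 0 <= z] d); [exact: ltW| | |exact: x0|exact: y0].
- move=> {x0 y0} {}x {}y /= x0 y0 xd yd; rewrite !candidate1_f ?x0 ?y0//.
  apply: (le_norm _ Lf); last by rewrite lerDl.
  by apply: (mv f1 f2 _ _ 0 d); rewrite ?x0 ?y0.
- move=> {x0 y0} {}x {}y /= _ _ xd yd; rewrite !candidate1_g//.
  apply: (le_norm _ Lg); last by rewrite lerDr.
  (* [mv] needs a bounded interval; beyond d it is ended at the larger of the two points. *)
  apply: (mv g1 g2 _ _ d (Num.max x y)); rewrite ?xd ?yd ?le_max ?lexx ?orbT//.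
  by move=> z /andP[dz _]; exact: g2L.
Qed.

Lemma candidate2_limit x : backward_quotient candidate1 n x @[n --> \oo] --> candidate2 x.
Proof.
have [x0|x0] := leP x 0; last have [xd|xd] := leP x d.
- rewrite candidate2_0//; apply: (@backward_quotient_local _ _ (fun=> 0) _ 1) => //.
    by move=> y /andP[_ yx]; rewrite candidate1_0// (le_trans yx).
  by apply: cvg_near_cst; apply: nearW => n; rewrite /backward_quotient subrr mul0r.
- rewrite candidate2_f ?x0//; apply: (@backward_quotient_local _ _ f1 _ x) => //.
    by rewrite subrr => y /andP[y0 yx]; rewrite candidate1_f// (ltW y0) (le_trans yx).
  exact: backward_quotient_cvg.
- rewrite candidate2_g//; apply: (@backward_quotient_local _ _ g1 _ (x - d)).
  + by rewrite subr_gt0.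
  + move=> y /andP[yd _]; rewrite candidate1_g// ltW//.
    by move: yd; rewrite opprB addrC subrK.
  + exact: backward_quotient_cvg.
Qed.

Lemma candidate1_d : candidate1 d = - zeta a1 a2 r d.
Proof. by rewrite candidate1_g// /g1 subrr mulr0 expR0 mulr1 mulNr -zetE. Qed.

(** The slope vanishes below 0, decreases on [0, d] because both exponential terms do, and beyond d
    is a negative multiple of a decaying exponential. *)
Lemma candidate1_ge x : - zeta a1 a2 r d <= candidate1 x.
Proof.
have z0 : 0 <= zet by rewrite zetE mulr_ge0 ?(ltW a2_gt0).
have [x0|x0] := leP x 0; first by rewrite candidate1_0// oppr_le0.
have [xd|xd] := leP x d.
  rewrite -candidate1_d !candidate1_f ?lexx ?xd ?(ltW x0) ?(ltW d_gt0)//.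
  have h y : f1 y = - (kap * a1 * a2 * (expR (a1 * y) - expR (- a2 * y))) by rewrite /f1; ring.
  rewrite !h lerN2; apply: ler_wpM2l => //; apply: lerB.
    by rewrite ler_expR ler_wpM2l// ltW.
  by rewrite ler_expR ler_wnM2l// oppr_le0 ltW.
rewrite candidate1_g ?(ltW xd)//.
rewrite (_ : g1 x = - (zet * expR (- a2 * (x - d)))); last by rewrite zetE /g1; ring.
rewrite lerN2; apply: ler_piMr => //.
by have := @expa2_le (x - d); rewrite subr_ge0 (ltW xd) => /(_ isT)/andP[].
Qed.

(** For u = u0 this is the equation solved by the payoff of constant full payment, a consequence of
    the two characteristic equations. Replacing u0 by u changes the left side by (u0 - u) V' and the
    payment by beta (u0 - u). The point x = 0 is excluded, as [candidate2] vanishes there while the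
    second derivative from the right does not. *)
Lemma candidate_ode mu sigma u x : 0 < x ->
  sigma ^+ 2 / 2 * a1 ^+ 2 = (mu - u0) * a1 + r ->
  sigma ^+ 2 / 2 * a2 ^+ 2 = - (mu - u0) * a2 + r ->
  r * candidate x - (candidate1 x * (u - mu) + sigma ^+ 2 / 2 * candidate2 x) =
  beta * u - (if d < x then 1 else 0) + (u0 - u) * (beta + candidate1 x).
Proof.
move=> x0 h1 h2; rewrite candidateE ?(ltW x0)//; have [xd|xd] := leP x d.
  rewrite candidate1_f ?xd ?ltW// candidate2_f ?x0// fE /f1 /f2.
  move: (expR (a1 * x)) (expR (- a2 * x)) => E1 E2.
  transitivity (beta * u0 - r * kap * (a2 * E1 + a1 * E2)
    + kap * a1 * a2 * (E1 - E2) * (u - mu)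
    + kap * (a2 * (sigma ^+ 2 / 2 * a1 ^+ 2) * E1 + a1 * (sigma ^+ 2 / 2 * a2 ^+ 2) * E2)).
    by move: kap => k; field; rewrite r_neq0.
  by rewrite h1 h2; ring.
rewrite candidate1_g ?ltW// candidate2_g// gE /g1 /g2.
move: (expR _) => E; move: gam => k.
transitivity (beta * u0 - 1 + r * k * E + a2 * k * E * (u - mu)
   - (sigma ^+ 2 / 2 * a2 ^+ 2) * k * E); first by field; rewrite r_neq0.
by rewrite h2; ring.
Qed.

End CandidateValue.

(** * The drawdown does not stick at 0 *)

Section Irregularity.
Context (R : realType) (dm : measure_display) (T : measurableType dm).
Variables (P : probability T R) (W : R -> T -> R).
Hypothesis W_BM : standard_BM P W.
Implicit Types (Y Z : T -> R).

(** The cross term is integrable, being dominated by the sum of the squares, and has mean 0 by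
    independence, so variances add. *)
Lemma second_moment_increment s t Y k : 0 <= s -> s < t -> past P W s Y ->
  P.-integrable setT (EFin \o Y) -> P.-integrable setT (EFin \o (fun w => Y w ^+ 2)) ->
  let Y' := fun w => Y w + k * increment W s t w in
  [/\ P.-integrable setT (EFin \o Y'), P.-integrable setT (EFin \o (fun w => Y' w ^+ 2))
    & \int[P]_w Y' w ^+ 2 = \int[P]_w Y w ^+ 2 + k ^+ 2 * (t - s)].
Proof.
move=> s0 st pY iY iY2; set e := increment W s t => Y'.
have sd := sqrt_increment_gt0 st.
have me : measurable_fun setT e by exact: (measurable_increment W_BM s0 st).
have elaw : forall A, measurable A -> P [set w | A (e w)] = normal_prob 0 (Num.sqrt (t - s)) A.
  by move=> A mA; exact: (increment_law W_BM s0 st mA).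
have ie := integrable_gaussian sd me elaw.
have ie2 := integrable_gaussian_sqr sd me elaw.
have mY := past_measurable W_BM pY.
have iYe : P.-integrable setT (EFin \o (fun w => Y w * e w)).
  apply: (@le_integrable _ _ _ _ _ measurableT _ (EFin \o (fun w => Y w ^+ 2 + e w ^+ 2))).
  - by apply/measurable_EFinP; exact: measurable_funM.
  - move=> w _; rewrite /= lee_fin (ger0_norm (addr_ge0 (sqr_ge0 _) (sqr_ge0 _))).
    rewrite ler_norml; have := sqr_ge0 (Y w + e w); have := sqr_ge0 (Y w - e w).
    have := sqr_ge0 (Y w); have := sqr_ge0 (e w).
    by move: (Y w) (e w) => y x h1 h2 h3 h4; apply/andP; split; nra.
  - exact: (integrableD measurableT iY2 ie2).
have ike2 := integrableZl measurableT (k ^+ 2) ie2.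
have ikYe := integrableZl measurableT (2 * k) iYe.
have Y'E w : Y' w ^+ 2 = Y w ^+ 2 + (2 * k * (Y w * e w) + k ^+ 2 * e w ^+ 2).
  by rewrite /Y'; ring.
split.
- exact: (integrableD measurableT iY (integrableZl measurableT k ie)).
- rewrite (_ : (fun w => Y' w ^+ 2) = fun w => Y w ^+ 2 + (2 * k * (Y w * e w) + k ^+ 2 * e w ^+ 2)).
    exact: (integrableD measurableT iY2 (integrableD measurableT ikYe ike2)).
  by apply/funext => w; exact: Y'E.
- transitivity (\int[P]_w (Y w ^+ 2 + (2 * k * (Y w * e w) + k ^+ 2 * e w ^+ 2))).
    by apply: (@eq_Rintegral _ _ _ P setT) => w _; exact: Y'E.
  rewrite RintegralD//; last exact: (integrableD measurableT ikYe ike2).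
  rewrite RintegralD// RintegralZl// RintegralZl//.
  rewrite (Rintegral_past_increment W_BM s0 st (g := id) pY)//.
  rewrite (Rintegral_gaussian sd me elaw) (Rintegral_gaussian_sqr sd me elaw).
  by rewrite !mulr0 add0r sqr_sqrtr// subr_ge0 ltW.
Qed.

Section DyadicSum.
Variable t : R.
Hypothesis t_gt0 : 0 < t.

Let q : R := Num.sqrt t.
Let q_gt0 : 0 < q. Proof. by rewrite sqrtr_gt0. Qed.
Let q2 : q ^+ 2 = t. Proof. by rewrite sqr_sqrtr// ltW. Qed.

Let pow4 m : 4 ^+ m = (2 ^+ m) ^+ 2 :> R.
Proof. by rewrite -exprM mulnC exprM; congr (_ ^+ _); rewrite -natrX. Qed.

Let pow2_gt0 m : 0 < 2 ^+ m :> R. Proof. exact: exprn_gt0. Qed.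

(** The remaining time is t / 4^k, so the backward increment has standard deviation sqrt t / 2^k and
    [dyadic_term] has variance 1. *)
Definition dyadic_time (k : nat) : R := t - t / 4 ^+ k.

Lemma dyadic_time_ge0 k : 0 <= dyadic_time k.
Proof.
rewrite subr_ge0 ler_piMr ?(ltW t_gt0)// invf_le1 ?exprn_gt0//.
by rewrite exprn_ege1// ler1n.
Qed.

Lemma dyadic_time_lt k : dyadic_time k < t.
Proof. by rewrite ltrBlDr ltrDl divr_gt0 ?exprn_gt0. Qed.

Lemma dyadic_timeS k : dyadic_time k < dyadic_time k.+1.
Proof.
rewrite ltrD2l ltrN2 ltr_pM2l// ltf_pV2 ?posrE ?exprn_gt0//.
by rewrite exprS ltr_pMl ?exprn_gt0// ltr1n.
Qed.

(** The part of the sum known at [dyadic_time n]. The increment between times m and m+1 occurs in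
    the terms of index 0 to m, with total weight 1 + 2 + ... + 2^m = 2^(m+1) - 1. *)
Fixpoint dyadic_past (n : nat) (w : T) : R :=
  if n is m.+1 then
    dyadic_past m w + (2 ^+ m.+1 - 1) / q * increment W (dyadic_time m) (dyadic_time m.+1) w
  else 0.

Definition dyadic_term (k : nat) (w : T) : R := 2 ^+ k / q * increment W (dyadic_time k) t w.

Definition dyadic_sum (n : nat) (w : T) : R := \sum_(k < n) dyadic_term k w.

(* Summation by parts: the remaining increment is split off at each dyadic time. *)
Lemma dyadic_sumE n w : dyadic_sum n w =
  dyadic_past n w + (2 ^+ n - 1) / q * increment W (dyadic_time n) t w.
Proof.
elim: n => [|n IH]; first by rewrite /dyadic_sum big_ord0 expr0 subrr !mul0r addr0.
rewrite /dyadic_sum big_ord_recr /= -/(dyadic_sum n w) IH /dyadic_term /increment exprS.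
by field; rewrite gt_eqF.
Qed.

Lemma past_dyadic_past n : past P W (dyadic_time n) (dyadic_past n).
Proof.
elim: n => [|n IH]; first exact: measurable_cst.
apply: measurable_funD; first exact: (past_mono (ltW (dyadic_timeS n)) IH).
apply: measurable_funM; first exact: measurable_cst.
by apply: measurable_funB; apply: past_BM; rewrite ?dyadic_time_ge0 ?lexx ?(ltW (dyadic_timeS n)).
Qed.

Lemma dyadic_past_moment n : [/\ P.-integrable setT (EFin \o dyadic_past n),
  P.-integrable setT (EFin \o (fun w => dyadic_past n w ^+ 2))
  & \int[P]_w dyadic_past n w ^+ 2 <= 3 * n%:R].
Proof.
elim: n => [|n [i1 i2 IH]].
  split; first exact: finite_measure_integrable_cst.
    by rewrite /= expr0n; exact: finite_measure_integrable_cst.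
  by rewrite /= expr0n Rintegral_probability_cst mulr0.
have [j1 j2 jE] := second_moment_increment ((2 ^+ n.+1 - 1) / q) (dyadic_time_ge0 n)
  (dyadic_timeS n) (@past_dyadic_past n) i1 i2.
split=> //; rewrite [leLHS]jE (_ : 3 * n.+1%:R = 3 * n%:R + 3); last by rewrite -(natr1 n); ring.
apply: lerD => //.
(* The time step is 3 t / 4^(n+1), so each new increment contributes at most 3. *)
have -> : ((2 ^+ n.+1 - 1) / q) ^+ 2 * (dyadic_time n.+1 - dyadic_time n) =
    3 * ((2 ^+ n.+1 - 1) / 2 ^+ n.+1) ^+ 2.
  rewrite /dyadic_time !expr_div_n q2 !pow4 (exprS _ n).
  move: (2 ^+ n) (pow2_gt0 n) => x x0; field.
  by rewrite (gt_eqF x0)/= gt_eqF.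
rewrite ler_piMr// expr_le1// ?divr_ge0 ?subr_ge0 ?exprn_ge0 ?exprn_ege1 ?ler1n//.
by rewrite ler_pdivrMr ?exprn_gt0// mul1r gerBl.
Qed.

(** The terms are correlated, yet the second moment grows only linearly: after summation by parts
    the increments are independent, and the last one contributes at most 1. *)
Lemma dyadic_sum_moment n : [/\ P.-integrable setT (EFin \o dyadic_sum n),
  P.-integrable setT (EFin \o (fun w => dyadic_sum n w ^+ 2))
  & \int[P]_w dyadic_sum n w ^+ 2 <= 3 * n%:R + 1].
Proof.
have [i1 i2 iE] := dyadic_past_moment n.
have [j1 j2 jE] := second_moment_increment ((2 ^+ n - 1) / q) (dyadic_time_ge0 n)
  (dyadic_time_lt n) (@past_dyadic_past n) i1 i2.
rewrite (_ : dyadic_sum n = fun w => dyadic_past n w +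
  (2 ^+ n - 1) / q * increment W (dyadic_time n) t w); last exact/funext/dyadic_sumE.
split=> //; rewrite [leLHS]jE lerD//.
have -> : ((2 ^+ n - 1) / q) ^+ 2 * (t - dyadic_time n) = ((2 ^+ n - 1) / 2 ^+ n) ^+ 2.
  rewrite /dyadic_time !expr_div_n q2 !pow4.
  move: (2 ^+ n) (pow2_gt0 n) => x x0; field.
  by rewrite (gt_eqF x0)/= gt_eqF.
rewrite expr_le1// ?divr_ge0 ?subr_ge0 ?exprn_ge0 ?exprn_ege1 ?ler1n//.
by rewrite ler_pdivrMr ?exprn_gt0// mul1r gerBl.
Qed.

Lemma integrable_indicM A Z : measurable A -> P.-integrable setT (EFin \o Z) ->
  P.-integrable setT (EFin \o (fun w => \1_A w * Z w)).
Proof.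
move=> mA iZ; apply: (@le_integrable _ _ _ _ _ measurableT _ (EFin \o Z)) => //.
  apply/measurable_EFinP; apply: measurable_funM; first exact: measurable_indic.
  by apply/measurable_EFinP; exact: measurable_int iZ.
move=> w _; rewrite /= lee_fin normrM ler_piMl//.
by rewrite indicE; case: (_ \in _); rewrite ?normr1 ?normr0.
Qed.

Let Rintegral_indicator A : measurable A -> \int[P]_w \1_A w = fine (P A).
Proof. by move=> mA; rewrite /Rintegral integral_indic// setIT. Qed.

(* On A the normalised backward increments Z_k = 2^k (W_t - W_(t - t/4^k)) / sqrt t are
   eventually almost nonnegative, so E[1_A S_n] grows linearly in n for their sum S_n when
   P A > 0, while E[S_n^2] = O(n). *)
Lemma one_sided_increment_null A c : measurable A -> 0 <= c ->
  (forall w s, A w -> 0 <= s < t -> - c * (t - s) <= increment W s t w) -> P A = 0%E.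
Proof.
move=> mA c0 hA; pose p := fine (P A).
have PA : P A = p%:E by rewrite fineK// fin_num_measure.
have p0 : 0 <= p by rewrite fine_ge0.
suff : p <= 0 by move=> p0'; rewrite PA (@le_anti _ _ p 0) ?p0 ?p0'.
rewrite leNgt; apply/negP => {}p0.
(* This maximises the gain per term a p - a^2, with value p^2/4. *)
pose a := p / 2; have a0 : 0 < a by rewrite divr_gt0.
(* Twice the normalised drift 2^k / q times c t / 4^k; these errors sum to at most 4 c q. *)
pose b k := 2 * (c * q) / 2 ^+ k.
have mind B : measurable B -> P.-integrable setT (EFin \o (\1_B : T -> R)).
  by move=> mB; exact: integrable_indic.
have lower n : n%:R * (a * p - a ^+ 2) - 4 * (c * q) * (1 - (2 ^+ n)^-1) <=
    \int[P]_w (\1_A w * dyadic_sum n w).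
  elim: n => [|n IH].
    rewrite expr0 invr1 subrr mulr0 mul0r subrr.
    have -> : \int[P]_w (\1_A w * dyadic_sum 0 w) = \int[P]_w 0.
      by apply: (@eq_Rintegral _ _ _ P setT) => w _; rewrite /dyadic_sum big_ord0 mulr0.
    by rewrite Rintegral_probability_cst.
  have tn := dyadic_time_lt n; have tn0 := dyadic_time_ge0 n.
  pose e := increment W (dyadic_time n) t.
  have me : measurable_fun setT e by exact: (measurable_increment W_BM tn0 tn).
  have sE : Num.sqrt (t - dyadic_time n) = q / 2 ^+ n.
    rewrite /dyadic_time opprB addrC subrK pow4 -q2 -expr_div_n sqrtr_sqr ger0_norm//.
    by rewrite divr_ge0 ?(ltW q_gt0).
  have sg : 0 < q / 2 ^+ n by rewrite divr_gt0.
  have elaw : forall B, measurable B -> P [set w | B (e w)] = normal_prob 0 (q / 2 ^+ n) B.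
    by move=> B mB; rewrite -sE; exact: (increment_law W_BM tn0 tn mB).
  pose small := [set w | `|e w| < a * (q / 2 ^+ n)].
  have msmall : measurable small.
    have mabs : measurable_fun setT (fun w => `|e w|) by exact: measurableT_comp.
    have := mabs measurableT _ (measurable_itv `]-oo, a * (q / 2 ^+ n)[).
    by rewrite setTI; congr measurable; apply/seteqP; split => w; rewrite /= in_itv.
  have Psmall : \int[P]_w \1_small w <= a.
    rewrite Rintegral_indicator//; have := gaussian_small_ball sg elaw a0; rewrite -/small.
    by rewrite -[X in (X <= _)%E -> _]fineK ?fin_num_measure.
  have iA := mind A mA; have ismall := mind small msmall.
  have iS := integrable_indicM mA (let: And3 h _ _ := dyadic_sum_moment n in h).
  have iZ : P.-integrable setT (EFin \o dyadic_term n).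
    exact: (integrableZl measurableT (2 ^+ n / q) (integrable_gaussian sg me elaw)).
  have iAZ := integrable_indicM mA iZ.
  have low : a * p - a ^+ 2 - b n <= \int[P]_w (\1_A w * dyadic_term n w).
    have icst : P.-integrable setT (EFin \o (fun=> b n)) by exact: finite_measure_integrable_cst.
    have i1 := integrableB measurableT (integrableZl measurableT a iA)
      (integrableZl measurableT a ismall).
    have i2 := integrableB measurableT i1 icst.
    have i3 := RintegralB measurableT i1 icst.
    (* The comparison is pointwise. On A the normalised increment Z is at least -b/2, and off
       [small] also |Z| >= a. If then Z <= -a, it follows that a <= b/2, and Z >= -b/2 >= a - b
       still holds. *)
    apply: (@le_trans _ _ (\int[P]_w (a * \1_A w - a * \1_small w - b n))).
      rewrite [leRHS]i3 (RintegralB measurableT) //; last 2 first.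
        exact: (integrableZl measurableT a iA).
        exact: (integrableZl measurableT a ismall).
      rewrite RintegralZl// RintegralZl// Rintegral_probability_cst Rintegral_indicator//.
      by rewrite lerD2r lerB// expr2 ler_wpM2l// ltW.
    apply: (@le_Rintegral _ _ _ P setT (fun w => a * \1_A w - a * \1_small w - b n)
      (fun w => \1_A w * dyadic_term n w)) => // w _; rewrite /= /dyadic_term -/e.
    have bE : b n = 2 * (2 ^+ n / q * (c * (t / 4 ^+ n))).
      rewrite /b pow4 -q2; move: (2 ^+ n) (pow2_gt0 n) => x x0.
      by field; rewrite !lt0r_neq0.
    have hAw : A w -> - (b n) <= 2 * (2 ^+ n / q * e w).
      move=> Aw; rewrite bE -mulrN ler_pM2l// -mulrN ler_pM2l ?divr_gt0// -mulNr.
      have := hA w (dyadic_time n) Aw; rewrite tn tn0 => /(_ isT).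
      by rewrite /dyadic_time opprB [t + _]addrC subrK.
    have hs : ~ small w -> a <= `|2 ^+ n / q * e w|.
      move=> /negP; rewrite -leNgt normrM ger0_norm ?divr_ge0 ?(ltW q_gt0) ?exprn_ge0// => h.
      rewrite mulrC -ler_pdivrMr ?divr_gt0// invf_div; exact: h.
    have b0 : 0 <= b n by rewrite /b divr_ge0 ?mulr_ge0 ?(ltW q_gt0) ?exprn_ge0.
    rewrite !indicE; move: (2 ^+ n / q * e w) hAw hs => Z hAw hs.
    have [/set_mem Aw|_] := boolP (w \in A); have [_|/negP nw] := boolP (w \in small).
    - by have := hAw Aw; rewrite !mulr1 !mul1r; lra.
    - have := hAw Aw; have /hs : ~ small w by move=> sw; apply: nw; exact/mem_set.
      by rewrite ler_normr => /orP[]; rewrite !mulr1 mulr0 mul1r; lra.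
    - by rewrite mulr1 mulr0 mul0r; lra.
    - by rewrite !mulr0 mul0r; lra.
  have -> : \int[P]_w (\1_A w * dyadic_sum n.+1 w) =
      \int[P]_w (\1_A w * dyadic_sum n w + \1_A w * dyadic_term n w).
    apply: (@eq_Rintegral _ _ _ P setT) => w _.
    by rewrite /dyadic_sum big_ord_recr mulrDr.
  rewrite RintegralD//; apply: le_trans (lerD IH low).
  rewrite -(natr1 n) /b (exprS 2 n); move: (2 ^+ n) (pow2_gt0 n) (c * q) => x x0 y.
  by rewrite le_eqVlt; apply/orP; left; apply/eqP; field; exact: lt0r_neq0.
(* In |S| <= l/2 + S^2 / (2 l) this choice turns the second moment 3n + 1 into n p^2/8 plus a
   constant, half of the growth n p^2/4 from below. *)
pose l := 12 / p ^+ 2; have l0 : 0 < l by rewrite divr_gt0 ?exprn_gt0.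
have upper n : \int[P]_w (\1_A w * dyadic_sum n w) <= l / 2 + (2 * l)^-1 * (3 * n%:R + 1).
  have [iS iS2 S2] := dyadic_sum_moment n.
  have iS2' := integrableZl measurableT (2 * l)^-1 iS2.
  have icst : P.-integrable setT (EFin \o (fun=> l / 2)) by exact: finite_measure_integrable_cst.
  apply: (@le_trans _ _ (\int[P]_w (l / 2 + (2 * l)^-1 * dyadic_sum n w ^+ 2))).
    apply: (@le_Rintegral _ _ _ P setT (fun w => \1_A w * dyadic_sum n w)
      (fun w => l / 2 + (2 * l)^-1 * dyadic_sum n w ^+ 2)) => //; first exact: integrable_indicM.
      exact: (integrableD measurableT icst iS2').
    move=> w _; rewrite /= indicE; move: (dyadic_sum n w) => S.
    apply: (@le_trans _ _ `|S|).
      by case: (_ \in _); rewrite ?mul1r ?mul0r ?ler_norm ?normr_ge0.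
    have : 0 <= (2 * l)^-1 * (l - `|S|) ^+ 2 by rewrite mulr_ge0 ?sqr_ge0// invr_ge0 mulr_ge0 ?ltW.
    rewrite -(real_normK (num_real S)); move: `|S| => y.
    rewrite (_ : (2 * l)^-1 * (l - y) ^+ 2 = l / 2 + (2 * l)^-1 * y ^+ 2 - y) ?subr_ge0//.
    by field; exact: lt0r_neq0.
  rewrite RintegralD// Rintegral_probability_cst RintegralZl//.
  by rewrite lerD2l ler_wpM2l// invr_ge0 mulr_ge0 ?ltW.
(* All terms not proportional to n; the two bounds would give n p^2/8 <= C for every n. *)
pose C := l / 2 + p ^+ 2 / 24 + 4 * (c * q).
have C0 : 0 <= C.
  apply: addr_ge0; last by rewrite mulr_ge0// mulr_ge0// ltW.
  by apply: addr_ge0; apply: divr_ge0 => //; rewrite ltW// exprn_gt0.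
have p20 : 0 < p ^+ 2 by rewrite exprn_gt0.
have [n hn] : exists n : nat, 8 * C / p ^+ 2 < n%:R.
  by exists (Num.bound (8 * C / p ^+ 2)); apply: archi_boundP; rewrite divr_ge0 ?mulr_ge0// ltW.
have := le_trans (lower n) (upper n).
have -> : (2 * l)^-1 * (3 * n%:R + 1) = n%:R * p ^+ 2 / 8 + p ^+ 2 / 24.
  by rewrite /l; field; exact: lt0r_neq0.
have -> : n%:R * (a * p - a ^+ 2) = n%:R * p ^+ 2 / 4 by rewrite /a; field.
move: hn; rewrite ltr_pdivrMr// /C.
have cq : 4 * (c * q) * (1 - (2 ^+ n)^-1) <= 4 * (c * q).
  by rewrite ler_piMr ?mulr_ge0 ?(ltW q_gt0)// gerBl invr_ge0 exprn_ge0.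
by move: (n%:R * p ^+ 2) (4 * (c * q)) (4 * (c * q) * _) cq => X y' Y; lra.
Qed.

End DyadicSum.

(** Zero drawdown at t means that X_t dominates all earlier values of X. Payments only lower X, so
    every backward increment of W is at least -(|mu| / sigma)(t - s). *)
Lemma drawdown_null mu sigma u0 U z t : complete_prob_space P -> 0 < sigma ->
  admissible P W u0 U -> 0 <= z -> 0 < t ->
  P [set w | drawdown W mu sigma U z t w = 0] = 0%E.
Proof.
move=> Pcomp sigma0 U_adm z0 t0.
have mD : measurable_fun setT (drawdown W mu sigma U z t).
  exact: (@measurable_slice1 _ _ R T R (fun s w => drawdown W mu sigma U z s w)
    (measurable_drawdown mu sigma Pcomp W_BM U_adm z0) t).
apply: (@one_sided_increment_null t t0 _ (`|mu| / sigma)).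
- rewrite -[X in measurable X]setTI; exact: (mD measurableT [set 0] (measurable_set1 0)).
- by rewrite divr_ge0// ltW.
- move=> w s /= D0 /andP[s0 st].
  have := Xproc_le_Mproc mu sigma W_BM U_adm z w (s := s) (t := t); rewrite s0 (ltW st) => /(_ isT).
  move: D0; rewrite /drawdown /Dproc (max_r (ltW t0)) => /eqP; rewrite subr_eq0 => /eqP ->.
  rewrite -subr_ge0 Xproc_incr.
  have st' : 0 <= s <= t by rewrite s0 ltW.
  have /andP[c0 _] := cumulated_incr_itv U_adm w st'.
  move: (_ - cumulated U s w) c0 => c c0 h.
  have h1 : - (`|mu| * (t - s)) <= sigma * increment W s t w.
    have : mu * (t - s) <= `|mu| * (t - s) by rewrite ler_wpM2r ?ler_norm// subr_ge0 ltW.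
    by move: h c0; move: (mu * _) (sigma * _) (`|mu| * _) => x y y'; lra.
  rewrite -(ler_pM2l sigma0); apply: le_trans h1.
  by rewrite (_ : sigma * _ = - (`|mu| * (t - s)))//; field; exact: lt0r_neq0.
Qed.

End Irregularity.

(** * Verification *)

Lemma eq_Rintegral_off_null (d : measure_display) (T : measurableType d) (R : realType)
  (m : measure T R) (f g : T -> R) (N : set T) :
  measurable_fun setT f -> measurable_fun setT g -> measurable N -> m N = 0%E ->
  (forall x, ~ N x -> f x = g x) -> \int[m]_x f x = \int[m]_x g x.
Proof.
move=> mf mg mN N0 fg; congr fine; apply: ae_eq_integral => //.
- exact/measurable_EFinP.
- exact/measurable_EFinP.
- exists N; split=> // x /= fgx; apply: contrapT => Nx; apply: fgx => _.
  by rewrite fg.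
Qed.

Section Discounted.
Context (R : realType) (dm : measure_display) (T : measurableType dm).
Variables (P : probability T R) (r : R).
Hypothesis r_gt0 : 0 < r.
Notation nu := (exponential_law r_gt0).
Implicit Types (H : R -> T -> R).

Lemma exponential_law_below s : 0 <= s ->
  nu (`]-oo, s[%classic : set (measurableTypeR R)) = (1 - expR (- r * s))%:E.
Proof.
move=> s0; have := exponential_law_tail r_gt0 s0.
rewrite (_ : (\int[_]_(t in _) _)%E = nu (`[s, +oo[%classic : set (measurableTypeR R)))// => h.
have mtail : measurable (`[s, +oo[%classic : set (measurableTypeR R)) by exact: measurable_itv.
rewrite (_ : (`]-oo, s[%classic : set (measurableTypeR R)) = ~` (`[s, +oo[%classic)).
  by rewrite probability_setC// [X in (_ - X)%E]h.
by rewrite setCitvr.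
Qed.

Lemma exponential_law_npos : nu (`]-oo, 0]%classic : set (measurableTypeR R)) = 0%E.
Proof.
have m0 : measurable (`]-oo, 0]%classic : set (measurableTypeR R)) by exact: measurable_itv.
apply/eqP; rewrite eq_le measure_ge0 andbT.
apply/lee_addgt0Pr => e e0; rewrite add0e.
have s0 : 0 < e / r by rewrite divr_gt0.
apply: (@le_trans _ _ (nu (`]-oo, e / r[%classic : set (measurableTypeR R)))).
  apply: le_measure; [exact: mem_set|apply: mem_set; exact: measurable_itv|].
  move=> x; rewrite /= !in_itv/= => x0; exact: le_lt_trans x0 s0.
rewrite exponential_law_below ?(ltW s0)// lee_fin.
have := expR_ge1Dx (- r * (e / r)); rewrite (_ : - r * (e / r) = - e).
  by lra.
by field; exact: lt0r_neq0.
Qed.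

Definition discounted H : R := \int[nu]_t (\int[P]_w H t w).

(** The class of fields to which Fubini and linearity apply without further integrability checks;
    every process below belongs to it. *)
Definition bounded_field H : Prop :=
  measurable_fun setT (fun p : R * T => H p.1 p.2) /\ exists C, forall t w, `|H t w| <= C.

Lemma bounded_field_slice H t : bounded_field H -> measurable_fun setT (H t).
Proof. by move=> [mH _]; exact: (@measurable_slice1 _ _ R T R H mH t). Qed.

Lemma bounded_field_integrable H t : bounded_field H -> P.-integrable setT (EFin \o H t).
Proof.
move=> bH; have [_ [C HC]] := bH.
exact: (probability_integrable P (C := C) (bounded_field_slice t bH)).
Qed.

Lemma bounded_field_expectation H : bounded_field H ->
  measurable_fun setT (fun t => \int[P]_w H t w) /\
  nu.-integrable setT (EFin \o (fun t => \int[P]_w H t w)).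
Proof.
move=> bH; have [mH [C HC]] := bH; have mE := measurable_expectation P mH HC.
split=> //; apply: (probability_integrable nu (C := C) mE) => t.
exact: (Rintegral_probability_bound P (bounded_field_slice t bH) (HC t)).
Qed.

Lemma bounded_fieldD H1 H2 : bounded_field H1 -> bounded_field H2 ->
  bounded_field (fun t w => H1 t w + H2 t w).
Proof.
move=> [m1 [C1 h1]] [m2 [C2 h2]]; split; first exact: measurable_funD.
by exists (C1 + C2) => t w; rewrite (le_trans (ler_normD _ _))// lerD.
Qed.

Lemma bounded_fieldM H1 H2 : bounded_field H1 -> bounded_field H2 ->
  bounded_field (fun t w => H1 t w * H2 t w).
Proof.
move=> [m1 [C1 h1]] [m2 [C2 h2]]; split; first exact: measurable_funM.
by exists (C1 * C2) => t w; rewrite normrM ler_pM.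
Qed.

Lemma bounded_field_cst c : bounded_field (fun _ _ => c).
Proof. by split; [exact: measurable_cst|exists `|c| => _ _]. Qed.

Lemma bounded_fieldZ c H : bounded_field H -> bounded_field (fun t w => c * H t w).
Proof. exact: bounded_fieldM (bounded_field_cst c). Qed.

Lemma discountedD H1 H2 : bounded_field H1 -> bounded_field H2 ->
  discounted (fun t w => H1 t w + H2 t w) = discounted H1 + discounted H2.
Proof.
move=> b1 b2; have [_ i1] := bounded_field_expectation b1.
have [_ i2] := bounded_field_expectation b2.
rewrite /discounted -(RintegralD measurableT i1 i2).
apply: (@eq_Rintegral _ _ _ nu setT) => t _.
exact: (RintegralD measurableT (bounded_field_integrable t b1) (bounded_field_integrable t b2)).
Qed.

Lemma discountedZ c H : bounded_field H ->
  discounted (fun t w => c * H t w) = c * discounted H.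
Proof.
move=> bH; have [_ iH] := bounded_field_expectation bH.
rewrite /discounted -(RintegralZl c measurableT iH).
apply: (@eq_Rintegral _ _ _ nu setT) => t _.
exact: (RintegralZl c measurableT (bounded_field_integrable t bH)).
Qed.

(** The exceptional event may vary with t and time 0 is excluded, as needed for [drawdown_null]: the
    drawdown starts at z, which may be 0. *)
Lemma eq_discounted H1 H2 (N : R -> set T) : bounded_field H1 -> bounded_field H2 ->
  (forall t, 0 < t -> measurable (N t) /\ P (N t) = 0%E) ->
  (forall t w, 0 < t -> ~ N t w -> H1 t w = H2 t w) -> discounted H1 = discounted H2.
Proof.
move=> b1 b2 N0 H12; have [m1 _] := bounded_field_expectation b1.
have [m2 _] := bounded_field_expectation b2.
have mneg : measurable (`]-oo, 0]%classic : set (measurableTypeR R)) by exact: measurable_itv.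
rewrite /discounted; apply: (@eq_Rintegral_off_null _ _ _ nu _ _ _ m1 m2 mneg exponential_law_npos).
move=> t /=; rewrite in_itv/= => /negP; rewrite -ltNge => t0.
have [mN PN] := N0 t t0.
apply: (eq_Rintegral_off_null (bounded_field_slice t b1) (bounded_field_slice t b2) mN PN) => w Nw.
exact: H12.
Qed.

Lemma discounted_ge0 H : (forall t w, 0 <= H t w) -> 0 <= discounted H.
Proof. by move=> H0; apply: Rintegral_ge0 => t _; exact: Rintegral_ge0. Qed.

End Discounted.

(** * Roots of the characteristic equation *)

Section Theta.
Variables (R : realType) (mu sigma r u : R).
Hypotheses (sigma_gt0 : 0 < sigma) (r_gt0 : 0 < r).

Let disc := (mu - u) ^+ 2 + 2 * r * sigma ^+ 2.
Let s2_gt0 : 0 < sigma ^+ 2. Proof. by rewrite exprn_gt0. Qed.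
Let rs_gt0 : 0 < 2 * r * sigma ^+ 2. Proof. by rewrite !mulr_gt0. Qed.
Let disc_ge0 : 0 <= disc. Proof. by rewrite addr_ge0 ?sqr_ge0 ?(ltW rs_gt0). Qed.

Let sqrt_gt_norm : `|mu - u| < Num.sqrt disc.
Proof. by rewrite -sqrtr_sqr ltr_sqrt ?ltrDl// ltr_wpDl ?sqr_ge0. Qed.

Lemma theta1_gt0 : 0 < theta1 mu sigma r u.
Proof.
rewrite divr_gt0//; move: sqrt_gt_norm; rewrite /disc ltr_norml => /andP[h _].
by move: h; move: (Num.sqrt _) => s h; lra.
Qed.

Lemma theta2_gt0 : 0 < theta2 mu sigma r u.
Proof. by rewrite divr_gt0// subr_gt0 (le_lt_trans (ler_norm _)). Qed.

Lemma theta1_root : sigma ^+ 2 / 2 * theta1 mu sigma r u ^+ 2 = (mu - u) * theta1 mu sigma r u + r.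
Proof.
have := sqr_sqrtr disc_ge0; rewrite /theta1 /disc; move: (mu - u) (Num.sqrt _) => m s h.
transitivity ((s ^+ 2 + 2 * s * m + m ^+ 2) / (2 * sigma ^+ 2)).
  by field; exact: lt0r_neq0.
by rewrite h; field; exact: lt0r_neq0.
Qed.

Lemma theta2_root : sigma ^+ 2 / 2 * theta2 mu sigma r u ^+ 2 = - (mu - u) * theta2 mu sigma r u + r.
Proof.
have := sqr_sqrtr disc_ge0; rewrite /theta2 /disc; move: (mu - u) (Num.sqrt _) => m s h.
transitivity ((s ^+ 2 - 2 * s * m + m ^+ 2) / (2 * sigma ^+ 2)).
  by field; exact: lt0r_neq0.
by rewrite h; field; exact: lt0r_neq0.
Qed.

End Theta.

Section Verification.
Context (R : realType) (dm : measure_display) (T : measurableType dm).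
Variables (P : probability T R) (W : R -> T -> R) (mu sigma u0 r beta d : R).
Hypotheses (Pcomp : complete_prob_space P) (W_BM : standard_BM P W).
Hypotheses (sigma_gt0 : 0 < sigma) (u0_gt0 : 0 < u0) (r_gt0 : 0 < r) (d_gt0 : 0 < d).

Notation nu := (exponential_law r_gt0).
Notation leb := (@lebesgue_measure R).
Notation E := (discounted P r_gt0).

Let a1 := theta1 mu sigma r u0.
Let a2 := theta2 mu sigma r u0.
Let a1_gt0 : 0 < a1. Proof. exact: theta1_gt0. Qed.
Let a2_gt0 : 0 < a2. Proof. exact: theta2_gt0. Qed.
Let V := candidate a1 a2 u0 r beta d.
Let V1 := candidate1 a1 a2 r d.
Let V2 := candidate2 a1 a2 r d.

Let V1_lip := candidate1_lipschitz a1_gt0 a2_gt0 r_gt0 d_gt0.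

Let continuous_V1 : continuous V1.
Proof. by have [L hL] := V1_lip; exact: lipschitz_continuous hL. Qed.

Section Control.
Variables (U : R -> T -> R) (z : R).
Hypotheses (U_adm : admissible P W u0 U) (z_ge0 : 0 <= z).

Notation Dr := (drawdown W mu sigma U z).
Notation C := (control U).

Definition payoff t w : R := beta * C t w - (if d < Dr t w then 1 else 0).
(** The rate at which value is lost by paying the control instead of u0. *)
Definition gap t w : R := (u0 - C t w) * (beta + V1 (Dr t w)).

Let mDr := measurable_drawdown mu sigma Pcomp W_BM U_adm z_ge0.

Let bounded_field_control : bounded_field C.
Proof.
split; first exact: (measurable_control U_adm).
by exists u0 => t w; exact: (control_norm_le U_adm).
Qed.

Let bounded_field_late : bounded_field (fun t w => if d < Dr t w then 1 else 0 : R).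
Proof.
split; last by exists 1 => t w; case: ifP; rewrite ?normr1 ?normr0.
have h : measurable_fun setT (fun x : R => if d < x then 1 else 0 : R).
  apply: measurable_fun_ifT => //.
  by apply: measurable_fun_ltr => //; exact: measurable_cst.
exact: (measurableT_comp h mDr).
Qed.

Let bounded_field_payoff : bounded_field payoff.
Proof.
rewrite (_ : payoff = fun t w => beta * C t w + -1 * (if d < Dr t w then 1 else 0)).
  exact: (bounded_fieldD (bounded_fieldZ beta bounded_field_control)
    (bounded_fieldZ (-1) bounded_field_late)).
by apply/funext => t; apply/funext => w; rewrite mulN1r.
Qed.

Lemma bounded_field_slope : bounded_field (fun t w => beta + V1 (Dr t w)).
Proof.
apply: (bounded_fieldD (bounded_field_cst _ beta)); split.
  exact: (measurableT_comp (continuous_measurable_fun continuous_V1) mDr).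
have [K [_ hK _]] := candidate_bounded u0 beta a1_gt0 a2_gt0 r_gt0 d_gt0.
by exists K => t w; exact: hK.
Qed.

Lemma bounded_field_gap : bounded_field gap.
Proof.
apply: bounded_fieldM bounded_field_slope.
rewrite (_ : (fun t w => u0 - C t w) = fun t w => u0 + -1 * C t w).
  exact: (bounded_fieldD (bounded_field_cst _ u0) (bounded_fieldZ (-1) bounded_field_control)).
by apply/funext => t; apply/funext => w; rewrite mulN1r.
Qed.

(** On each path the two discounted Lebesgue integrals become one average under the exponential law,
    with a factor 1/r; Fubini then puts the time average outside, as the resolvent identity
    requires. *)
Lemma vUE : vU P W mu sigma r beta d U z = (r^-1 * E payoff)%:E.
Proof.
have slice2 (H : R -> T -> R) : bounded_field H -> forall w,
    measurable_fun setT (fun t => H t w) /\ nu.-integrable setT (EFin \o (fun t => H t w)).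
  move=> [mH [K HK]] w.
  have mw : measurable_fun setT (fun t => H t w) by exact: (@measurable_slice2 _ _ R T R H mH w).
  by split=> //; exact: (probability_integrable nu (C := K) mw).
have disc (H : R -> T -> R) w : bounded_field H ->
    Rintegral leb `[0, +oo[ (fun t => expR (- r * t) * H t w) = r^-1 * \int[nu]_t H t w.
  move=> bH; have [mw _] := slice2 H bH w; have [_ [K HK]] := bH.
  exact: (Rintegral_discount r_gt0 mw (C := K)).
pose inner w := r^-1 * \int[nu]_t payoff t w.
have innerE w : beta * Rintegral leb `[0, +oo[ (fun t => expR (- r * t) * U t w)
    - Rintegral leb `[0, +oo[ (fun t => expR (- r * t) *
        (if d < Dproc W mu sigma U z t w then 1 else 0)) = inner w.
  rewrite (_ : Rintegral leb `[0, +oo[ (fun t => expR (- r * t) * U t w) =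
    Rintegral leb `[0, +oo[ (fun t => expR (- r * t) * C t w)); last first.
    apply: eq_Rintegral => t; rewrite inE/= in_itv/= andbT => t0.
    by rewrite controlE.
  rewrite (_ : Rintegral leb `[0, +oo[ (fun t => _ * (if _ then _ else _)) =
    Rintegral leb `[0, +oo[ (fun t => expR (- r * t) * (if d < Dr t w then 1 else 0))); last first.
    apply: eq_Rintegral => t; rewrite inE/= in_itv/= andbT => t0.
    by rewrite /drawdown max_r.
  rewrite (disc _ w bounded_field_control) (disc _ w bounded_field_late) /inner.
  have [_ iC] := slice2 _ bounded_field_control w.
  have [_ iL] := slice2 _ bounded_field_late w.
  have -> : \int[nu]_t payoff t w =
      beta * \int[nu]_t C t w - \int[nu]_t (if d < Dr t w then 1 else 0).
    rewrite -(RintegralZl beta measurableT iC).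
    exact: (RintegralB measurableT (integrableZl measurableT beta iC) iL).
  by ring.
rewrite /vU (_ : (fun w => _) = fun w => (inner w)%:E); last first.
  by apply/funext => w; rewrite innerE.
have [mp [K pK]] := bounded_field_payoff.
have minner : measurable_fun setT (fun w => \int[nu]_t payoff t w).
  apply: (@measurable_Rintegral_slice1 _ _ T (measurableTypeR R) R nu setT setT
    (fun w t => payoff t w) K) => //; first exact: (probability_fin nu).
  exact: (measurableT_comp mp (@measurable_swap _ _ T (measurableTypeR R))).
have iinner : P.-integrable setT (EFin \o (fun w => \int[nu]_t payoff t w)).
  apply: (probability_integrable P (C := K) minner) => w.
  by apply: (Rintegral_probability_bound nu (C := K)) => //; have [] := slice2 _ bounded_field_payoff w.
rewrite (EFin_Rintegral measurableT (integrableZl measurableT r^-1 iinner)).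
congr EFin; rewrite [LHS](RintegralZl r^-1 measurableT iinner).
congr (_ * _); apply: esym.
exact: (@Rintegral_Fubini _ _ (measurableTypeR R) T R nu P setT setT payoff K measurableT measurableT
  (probability_fin nu) (probability_fin P) mp pK).
Qed.

Lemma candidate_gap : V z = r^-1 * E payoff + r^-1 * E gap.
Proof.
have [K [VK V1K V2K]] := candidate_bounded u0 beta a1_gt0 a2_gt0 r_gt0 d_gt0.
have [L V1L] := V1_lip.
have L0 : 0 <= L by have := le_trans (normr_ge0 _) (V1L 1 0); rewrite subr0 normr1 mulr1.
have K0 : 0 <= K := le_trans (normr_ge0 _) (VK 0).
(* [resolvent_C11] takes a single constant for the sup bounds and for the Lipschitz bound of V'. *)
have KL (x : R) : x <= K -> x <= K + L by move=> xK; rewrite (le_trans xK)// lerDl.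
have V1KL x y : `|V1 x - V1 y| <= (K + L) * `|x - y|.
  by apply: (le_trans (V1L x y)); rewrite ler_wpM2r// lerDr.
have V2_lim := candidate2_limit a1_gt0 a2_gt0 r_gt0 d_gt0.
rewrite /V -(resolvent_C11 (K := K + L)
  (has_derivative_candidate_int u0 beta a1_gt0 a2_gt0 r_gt0 d_gt0)
  (has_derivative_candidate u0 beta a1_gt0 a2_gt0 r_gt0 d_gt0)
  (fun x => KL _ (VK x)) (fun x => KL _ (V1K x)) V1KL
  (candidate_neg a1 a2 u0 r beta d) V2_lim mu Pcomp W_BM sigma_gt0 r_gt0 U_adm z_ge0
  (fun x => KL _ (V2K x))).
have bp := bounded_field_payoff; have bg := bounded_field_gap.
rewrite -mulrDr -(discountedD P r_gt0 bp bg) -(discountedZ P r_gt0 r^-1 (bounded_fieldD bp bg)).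
have mV : measurable_fun setT V.
  apply: continuous_measurable_fun.
  exact: is_derive_continuous (has_derivative_candidate u0 beta a1_gt0 a2_gt0 r_gt0 d_gt0).
have mV1 := continuous_measurable_fun continuous_V1.
have mV2 : measurable_fun setT V2.
  have mq n : measurable_fun setT (backward_quotient V1 n).
    apply: measurable_funM; last exact: measurable_cst.
    apply: measurable_funB => //; apply: (measurableT_comp mV1).
    by apply: measurable_funB => //; exact: measurable_cst.
  by apply: (measurable_fun_cvg mq) => x _; exact: V2_lim.
have br : bounded_field (resolvent_term W mu sigma r U z V V1 V2).
  split; first exact: (measurable_resolvent_term mu sigma r Pcomp W_BM U_adm z_ge0 mV mV1 mV2).
  by eexists => t w; exact: (resolvent_term_le mu sigma r_gt0 U_adm z VK V1K V2K).
transitivity (E (resolvent_term W mu sigma r U z V V1 V2)); first by [].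
(* Off the event of zero drawdown, null for each t > 0, the differential equation identifies the
   resolvent term with 1/r times payoff plus gap. *)
apply: (@eq_discounted _ _ _ P r r_gt0 _ _ (fun t => [set w | Dr t w = 0]) br
  (bounded_fieldZ r^-1 (bounded_fieldD bp bg))) => t.
  move=> t0; split; last exact: (drawdown_null W_BM mu Pcomp sigma_gt0 U_adm z_ge0 t0).
  rewrite -[X in measurable X]setTI.
  exact: ((@measurable_slice1 _ _ R T R Dr mDr t) measurableT [set 0] (measurable_set1 0)).
move=> w t0 /= Dr0.
have Drp : 0 < Dr t w.
  rewrite lt_neqAle eq_sym; apply/andP; split; first exact/eqP.
  exact: (drawdown_ge0 mu sigma W_BM U_adm).
rewrite /payoff /gap -/V1 -(candidate_ode beta a1_gt0 a2_gt0 r_gt0 d_gt0 (C t w) Drp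
  (theta1_root mu u0 sigma_gt0 r_gt0) (theta2_root mu u0 sigma_gt0 r_gt0)).
rewrite /resolvent_term /generator_term -/V -/V1 -/V2.
by field; exact: lt0r_neq0.
Qed.

End Control.

Lemma deterministic_admissible (u : R -> R) : measurable_fun setT u ->
  (forall t, 0 <= t -> 0 <= u t <= u0) -> admissible P W u0 (fun t _ => u t).
Proof.
move=> mu_ uu; split; last by move=> t _; exact: uu.
- exact: (measurableT_comp mu_ (@measurable_fst _ _ R T)).
- by move=> t t0; apply/pastP; exact: measurable_cst.
Qed.

Lemma full_admissible : admissible P W u0 (fun _ _ => u0).
Proof.
by apply: (@deterministic_admissible (fun=> u0)) => // t _; rewrite lexx ltW.
Qed.

Lemma vU_full z : 0 <= z -> vU P W mu sigma r beta d (fun _ _ => u0) z = (V z)%:E.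
Proof.
move=> z0; rewrite (vUE full_admissible z0) (candidate_gap full_admissible z0).
(* Written as a product so that [discountedZ] with factor 0 evaluates the average. *)
rewrite (_ : gap _ _ = fun _ _ => 0 * 0); last first.
  by apply/funext => t; apply/funext => w; rewrite /gap /control subrr !mul0r.
by rewrite (discountedZ P r_gt0 0 (bounded_field_cst T 0)) mul0r mulr0 addr0.
Qed.

Lemma vU_le_candidate U z : admissible P W u0 U -> 0 <= z -> zeta a1 a2 r d <= beta ->
  (vU P W mu sigma r beta d U z <= (V z)%:E)%E.
Proof.
move=> U_adm z0 zb; rewrite (vUE U_adm z0) (candidate_gap U_adm z0) lee_fin lerDl.
rewrite mulr_ge0 ?invr_ge0 ?(ltW r_gt0)//; apply: discounted_ge0 => t w.
have /andP[_ Cu] := control_itv U_adm t w.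
rewrite mulr_ge0 ?subr_ge0//.
have := candidate1_ge a1_gt0 a2_gt0 r_gt0 d_gt0 (drawdown W mu sigma U z t w).
by rewrite -/V1; move: zb; lra.
Qed.

Lemma vfun_candidate z : 0 <= z -> zeta a1 a2 r d <= beta ->
  vfun P W mu sigma u0 r beta d z = (V z)%:E.
Proof.
move=> z0 zb; apply/eqP; rewrite eq_le; apply/andP; split.
- by apply: ge_ereal_sup => _ [U U_adm <-]; exact: vU_le_candidate.
- by rewrite -(vU_full z0); apply: ereal_sup_ubound; exists (fun _ _ => u0) => //; exact: full_admissible.
Qed.

Lemma eq_Dproc U U' z t w : (forall s, 0 <= s <= t -> U s w = U' s w) ->
  Dproc W mu sigma U z t w = Dproc W mu sigma U' z t w.
Proof.
move=> UU'.
have XX' s : 0 <= s <= t -> Xproc W mu sigma U s w = Xproc W mu sigma U' s w.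
  move=> /andP[s0 st]; congr (_ - _); apply: eq_Rintegral => q; rewrite inE/= in_itv/= => /andP[q0 qs].
  by apply: UU'; rewrite q0 (le_trans qs).
have [t0|t0] := leP 0 t; last first.
  rewrite /Dproc /Mproc; congr (Num.max _ (sup _) - _).
    have e (X : R -> T -> R) : [set X s w | s in `[0, t]] = set0.
      by apply/seteqP; split => // x [s]; rewrite /= in_itv/= => /andP[h1 h2]; lra.
    by rewrite !e.
  congr (_ - _); apply: eq_Rintegral => q; rewrite inE/= in_itv/= => /andP[h1 h2]; lra.
rewrite /Dproc XX' ?t0 ?lexx// /Mproc; congr (Num.max _ (sup _) - _).
apply/seteqP; split => x [s]; rewrite /= in_itv/= => st <-; exists s; rewrite /= ?in_itv//=.
  by rewrite XX'.
by rewrite XX'.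
Qed.

(** As z > 0 and X starts at 0, X stays below z for a short time; the maximum is then still z and
    the drawdown equals z - X. Negative times are frozen at 0, so only an upper bound on the times
    is required. *)
Lemma drawdown_cvg0 U z (t_ : nat -> R) w : admissible P W u0 U -> 0 < z ->
  (forall n, t_ n < n.+1%:R^-1) ->
  drawdown W mu sigma U z (t_ n) w @[n --> \oo] --> z.
Proof.
move=> U_adm z0 tn; apply/cvgrPdist_le => e e0.
have m0 : 0 < Num.min z e by rewrite lt_min z0 e0.
have := @continuous_Xproc_max _ _ _ P W mu sigma u0 W_BM U U_adm w 0.
move/cvgrPdist_le => /(_ _ m0)[] /= c c0 hc.
have Xsmall s : 0 <= s < c -> `|Xproc W mu sigma U s w| <= Num.min z e.
  move=> /andP[s0 sc]; have := hc s; rewrite /= sub0r normrN ger0_norm// => /(_ sc).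
  by rewrite (max_r (lexx 0)) (Xproc0 mu sigma W_BM) sub0r normrN (max_r s0).
near=> n.
have nc : n.+1%:R^-1 < c by near: n; exact: (near_infty_natSinv_lt (PosNum c0)).
set t := Num.max 0 (t_ n).
have t0 : 0 <= t by rewrite le_max lexx.
have tc : t < c by rewrite gt_max c0 (lt_trans (tn n)).
have ME : Mproc W mu sigma U z t w = z.
  apply: le_anti; rewrite Mproc_ge_start andbT; apply: Mproc_le => // s /andP[s0 st].
  apply: le_trans (ler_norm _) _; apply: le_trans (Xsmall s _) _; rewrite ?ge_min ?lexx//.
  by rewrite s0 (le_lt_trans st).
rewrite /drawdown /Dproc -/t ME opprB addrC subrK.
by apply: le_trans (Xsmall t _) _; rewrite ?t0// ge_min lexx orbT.
Unshelve. all: by end_near. Qed.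

(** Otherwise some times below 1/(n+1) would violate the bound for every n; by bounded convergence
    the expectations there tend to beta + V'(d) = beta - zeta, which is negative and hence below its
    half. The control 0 appears because the improved strategy coincides with it at first. *)
Lemma expected_slope_near0 : beta < zeta a1 a2 r d -> exists2 e, 0 < e &
  forall t, t < e ->
    \int[P]_w (beta + V1 (drawdown W mu sigma (fun _ _ => 0) d t w)) <= (beta - zeta a1 a2 r d) / 2.
Proof.
move=> bz; set a := (_ / 2).
have U_adm : admissible P W u0 (fun _ _ => 0).
  by apply: (@deterministic_admissible (fun=> 0)) => // t _; rewrite lexx ltW.
pose H t w := beta + V1 (drawdown W mu sigma (fun _ _ => 0) d t w).
have bH : bounded_field H := bounded_field_slope U_adm (ltW d_gt0).
apply: contrapT => noe.
have /choice[t_ ht] : forall n : nat, exists t, t < n.+1%:R^-1 /\ a < \int[P]_w H t w.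
  move=> n; apply: contrapT => not; apply: noe; exists n.+1%:R^-1; first by rewrite invr_gt0.
  move=> t tn; rewrite leNgt; apply/negP => h; apply: not; exists t; split=> //.
have [_ [C HC]] := bH.
have cv : \int[P]_w H (t_ n) w @[n --> \oo] --> \int[P]_w (beta - zeta a1 a2 r d).
  apply: (bounded_convergence (C := Num.max C `|beta - zeta a1 a2 r d|) measurableT (probability_fin P)).
  - by move=> n; exact: bounded_field_slice.
  - exact: measurable_cst.
  - by move=> n w _; rewrite le_max HC.
  - move=> w _; rewrite -(candidate1_d a1_gt0 a2_gt0 r_gt0 d_gt0); apply: cvgD; first exact: cvg_cst.
    apply: continuous_cvg; first exact: continuous_V1.
    by apply: (drawdown_cvg0 w U_adm d_gt0) => n; exact: (ht n).1.
rewrite Rintegral_probability_cst in cv.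
have : a <= beta - zeta a1 a2 r d.
  rewrite -(cvg_lim (@Rhausdorff R) cv); apply: limr_ge; first exact: cvgP cv.
  by apply: nearW => n; apply: ltW; exact: (ht n).2.
by rewrite /a; lra.
Qed.

(* The better strategy pays nothing before time e and u0 afterwards. *)
Lemma vfun_gt_candidate : beta < zeta a1 a2 r d ->
  ((V d)%:E < vfun P W mu sigma u0 r beta d d)%E.
Proof.
move=> bz; have [e e0 he] := expected_slope_near0 bz.
pose u t : R := if t < e then 0 else u0.
have U_adm : admissible P W u0 (fun t _ => u t).
  apply: deterministic_admissible.
    by apply: measurable_fun_ifT => //; apply: measurable_fun_ltr => //; exact: measurable_cst.
  by move=> t _; rewrite /u; case: ifP; rewrite lexx (ltW u0_gt0).
have d0 := ltW d_gt0.
apply: (@lt_le_trans _ _ (vU P W mu sigma r beta d (fun t _ => u t) d)); last first.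
  by apply: ereal_sup_ubound; exists (fun t _ => u t).
rewrite (vUE U_adm d0) (candidate_gap U_adm d0) lte_fin gtrDl.
rewrite pmulr_rlt0 ?invr_gt0//.
(* Bound on the expected gap before time e, when nothing is paid; from e on the gap is 0. *)
pose k := u0 * ((beta - zeta a1 a2 r d) / 2).
have k0 : k < 0 by rewrite pmulr_rlt0// pmulr_llt0// subr_lt0.
pose B : set (measurableTypeR R) := `]-oo, e[%classic.
have mB : measurable B by exact: measurable_itv.
have i1 : nu.-integrable setT (EFin \o (\1_B : measurableTypeR R -> R)).
  exact: integrable_indic.
have iB := integrableZl measurableT k i1.
apply: (@le_lt_trans _ _ (\int[nu]_t (k * \1_B t))).
  apply: (@le_Rintegral _ _ _ nu setT _ (fun t => k * \1_B t) measurableT _ iB).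
    by have [] := bounded_field_expectation P r_gt0 (bounded_field_gap U_adm d0).
  move=> t _; rewrite indicE.
  have [/set_mem|] := boolP (t \in B); last first.
    move=> /negP tB; have et : e <= t.
      by rewrite leNgt; apply/negP => te; apply: tB; apply: mem_set; rewrite /B/= in_itv.
    rewrite mulr0 -(Rintegral_probability_cst P 0) le_eqVlt; apply/orP; left; apply/eqP.
    apply: (@eq_Rintegral _ _ _ P setT) => w _.
    by rewrite /gap /control /u max_r ?(le_trans (ltW e0))// ltNge et subrr mul0r.
  rewrite /B/= in_itv/= => te; rewrite mulr1 /k.
  have m0 : Num.max 0 t < e by rewrite gt_max e0 te.
  (* The drawdown at t depends on the control up to t only, so before e it is that of the zero
     control. *)
  have -> : \int[P]_w gap (fun t _ => u t) d t w =
      u0 * \int[P]_w (beta + V1 (drawdown W mu sigma (fun _ _ => 0) d t w)).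
    have Z_adm : admissible P W u0 (fun _ _ => 0).
      by apply: (@deterministic_admissible (fun=> 0)) => // s _; rewrite lexx ltW.
    rewrite -(RintegralZl u0 measurableT
      (bounded_field_integrable P t (bounded_field_slope Z_adm d0))).
    apply: (@eq_Rintegral _ _ _ P setT) => w _.
    rewrite /gap /control {1}/u m0 subr0 /drawdown (eq_Dproc (U' := fun _ _ => 0))//.
    by move=> s /andP[_ st]; rewrite /u (le_lt_trans st).
  by rewrite ler_pM2l// he.
rewrite (RintegralZl k measurableT i1).
rewrite /Rintegral integral_indic// setIT.
rewrite [X in fine X](exponential_law_below r_gt0 (ltW e0))/= nmulr_rlt0// subr_gt0.
by rewrite -expR0 ltr_expR mulNr oppr_lt0 mulr_gt0.
Qed.

End Verification.

Theorem theorem3p1 (R : realType) (dm : measure_display) (T : measurableType dm)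
  (P : probability T R) (W : R -> T -> R)
  (mu sigma u0 r beta d : R) :
  complete_prob_space P ->
  standard_BM P W ->
  0 < sigma -> 0 < u0 -> 0 < r -> 0 < beta -> 0 < d ->
  let a1 := theta1 mu sigma r u0 in
  let a2 := theta2 mu sigma r u0 in
  ((forall z : R, 0 <= z ->
      vfun P W mu sigma u0 r beta d z =
      ((if z <= d then fbar a1 a2 u0 r beta d z
        else gbar a1 a2 u0 r beta d z))%:E)
   <-> zeta a1 a2 r d <= beta)
  /\ (zeta a1 a2 r d <= beta ->
      forall z : R, 0 <= z ->
        vU P W mu sigma r beta d (fun _ _ => u0) z
        = vfun P W mu sigma u0 r beta d z).
Proof.
move=> Pcomp W_BM sigma_gt0 u0_gt0 r_gt0 _ d_gt0 a1 a2.
have VE z : 0 <= z -> candidate a1 a2 u0 r beta d z =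
    if z <= d then fbar a1 a2 u0 r beta d z else gbar a1 a2 u0 r beta d z.
  exact: candidateE.
split=> [|zb z z0]; last by rewrite vU_full// vfun_candidate.
split=> [H|zb z z0]; last by rewrite -VE// vfun_candidate.
rewrite leNgt; apply/negP => bz.
have := vfun_gt_candidate Pcomp W_BM sigma_gt0 u0_gt0 r_gt0 d_gt0 bz.
by rewrite (H d (ltW d_gt0)) -VE ?(ltW d_gt0)// ltxx.
Qed.
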